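(* Let $-1/h_\tau<\kappa<1/h_\tau$. There exists a matrix $\mu=[\mu_{T,T'}]_{T,T'\in\mathcal{Y}(\tau)}$ of complex Baire measures on $\mathbb{T}^N$ such that $\int_{\mathbb{T}^N}x^{-\alpha}\,\mathrm{d}\mu_{T,T'}(x)=(A_\alpha)_{T,T'}$ for all $\alpha\in\mathbb{Z}^N$, each $\mu_{T,T}$ is a positive measure, and $$\langle f,g\rangle_{\mathbb{T}}=\sum_{T,T'\in\mathcal{Y}(\tau)}\int_{\mathbb{T}^N}\overline{f_T(x)}\,g_{T'}(x)\,\mathrm{d}\mu_{T,T'}(x)$$ for all Laurent polynomials $f,g$ with coefficients in $V_\tau$ (in particular for all $\zeta_{\alpha,T}$), where $f_T$ denotes the coordinates of $f$ in the orthonormal basis $\{\langle T,T\rangle_0^{-1/2}T\}$.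
   Context: Fix $N\ge2$ and a partition $\tau$ of $N$ that is neither $(N)$ nor $(1,\ldots,1)$; $\ell(\tau)$ is its number of nonzero parts, $h_\tau:=\tau_1+\ell(\tau)-1$. A reverse standard Young tableau (RSYT) of shape $\tau$ is a filling of the Ferrers diagram $\{(i,j):1\le i\le\ell(\tau),1\le j\le\tau_i\}$ with $1,\ldots,N$, each once, entries decreasing along each row and down each column; $\mathcal{Y}(\tau)$ is the set of them. For $T\in\mathcal{Y}(\tau)$ the entry $i$ sits in row $\mathrm{rw}(i,T)$, column $\mathrm{cm}(i,T)$, and its content is $c(i,T)=\mathrm{cm}(i,T)-\mathrm{rw}(i,T)$. $V_\tau$ is the vector space with basis $\mathcal{Y}(\tau)$, with Hermitian inner product $\langle T,T'\rangle_0=\delta_{T,T'}\prod_{1\le i<j\le N,\ c(i,T)\le c(j,T)-2}\big(1-(c(i,T)-c(j,T))^{-2}\big)$. The representation $\tau$ of the symmetric group $\mathcal{S}_N$ on $V_\tau$ is defined on simple transpositions $s_i=(i,i+1)$ by: if $i,i+1$ are in the same row of $T$, $\tau(s_i)T=T$; if in the same column, $\tau(s_i)T=-T$; otherwise, with $T^{(i)}$ the RSYT obtained by interchanging $i,i+1$ and $b=1/(c(i,T)-c(i+1,T))$, $\tau(s_i)T=T^{(i)}+bT$ if $\mathrm{rw}(i,T)<\mathrm{rw}(i+1,T)$ and $\tau(s_i)T=(1-b^2)T^{(i)}+bT$ if $\mathrm{rw}(i,T)>\mathrm{rw}(i+1,T)$. Each $\tau(w)$ is orthogonal for $\langle\cdot,\cdot\rangle_0$;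 write $\tau(i,j)$ for $\tau$ of the transposition $(i,j)$. $\kappa$ is a real parameter. $\mathcal{P}_\tau$ is the space of polynomials in $x=(x_1,\ldots,x_N)$ with coefficients in $V_\tau$; $\mathcal{S}_N$ acts by $(wp)(x)=\tau(w)p(xw)$ where $(xw)_i=x_{w(i)}$, and on multi-indices by $(w\alpha)_i=\alpha_{w^{-1}(i)}$. Dunkl operators: $\mathcal{D}_ip(x)=\partial_ip(x)+\kappa\sum_{j\ne i}\tau(i,j)\frac{p(x)-p(x(i,j))}{x_i-x_j}$; Cherednik–Dunkl operators: $\mathcal{U}_ip(x)=\mathcal{D}_i(x_ip(x))-\kappa\sum_{j<i}\tau(i,j)p(x(i,j))$. For $\alpha\in\mathbb{N}_0^N$, $\alpha^+$ is its nonincreasing rearrangement; $\alpha\prec\beta$ means $\sum_{j\le i}\alpha_j\le\sum_{j\le i}\beta_j$ for all $i$ and $\alpha\ne\beta$; $\alpha\vartriangleleft\beta$ means $|\alpha|=|\beta|$ and ($\alpha^+\prec\beta^+$, or $\alpha^+=\beta^+$ and $\alpha\prec\beta$). The rank function $r_\alpha(i)=\#\{j:\alpha_j>\alpha_i\}+\#\{j\le i:\alpha_j=\alpha_i\}$ is a permutation. The nonsymmetric Jack polynomial $\zeta_{\alpha,T}$ ($\alpha\in\mathbb{N}_0^N$, $T\in\mathcal{Y}(\tau)$) is the unique element of $\mathcal{P}_\tau$ of the form $x^\alpha\otimes\tau(r_\alpha^{-1})T+\sum_{\beta\vartriangleleft\alpha}x^\beta\otimes t_{\alpha\beta}$ with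 $\mathcal{U}_i\zeta_{\alpha,T}=\xi_{\alpha,T}(i)\zeta_{\alpha,T}$, $\xi_{\alpha,T}(i)=\alpha_i+1+\kappa c(r_\alpha(i),T)$, $1\le i\le N$. $\kappa$ is generic if $(\alpha,T)\ne(\beta,T')$ implies $\xi_{\alpha,T}\ne\xi_{\beta,T'}$; then $\{\zeta_{\alpha,T}\}$ is a basis of $\mathcal{P}_\tau$. For $\varepsilon=\pm1$, $\mathcal{E}_\varepsilon(\alpha,T)=\prod_{1\le i<j\le N,\ \alpha_i<\alpha_j}\big(1+\frac{\varepsilon\kappa}{\alpha_j-\alpha_i+\kappa(c(r_\alpha(j),T)-c(r_\alpha(i),T))}\big)$. The Hermitian form $\langle\cdot,\cdot\rangle_{\mathbb{T}}$ on $\mathcal{P}_\tau$ (conjugate-linear in the first argument) is defined by $\langle\zeta_{\alpha,T},\zeta_{\beta,T'}\rangle_{\mathbb{T}}=0$ if $(\alpha,T)\ne(\beta,T')$, $\langle\zeta_{\lambda,T},\zeta_{\lambda,T}\rangle_{\mathbb{T}}=\langle T,T\rangle_0\prod_{1\le i<j\le N}\prod_{\ell=1}^{\lambda_i-\lambda_j}\big(1-\big(\frac{\kappa}{\ell+\kappa(c(i,T)-c(j,T))}\big)^2\big)$ for partitions $\lambda$, and $\langle\zeta_{\alpha,T},\zeta_{\alpha,T}\rangle_{\mathbb{T}}=(\mathcal{E}_1(\alpha,T)\mathcal{E}_{-1}(\alpha,T))^{-1}\langle\zeta_{\alpha^+,T},\zeta_{\alpha^+,T}\rangle_{\mathbb{T}}$.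 The form extends to $V_\tau$-valued Laurent polynomials via $\zeta_{\alpha,T}:=(x_1\cdots x_N)^{-m}\zeta_{\alpha+m\mathbf{1},T}$ for $\alpha\in\mathbb{Z}^N$, $m\ge-\min_i\alpha_i$ (same defining formulas). For $-1/h_\tau<\kappa<1/h_\tau$ the $\zeta_{\alpha,T}$ and the form are well defined (the latter then positive definite). Coefficient matrices: $\boldsymbol{Z}_N=\{\gamma\in\mathbb{Z}^N:\sum_i\gamma_i=0\}$. For $\gamma\in\boldsymbol{Z}_N$ let $\gamma^\pi_i=\max(\gamma_i,0)$, $\gamma^\nu_i=\max(-\gamma_i,0)$; $(A_\gamma)_{T,T'}=(\langle T,T\rangle_0\langle T',T'\rangle_0)^{-1/2}\langle x^{\gamma^\pi}\otimes T,x^{\gamma^\nu}\otimes T'\rangle_{\mathbb{T}}$ for $\gamma\in\boldsymbol{Z}_N$, $A_\gamma=0$ otherwise. $\mathbb{T}^N=\{x\in\mathbb{C}^N:|x_j|=1\}$. *)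

(* Defs.v *)
From HB Require Import structures.
From Stdlib Require Import ClassicalEpsilon.
From mathcomp Require Import all_boot all_order all_algebra all_fingroup.
From mathcomp Require Import all_classical all_reals all_analysis.
From mathcomp Require Import complex.

Set Implicit Arguments.
Unset Strict Implicit.
Unset Printing Implicit Defensive.

Import Order.TTheory GRing.Theory Num.Theory numFieldNormedType.Exports.
Local Open Scope ring_scope.
Local Open Scope complex_scope.

(* complex numbers R[i] are given their (trivial) pointed structure, needed  *)
(* to build a measurable space on (C^N).                                      *)
HB.instance Definition _ (R : rcfType) := isPointed.Build (complex R) 0.

Definition is_partition_of (N : nat) (t : seq nat) : bool :=
  [&& sorted geq t, all (fun k => 0 < k)%N t & sumn t == N].

Definition hook (t : seq nat) : nat := (head 0%N t + size t - 1)%N.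

Section Tableaux.
Variables (N : nat) (t : seq nat).

(* cells are (row, column), 0-based: row r < l(tau), column c < tau_{r+1} *)
Definition in_diagram (rc : 'I_N * 'I_N) : bool :=
  (rc.1 < size t)%N && (rc.2 < nth 0%N t rc.1)%N.

(* A filling is described by the map  entry -> cell ; entry k : 'I_N stands *)
(* for the number k+1 in {1,..,N}.  Each number is used once (injectivity),  *)
(* all cells are in the Ferrers diagram (hence, since |tau| = N, the map is  *)
(* a bijection onto the diagram), entries decrease along rows and columns.   *)
Definition is_rsyt (f : {ffun 'I_N -> 'I_N * 'I_N}) : bool :=
  [&& injectiveb f, [forall i, in_diagram (f i)],
      [forall i, forall j,
         (((f i).1 == (f j).1) && ((f i).2 < (f j).2)%N) ==> (j < i)%N] &
      [forall i, forall j,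
         (((f i).2 == (f j).2) && ((f i).1 < (f j).1)%N) ==> (j < i)%N]].

Definition rsyt := {f : {ffun 'I_N -> 'I_N * 'I_N} | is_rsyt f}.

Definition rw (k : 'I_N) (T : rsyt) : nat := ((val T k).1).+1.
Definition cm (k : 'I_N) (T : rsyt) : nat := ((val T k).2).+1.
Definition content (k : 'I_N) (T : rsyt) : int := (cm k T)%:Z - (rw k T)%:Z.

End Tableaux.

Section Main.
Variables (R : realType) (N : nat) (t : seq nat) (kappa : R).

Local Notation C := (R[i]).
Local Notation Y := (rsyt N t).
Local Notation c := (@content N t).

Definition norm0 (T : Y) : R :=
  \prod_(i < N) \prod_(j < N | (i < j)%N && (c i T <= c j T - 2))
     (1 - (((c i T - c j T)%:~R : R) ^- 2)).

(* V_tau : coordinates w.r.t. the basis Y(tau) *)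
Definition V := {ffun Y -> C}.
Definition basisv (T : Y) : V := [ffun T' => (T' == T)%:R].

(* linear operators on V; A T' T = coefficient of T' in A(T) *)
Definition Op := Y -> Y -> C.
Definition opmul (A B : Op) : Op := fun T1 T3 => \sum_(T2 : Y) A T1 T2 * B T2 T3.
Definition opv (A : Op) (v : V) : V := [ffun T' => \sum_(T : Y) A T' T * v T].

(* tau(s) for s = (a,b) with a, b consecutive entries, b = a+1 *)
Definition swap_filling (T : Y) (a b : 'I_N) : {ffun 'I_N -> 'I_N * 'I_N} :=
  [ffun k => val T (tperm a b k)].

Definition tau_s (a b : 'I_N) : Op := fun T' T =>
  if rw a T == rw b T then (T' == T)%:R
  else if cm a T == cm b T then - (T' == T)%:R
  else
    let bb : C := ((c a T - c b T)%:~R)^-1 in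
    (if val T' == swap_filling T a b then
       (if (rw a T < rw b T)%N then 1 else 1 - bb ^+ 2) else 0)
    + (if T' == T then bb else 0).

(* the representation tau of S_N, determined by its values on the simple   *)
(* transpositions s_i = (i, i+1).  With mathcomp's convention              *)
(* (u * v) x = v (u x), the usual composition u o v is  v * u .             *)
Definition is_tau_rep (rho : {perm 'I_N} -> Op) : Prop :=
  (forall u v : {perm 'I_N}, rho (v * u)%g = opmul (rho u) (rho v)) /\
  (forall (i : 'I_N) (h : (i.+1 < N)%N),
     rho (tperm i (Ordinal h)) = tau_s i (Ordinal h)).

Definition rep : {perm 'I_N} -> Op :=
  epsilon (inhabits (fun _ _ _ => 0)) is_tau_rep.

Definition K := {ffun 'I_N -> int}.
Definition LP := K -> V.

Definition is_lp (p : LP) : Prop := exists s : seq K, forall k, p k != 0 -> k \in s.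
Definition is_poly (p : LP) : Prop :=
  is_lp p /\ forall k, p k != 0 -> forall m, 0 <= k m.

Definition lp_add (p q : LP) : LP := fun k => p k + q k.
Definition lp_sub (p q : LP) : LP := fun k => p k - q k.
Definition lp_scale (a : C) (p : LP) : LP := fun k => a *: p k.
Definition lp_mulx (e : K) (p : LP) : LP := fun k => p (k - e).
Definition lp_mono (e : K) (v : V) : LP := fun k => if k == e then v else 0.
(* p(x (i,j)), where (x w)_m = x_{w(m)} *)
Definition lp_swapx (i j : 'I_N) (p : LP) : LP :=
  fun k => p [ffun m => k (tperm i j m)].
Definition lp_op (A : Op) (p : LP) : LP := fun k => opv A (p k).

Definition unitK (i : 'I_N) : K := [ffun m => (m == i)%:Z].
Definition constK (m : int) : K := [ffun _ => m].

Definition lp_deriv (i : 'I_N) (p : LP) : LP :=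
  fun k => ((k i + 1)%:~R : C) *: p (k + unitK i).

(* divided difference (p(x) - p(x(i,j)))/(x_i - x_j) : the unique Laurent  *)
(* polynomial q with (x_i - x_j) q = p - p(x(i,j))                         *)
Definition lp_divdiff (i j : 'I_N) (p : LP) : LP :=
  epsilon (inhabits (fun _ => 0))
    (fun q => is_lp q /\
      lp_sub (lp_mulx (unitK i) q) (lp_mulx (unitK j) q) = lp_sub p (lp_swapx i j p)).

Definition dunkl (i : 'I_N) (p : LP) : LP := fun k =>
  lp_deriv i p k
  + (kappa%:C) *: \sum_(j < N | j != i) opv (rep (tperm i j)) (lp_divdiff i j p k).

Definition cdunkl (i : 'I_N) (p : LP) : LP := fun k =>
  dunkl i (lp_mulx (unitK i) p) k
  - (kappa%:C) *: \sum_(j < N | (j < i)%N) opv (rep (tperm i j)) (lp_swapx i j p k).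

(* r_alpha(i) (1-based) = #{j : a_j > a_i} + #{j <= i : a_j = a_i};        *)
(* here the 0-based value r_alpha(i) - 1.                                    *)
Definition rank_nat (a : K) (i : 'I_N) : nat :=
  (#|[pred j : 'I_N | a j > a i]| + #|[pred j : 'I_N | (j <= i)%N && (a j == a i)]|).-1.

Definition rankp (a : K) : {perm 'I_N} :=
  odflt 1%g [pick r : {perm 'I_N} | [forall i, (r i : nat) == rank_nat a i]].

Definition plus (a : K) : K :=
  [ffun m : 'I_N => nth 0 (sort (fun x y : int => y <= x) [seq a i | i <- enum 'I_N]) m].

Definition sumK (a : K) : int := \sum_(i < N) a i.
Definition psum (a : K) (i : 'I_N) : int := \sum_(j < N | (j <= i)%N) a j.

Definition prec (a b : K) : bool := [forall i, psum a i <= psum b i] && (a != b).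
Definition dom (a b : K) : bool :=
  (sumK a == sumK b) && (prec (plus a) (plus b) || ((plus a == plus b) && prec a b)).

Definition xi (a : K) (T : Y) (i : 'I_N) : C :=
  ((a i + 1)%:~R : C) + kappa%:C * (c (rankp a i) T)%:~R.

(* nonsymmetric Jack polynomial zeta_{alpha,T}, alpha in N^N *)
Definition is_zeta (a : K) (T : Y) (p : LP) : Prop :=
  [/\ is_poly p,
      p a = opv (rep (rankp a)^-1) (basisv T),
      (forall b, b != a -> p b != 0 -> dom b a) &
      (forall i, cdunkl i p = lp_scale (xi a T i) p)].

Definition zeta (a : K) (T : Y) : LP := epsilon (inhabits (fun _ => 0)) (is_zeta a T).

(* extension to alpha in Z^N: zeta_{alpha,T} = (x_1..x_N)^{-m} zeta_{alpha + m1,T} *)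
(* with m = sum_i |alpha_i| >= - min_i alpha_i                                   *)
Definition shiftm (a : K) : int := (\sum_(i < N) `|a i|)%N%:Z.
Definition zetaL (a : K) (T : Y) : LP :=
  lp_mulx (constK (- shiftm a)) (zeta (a + constK (shiftm a)) T).

Definition Eps (e : R) (a : K) (T : Y) : R :=
  \prod_(i < N) \prod_(j < N | (i < j)%N && (a i < a j))
    (1 + e * kappa / ((a j - a i)%:~R
                       + kappa * (c (rankp a j) T - c (rankp a i) T)%:~R)).

Definition normsq_part (l : K) (T : Y) : R :=
  norm0 T * \prod_(i < N) \prod_(j < N | (i < j)%N)
    \prod_(1 <= m < `|l i - l j|.+1)
       (1 - (kappa / (m%:R + kappa * (c i T - c j T)%:~R)) ^+ 2).

Definition normsq (a : K) (T : Y) : R :=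
  (Eps 1 a T * Eps (-1) a T)^-1 * normsq_part (plus a) T.

Definition is_lpform (B : LP -> LP -> C) : Prop :=
  [/\ (forall f1 f2 g (z : C), is_lp f1 -> is_lp f2 -> is_lp g ->
         B (lp_add (lp_scale z f1) f2) g = z^* * B f1 g + B f2 g),
      (forall f g1 g2 (z : C), is_lp f -> is_lp g1 -> is_lp g2 ->
         B f (lp_add (lp_scale z g1) g2) = z * B f g1 + B f g2) &
      (forall a T b T', B (zetaL a T) (zetaL b T') =
         if (a == b) && (T == T') then (normsq a T)%:C else 0)].

Definition lpform : LP -> LP -> C := epsilon (inhabits (fun _ _ => 0)) is_lpform.

Definition posK (g : K) : K := [ffun i => Num.max (g i) 0].
Definition negK (g : K) : K := [ffun i => Num.max (- g i) 0].
Definition Amat (g : K) (T T' : Y) : C :=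
  if sumK g == 0 then
    ((Num.sqrt (norm0 T * norm0 T'))^-1)%:C
      * lpform (lp_mono (posK g) (basisv T)) (lp_mono (negK g) (basisv T'))
  else 0.

Local Open Scope classical_set_scope.

(* Borel sigma-algebra of C^N: generated by the preimages of open sets of R *)
(* under the real and imaginary parts of the coordinates.                   *)
Definition cgen : set (set ('I_N -> C)) :=
  [set A | exists (j : 'I_N) (U : set R), open U /\
     (A = (fun x => complex.Re (x j)) @^-1` U \/
      A = (fun x => complex.Im (x j)) @^-1` U)].

Definition CN := g_sigma_algebraType cgen.

Definition torus : set CN := [set x | forall j, `|x j| = 1].

(* A complex measure mu = (nu0 - nu1) + i (nu2 - nu3), nu_k finite positive *)
(* measures (Jordan decomposition); only its restriction to the torus is   *)
(* used.                                                                    *)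
Definition cmeasure := 'I_4 -> {finite_measure set CN -> \bar R}.

Definition rint (nu : {finite_measure set CN -> \bar R}) (f : CN -> C) : C :=
  (Rintegral nu torus (fun x => complex.Re (f x)))
    +i* (Rintegral nu torus (fun x => complex.Im (f x))).

Definition cint (mu : cmeasure) (f : CN -> C) : C :=
  (rint (mu 0%R) f - rint (mu 1%R) f) + 'i * (rint (mu 2%:R) f - rint (mu 3%:R) f).

Definition cm_positive (mu : cmeasure) : Prop :=
  forall A : set CN, measurable A -> A `<=` torus ->
    mu 2%:R A = mu 3%:R A /\ (mu 1%R A <= mu 0%R A)%E.

Definition xpow (x : CN) (e : K) : C := \prod_(j < N) (x j) ^ (e j).

(* f_T(x): coordinate of f(x) in the orthonormal basis <T,T>_0^{-1/2} T *)
Definition lp_coord (f : LP) (T : Y) (x : CN) : C :=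
  (Num.sqrt (norm0 T))%:C *
  \sum_(k <- epsilon (inhabits [::]) (fun s : seq K => uniq s /\ forall k, f k != 0 -> k \in s))
     f k T * xpow x k.

End Main.

(* Main.v *)
(* The form is shown to be invariant under multiplication by monomials, after which the theorem is
   the Herglotz-Bochner theorem on Z^N.
   The seminormal matrices satisfy the Coxeter relations and the Cherednik-Dunkl operators the
   relations of the graded affine Hecke algebra. Since |kappa| h_tau < 1 separates the spectral
   vectors of distinct compositions, the Jack polynomials exist even for non-generic kappa: they
   are produced from the constants by the intertwiners of the s_i and of the affine step
   omega = (cyclic shift) x_1. Each s_i maps a Jack polynomial into the span of two of them, and the
   norm formulas are exactly what makes s_i symmetric; omega permutes the Jack polynomials and
   preserves their norms. Hence the S_N action and omega are unitary, and so is x_1.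
   For v in V_tau, gamma |-> <x^gamma v, v> is then positive definite on Z^N. Its Fejer means on
   finite grids are nonnegative weights; a weak limit of these is a measure on the torus with the
   prescribed moments, and polarization in v gives the matrix of measures. *)
Require Import Defs.
From HB Require Import structures.
From mathcomp Require Import all_boot all_order all_algebra all_fingroup.
From mathcomp Require Import all_classical all_reals all_analysis.
From mathcomp Require Import complex.
From mathcomp Require Import measurable_realfun.
From mathcomp Require Import zify ring lra.
Import Order.TTheory GRing.Theory Num.Theory numFieldNormedType.Exports.
Set Implicit Arguments.
Unset Strict Implicit.
Unset Printing Implicit Defensive.
Local Open Scope ring_scope.
Local Open Scope complex_scope.

(** * Coxeter words and actions of the symmetric group *)

(** The hypothesis on [kappa] is used as [|kappa| * hook t < 1], twice. Contents of two cells of the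
    shape differ by at most [hook t - 1], so [kappa] times such a difference is less than 1 in
    absolute value and cannot compensate a nonzero difference of integers [a i]. The same bound
    gives [|kappa| < |l + kappa * (c - c')|] for every integer [l != 0], which makes all factors of
    the norms positive. The eigenvalues separate compositions but not tableaux: for [kappa = 0] they
    do not see the tableau at all. Uniqueness of a Jack polynomial therefore rests on its
    coefficient at [a]: a joint eigenvector with the eigenvalues of [(a, T)] whose coefficient at
    [a] vanishes is zero. The representation, the divided differences, the Jack polynomials and the
    form are all chosen by [epsilon]. Nothing is known about any of them until an object with the
    required properties has been exhibited, which is why existence is proved each time before the
    first use. *)

Section WordAction.
Variables (X : Type) (t : nat -> X -> X).

Definition wact (s : seq nat) (x : X) : X := foldr t x s.

(** Off by one: [n] generators [t 0, ..., t n.-1], as for the symmetric group on [n.+1] letters. *)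
Definition coxeter (n : nat) : Prop :=
  [/\ forall i x, (i < n)%N -> t i (t i x) = x,
      forall i j x, (i.+1 < j)%N -> (j < n)%N -> t i (t j x) = t j (t i x) &
      forall i x, (i.+1 < n)%N -> t i (t i.+1 (t i x)) = t i.+1 (t i (t i.+1 x))].

Lemma coxeter_leq m n : (m <= n)%N -> coxeter n -> coxeter m.
Proof.
move=> mn [h1 h2 h3]; split.
- by move=> i x im; apply: h1; apply: leq_trans mn.
- by move=> i j x ij jm; apply: h2 => //; apply: leq_trans mn.
- by move=> i x im; apply: h3; apply: leq_trans mn.
Qed.

Lemma wact_cat s1 s2 x : wact (s1 ++ s2) x = wact s1 (wact s2 x).
Proof. by rewrite /wact foldr_cat. Qed.

(** The word [rev (iota j m)] is the descending run [j + m - 1, ..., j]; its last letter [j] acts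
    first. *)
Lemma wact_desc j m x :
  wact (rev (iota j m.+1)) x = wact (rev (iota j.+1 m)) (t j x).
Proof. by rewrite /= rev_cons -cats1 wact_cat. Qed.

Variables (n : nat) (cox : coxeter n).

Lemma wact_revK s x : all (gtn n) s -> wact (rev s) (wact s x) = x.
Proof.
case: cox => inv _ _; elim: s => [|i s IH] //= /andP[i_n sn].
by rewrite rev_cons -cats1 wact_cat /= inv ?IH.
Qed.

Lemma wact_desc_comm i j m x : (i.+1 < j)%N -> (j + m <= n)%N ->
  wact (rev (iota j m)) (t i x) = t i (wact (rev (iota j m)) x).
Proof.
case: cox => _ comm _; elim: m j x => [|m IH] j x ij jm //.
rewrite !wact_desc -IH; [|lia|lia].
by rewrite (comm i j) //; lia.
Qed.

(** A generator inside a descending run commutes with the letters below [i.-1]; on meeting [i.-1]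
    the braid relation turns it into [t i.-1], which commutes with the rest of the run. *)
Lemma wact_desc_shift i j m x : (j < i)%N -> (i < j + m)%N -> (j + m <= n)%N ->
  wact (rev (iota j m)) (t i x) = t i.-1 (wact (rev (iota j m)) x).
Proof.
case: cox => inv comm braid; elim: m j x => [|m IH] j x ji im jm; first lia.
have [ij|ij] := eqVneq i j.+1.
  subst i; case: m IH im jm => [|m] IH im jm; first lia.
  rewrite !(wact_desc j m.+1) !(wact_desc j.+1 m) -braid; last by lia.
  by rewrite wact_desc_comm //; lia.
rewrite !wact_desc comm; [|lia|lia].
by rewrite IH //; lia.
Qed.

(* Every word is equivalent to one in the first n - 1 generators followed by a
   descending run n-1, ..., j: coset representatives of S_n in S_n.+1. *)
Lemma wact_normal_form s : all (gtn n) s ->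
  exists s' j, [/\ all (gtn n.-1) s', (j <= n)%N &
    forall x, wact s x = wact s' (wact (rev (iota j (n - j))) x)].
Proof.
case: (cox) => inv _ _; elim/last_ind: s => [|s i IH].
  by move=> _; exists [::], n; split => //= x; rewrite subnn.
rewrite all_rcons => /andP[/= i_n /IH[s' [j [s'n jn e]]]].
(* A new first letter [i] commutes past the run, lengthens it ([i.+1 = j]), cancels its last letter
   ([i = j]), or crosses it with index lowered by one. *)
have [ij|ij] := ltnP i.+1 j.
  exists (rcons s' i), j; split => //.
    by rewrite all_rcons s'n andbT /=; lia.
  by move=> x; rewrite -!cats1 !wact_cat /= e wact_desc_comm //; lia.
have [ij'|ij'] := eqVneq i.+1 j.
  exists s', i; split => //; first lia.
  move=> x; rewrite -!cats1 !wact_cat /= e -ij'.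
  have -> : (n - i = (n - i.+1).+1)%N by lia.
  by rewrite wact_desc.
have [ij''|ij''] := eqVneq i j.
  exists s', j.+1; split => //; first lia.
  move=> x; rewrite -!cats1 !wact_cat /= e ij''.
  have -> : (n - j = (n - j.+1).+1)%N by lia.
  by rewrite wact_desc -ij'' inv.
exists (rcons s' i.-1), j; split => //.
  by rewrite all_rcons s'n andbT /=; lia.
move=> x; rewrite -!cats1 !wact_cat /= e wact_desc_shift //; lia.
Qed.

End WordAction.

Definition adj_swap (i k : nat) : nat :=
  if k == i then i.+1 else if k == i.+1 then i else k.

Lemma coxeter_adj_swap n : coxeter adj_swap n.
Proof. by split; move=> *; rewrite /adj_swap; repeat case: eqP; lia. Qed.

Lemma wact_adj_swap_fix s n k : all (gtn n) s -> (n < k)%N -> wact adj_swap s k = k.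
Proof.
elim: s => [|i s IH] //= /andP[i_n sn] nk; rewrite IH // /adj_swap.
by repeat case: eqP; lia.
Qed.

Lemma wact_adj_swap_desc j m : wact adj_swap (rev (iota j m)) j = (j + m)%N.
Proof.
elim: m j => [|m IH] j; first by rewrite addn0.
by rewrite wact_desc {2}/adj_swap eqxx IH addSnnS.
Qed.

(** The normal form is taken for the product of [t] with the action on numbers, so that one pair
    [s'], [j] serves both. The run sends [j] to [n.+1], which [s'] fixes; a word fixing all numbers
    thus has an empty run, and induction applies to [s']. *)
Lemma coxeter_faithful (X : Type) (t : nat -> X -> X) n s : coxeter t n ->
  all (gtn n) s -> (forall k, wact adj_swap s k = k) -> forall x, wact t s x = x.
Proof.
elim: n s => [|n IH] s cox sn sid x; first by case: s sn {sid}.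
pose t2 i (y : X * nat) := (t i y.1, adj_swap i y.2).
have wt2 u y : wact t2 u y = (wact t u y.1, wact adj_swap u y.2).
  by elim: u => [|i u /= ->] //; case: y.
have cox2 : coxeter t2 n.+1.
  case: cox => c1 c2 c3; case: (coxeter_adj_swap n.+1) => d1 d2 d3.
  split=> [i [y k] h|i j [y k] h h'|i [y k] h]; rewrite /t2 /=.
  - by congr pair; [apply: c1|apply: d1].
  - by congr pair; [apply: c2|apply: d2].
  - by congr pair; [apply: c3|apply: d3].
have [s' [j [s'n jn e]]] := wact_normal_form cox2 sn.
have e1 y : wact t s y = wact t s' (wact t (rev (iota j (n.+1 - j))) y).
  by have := congr1 fst (e (y, 0%N)); rewrite !wt2.
have e2 k : wact adj_swap s k = wact adj_swap s' (wact adj_swap (rev (iota j (n.+1 - j))) k).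
  by have := congr1 snd (e (x, k)); rewrite !wt2.
have jn1 : j = n.+1.
  have := e2 j; rewrite wact_adj_swap_desc sid subnKC // => ->.
  by rewrite (wact_adj_swap_fix s'n).
rewrite jn1 subnn /= in e1 e2.
rewrite e1 IH //; first by apply: coxeter_leq cox.
by move=> k; rewrite -e2 sid.
Qed.

(** * From Coxeter relations to actions of the symmetric group *)

Section SymmetricGroup.
Variable n : nat.
Local Notation N := n.+1.

Definition stp (i : nat) : {perm 'I_N} := tperm (inord i) (inord i.+1).

Lemma stpE i (k : 'I_N) : (i < n)%N -> (stp i k : nat) = adj_swap i k.
Proof.
move=> i_n; rewrite /stp permE /= /adj_swap -!val_eqE /= !inordK ?ltnS ?(ltnW i_n) //.
by case: eqP => [|_]; [rewrite inordK|case: eqP => _ //; rewrite inordK //; lia].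
Qed.

(** Transpositions are products of adjacent ones: [(i j)] is [(i j-1)] conjugated by [(j-1 j)], by
    induction on the distance. *)
Lemma stp_ind (P : {perm 'I_N} -> Prop) : P 1%g ->
  (forall w i, (i < n)%N -> P w -> P (w * stp i)%g) -> forall w, P w.
Proof.
move=> P1 Pmul.
have Pt d (i j : 'I_N) w : (i + d.+1)%N = j -> P w -> P (w * tperm i j)%g.
  elim: d i j w => [|d IH] i j w ij Pw.
    have -> : tperm i j = stp i.
      rewrite /stp; congr tperm; apply: val_inj; rewrite /= inordK ?ltn_ord //; have := ltn_ord j; lia.
    by apply: (Pmul) => //; have := ltn_ord j; lia.
  have jn := ltn_ord j.
  pose j' : 'I_N := inord j.-1.
  have j'E : j' = j.-1 :> nat by rewrite inordK //; lia.
  have -> : tperm i j = (stp j' * tperm i j' * stp j')%g.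
    have -> : stp j' = tperm j' j.
      rewrite /stp; congr tperm; apply: val_inj; rewrite /= ?inordK ?j'E //; lia.
    have -> : tperm i j = (tperm i j' ^ tperm j' j)%g.
      rewrite tpermJ tpermL tpermD //; apply/eqP => /(congr1 val) /=; rewrite ?j'E; lia.
    by rewrite conjgE tpermV mulgA.
  rewrite !mulgA; apply: (Pmul); first lia.
  by apply: IH; [lia|apply: (Pmul) => //; lia].
move=> w; have [ts -> _] := prod_tpermP w.
elim/last_ind: ts => [|ts [i j] IH]; first by rewrite big_nil.
rewrite -cats1 big_cat big_seq1 /=.
have [ij|ji|/val_inj ->] := ltngtP i j.
- by apply: (Pt (j - i).-1) => //; lia.
- by rewrite tpermC; apply: (Pt (i - j).-1) => //; lia.
- by rewrite tperm1 mulg1.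
Qed.

Lemma stp_word (w : {perm 'I_N}) :
  exists s, all (gtn n) s /\ forall k : 'I_N, (w k : nat) = wact adj_swap s k.
Proof.
elim/stp_ind: w => [|w i i_n [s [sn e]]].
  by exists [::]; split => // k; rewrite perm1.
by exists (i :: s); split => [|k] /=; [rewrite i_n|rewrite permM stpE // e].
Qed.

Variables (X : Type) (t : nat -> X -> X) (cox : coxeter t n).

(** By [coxeter_faithful] the effect of a word depends only on its permutation, so any choice of
    words gives an action. The second clause carries a property of maps, such as linearity, from the
    generators to all [rho w]. *)
Lemma coxeter_action : exists2 rho : {perm 'I_N} -> X -> X,
  (forall u v x, rho (v * u)%g x = rho u (rho v x)) /\
  (forall i x, (i < n)%N -> rho (stp i) x = t i x) &
  forall (P : (X -> X) -> Prop), P id ->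
    (forall i f, (i < n)%N -> P f -> P (t i \o f)) -> forall w, P (rho w).
Proof.
pose wd w := sval (cid (stp_word w)).
have wdP w : all (gtn n) (wd w) /\ forall k : 'I_N, (w k : nat) = wact adj_swap (wd w) k.
  by rewrite /wd; case: cid.
have uniq s1 s2 : all (gtn n) s1 -> all (gtn n) s2 ->
    (forall k : 'I_N, wact adj_swap s1 k = wact adj_swap s2 k) ->
    forall x, wact t s1 x = wact t s2 x.
  move=> s1n s2n e x.
  have s12 : forall x, wact t (rev s2 ++ s1) x = x.
    apply: (coxeter_faithful cox); first by rewrite all_cat all_rev s2n.
    move=> k; rewrite wact_cat; have [kn|kn] := ltnP k N.
      rewrite (e (Ordinal kn)) (wact_revK (coxeter_adj_swap n)) //.
    by rewrite (wact_adj_swap_fix s1n kn) (@wact_adj_swap_fix _ n) ?all_rev.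
  have := congr1 (wact t s2) (s12 x); rewrite wact_cat => <-.
  by have := @wact_revK _ _ _ cox (rev s2) (wact t s1 x); rewrite revK all_rev => ->.
exists (fun w => wact t (wd w)).
  split=> [u v x|i x i_n].
    rewrite -wact_cat; apply: uniq.
    - by case: (wdP (v * u)%g).
    - by rewrite all_cat; case: (wdP u) => ->; case: (wdP v) => ->.
    move=> k; rewrite wact_cat; case: (wdP (v * u)%g) => _ <-.
    by case: (wdP v) => _ <-; case: (wdP u) => _ <-; rewrite permM.
  rewrite -[RHS]/(wact t [:: i] x); apply: uniq; first by case: (wdP (stp i)).
    by rewrite /= i_n.
  by move=> k; case: (wdP (stp i)) => _ <-; rewrite stpE.
move=> P P1 PM w; case: (wdP w) => + _; elim: (wd w) => [|i s IH] //= /andP[i_n /IH].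
exact: PM.
Qed.

End SymmetricGroup.

(** * Tableaux *)

Section Tableaux.
Variables (n : nat) (t : seq nat).
Local Notation N := n.+1.
Local Notation F := {ffun 'I_N -> 'I_N * 'I_N}.
Local Notation Y := (rsyt N t).
Hypothesis tP : is_partition_of N t.

Lemma part_nth_leq r r' : (r <= r')%N -> (nth 0 t r' <= nth 0 t r)%N.
Proof.
move=> rr'; have [h|h] := ltnP r' (size t); last by rewrite nth_default.
case/and3P: tP => st _ _.
have gt : transitive geq by move=> x y z /= h1 h2; apply: leq_trans h1.
have gr : reflexive geq by move=> x /=.
by apply: (sorted_leq_nth gt gr 0%N st) => //; rewrite inE // (leq_ltn_trans rr').
Qed.

Lemma nth_leq_sumn (s : seq nat) r : (nth 0 s r <= sumn s)%N.
Proof.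
by elim: s r => [|x s IH] [|r] //=; rewrite ?leq_addr // (leq_trans (IH r)) ?leq_addl.
Qed.

Lemma part_nth_N r : (nth 0 t r <= N)%N.
Proof. by case/and3P: tP => _ _ /eqP <-; apply: nth_leq_sumn. Qed.

Lemma part_size : (size t <= N)%N.
Proof.
case/and3P: tP => _ + /eqP <-; elim: t => [|x s IH] //= /andP[x0 /IH h].
by rewrite -add1n leq_add.
Qed.

Lemma part_sum : (\sum_(r < N) nth 0 t r = N)%N.
Proof.
case/and3P: tP => _ _ /eqP st; rewrite -[RHS]st sumnE (big_nth 0%N) big_mkord.
rewrite [RHS](big_ord_widen _ (fun r => nth 0%N t r) part_size) [RHS]big_mkcond /=.
by apply: eq_bigr => r _; case: ltnP => // h; rewrite nth_default.
Qed.

Lemma card_diagram : #|[pred rc : 'I_N * 'I_N | in_diagram t rc]| = N.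
Proof.
rewrite -sum1_card.
rewrite (eq_bigl (fun p : 'I_N * 'I_N => true && (p.2 < nth 0 t p.1)%N)); last first.
  move=> [r c]; rewrite inE /in_diagram /=.
  by have [//|h] := ltnP r (size t); rewrite nth_default.
rewrite -(pair_big_dep xpredT (fun r c : 'I_N => (c < nth 0 t r)%N) (fun _ _ => 1%N)) /=.
rewrite -[RHS]part_sum; apply: eq_bigr => r _.
rewrite sum1_card -[RHS]card_ord.
rewrite -(@fintype.card_image _ _ (widen_ord (part_nth_N r))); last first.
  by move=> x y /(congr1 val)/= /val_inj.
apply: eq_card => c; apply/idP/fintype.imageP => [h|[x _ ->]]; last exact: (ltn_ord x).
by exists (Ordinal h) => //; apply: val_inj.
Qed.

(** An injection of [N] entries into a diagram of [N] cells is onto. *)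
Lemma rsyt_surj (f : F) rc : is_rsyt t f -> in_diagram t rc -> exists k, f k = rc.
Proof.
case/and4P=> /injectiveP f_inj /forallP fd _ _ rcd.
have : rc \in codom f.
  have /subset_leqif_card [_] : codom f \subset [pred x | in_diagram t x].
    by apply/fintype.subsetP => x /codomP[k ->]; rewrite inE.
  rewrite card_codom // card_ord card_diagram eqxx => /esym/fintype.subsetP; apply.
  by rewrite inE.
by case/codomP=> k ->; exists k.
Qed.

Lemma rsyt_inj (f : F) : is_rsyt t f -> injective f.
Proof. by case/and4P=> /injectiveP. Qed.

Lemma rsyt_in (f : F) k : is_rsyt t f -> in_diagram t (f k).
Proof. by case/and4P=> _ /forallP. Qed.

Lemma in_diagram_leq (a b : 'I_N * 'I_N) :
  (a.1 <= b.1)%N -> (a.2 <= b.2)%N -> in_diagram t b -> in_diagram t a.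
Proof.
rewrite /in_diagram => h1 h2 /andP[h3 h4]; rewrite (leq_ltn_trans h1) //=.
by rewrite (leq_ltn_trans h2) // (leq_trans h4) // part_nth_leq.
Qed.

Lemma rsyt_row (f : F) i j : is_rsyt t f ->
  (f i).1 = (f j).1 -> ((f i).2 < (f j).2)%N -> (j < i)%N.
Proof.
case/and4P=> _ _ /forallP/(_ i)/forallP/(_ j) h _ h1 h2.
by move: h; rewrite h1 eqxx h2.
Qed.

Lemma rsyt_col (f : F) i j : is_rsyt t f ->
  (f i).2 = (f j).2 -> ((f i).1 < (f j).1)%N -> (j < i)%N.
Proof.
case/and4P=> _ _ _ /forallP/(_ i)/forallP/(_ j) h h1 h2.
by move: h; rewrite h1 eqxx h2.
Qed.

(** Both entries are compared with the one in the corner cell, in the row of [i] and the column of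
    [j], which belongs to the diagram. *)
Lemma rsyt_mono (f : F) i j : is_rsyt t f ->
  ((f i).1 <= (f j).1)%N -> ((f i).2 <= (f j).2)%N -> (j <= i)%N.
Proof.
move=> fP h1 h2.
have [k fk] := @rsyt_surj f ((f i).1, (f j).2) fP (@in_diagram_leq ((f i).1, (f j).2) (f j) h1 (leqnn _) (rsyt_in j fP)).
have jk : (j <= k)%N.
  move: h1; rewrite leq_eqVlt => /orP[/eqP/val_inj e|h1].
    by rewrite (_ : k = j) //; apply: (rsyt_inj fP); rewrite fk e -surjective_pairing.
  by apply: ltnW; apply: (rsyt_col fP); rewrite fk.
have ki : (k <= i)%N.
  move: h2; rewrite leq_eqVlt => /orP[/eqP/val_inj e|h2].
    by rewrite (_ : k = i) //; apply: (rsyt_inj fP); rewrite fk -e -surjective_pairing.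
  by apply: ltnW; apply: (rsyt_row fP); rewrite fk.
exact: leq_trans ki.
Qed.

(** The rectangle spanned by two cells lies in the diagram and its entries are between those of the
    corners. For close entries there is no room in between, which restricts their relative
    position. *)
Lemma rsyt_between (f : F) i j (r c : nat) : is_rsyt t f ->
  ((f i).1 <= r <= (f j).1)%N -> ((f i).2 <= c <= (f j).2)%N ->
  exists k, [/\ (f k).1 = r :> nat, (f k).2 = c :> nat & (j <= k <= i)%N].
Proof.
move=> fP /andP[r1 r2] /andP[c1 c2].
have rN : (r < N)%N := leq_ltn_trans r2 (ltn_ord _).
have cN : (c < N)%N := leq_ltn_trans c2 (ltn_ord _).
have [k fk] := @rsyt_surj f (Ordinal rN, Ordinal cN) fP
  (@in_diagram_leq (Ordinal rN, Ordinal cN) (f j) r2 c2 (rsyt_in j fP)).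
exists k; rewrite fk; split => //.
by apply/andP; split; apply: (rsyt_mono fP); rewrite fk.
Qed.

Definition ct (f : F) (k : 'I_N) : int := ((f k).2 : nat)%:Z - ((f k).1 : nat)%:Z.

Lemma contentE k (T : Y) : Defs.content k T = ct (val T) k.
Proof. by clear tP; rewrite /Defs.content /ct /cm /rw; lia. Qed.

Definition ord_lo (i : nat) : 'I_N := inord i.
Definition ord_hi (i : nat) : 'I_N := inord i.+1.

Lemma ord_loE i : (i < n)%N -> ord_lo i = i :> nat.
Proof. by move=> h; rewrite inordK // ltnW. Qed.
Lemma ord_hiE i : (i < n)%N -> ord_hi i = i.+1 :> nat.
Proof. by move=> h; rewrite inordK. Qed.

Lemma ord_lo_neq i : (i < n)%N -> ord_lo i != ord_hi i.
Proof. clear tP. by move=> h; apply/eqP => /(congr1 val) /=; rewrite ord_loE ?ord_hiE //; lia. Qed.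

Lemma ord_between i (k : 'I_N) : (i < n)%N -> (ord_lo i <= k <= ord_hi i)%N ->
  k = ord_lo i \/ k = ord_hi i.
Proof. clear tP.
move=> h; rewrite ord_loE ?ord_hiE // => hk.
have [e|e] : (k : nat) = i \/ (k : nat) = i.+1 by lia.
  by left; apply: val_inj; rewrite /= ord_loE.
by right; apply: val_inj; rewrite /= ord_hiE.
Qed.

Variant rsyt_pos_spec (f : F) (i : nat) : Prop :=
  | PosRow of (f (ord_lo i)).1 = (f (ord_hi i)).1 &
      ((f (ord_lo i)).2 = (f (ord_hi i)).2.+1 :> nat)
  | PosCol of (f (ord_lo i)).2 = (f (ord_hi i)).2 &
      ((f (ord_lo i)).1 = (f (ord_hi i)).1.+1 :> nat)
  | PosNE of ((f (ord_lo i)).1 < (f (ord_hi i)).1)%N &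
      ((f (ord_hi i)).2 < (f (ord_lo i)).2)%N
  | PosSW of ((f (ord_hi i)).1 < (f (ord_lo i)).1)%N &
      ((f (ord_lo i)).2 < (f (ord_hi i)).2)%N.

Lemma rsyt_pos (f : F) i : is_rsyt t f -> (i < n)%N -> rsyt_pos_spec f i.
Proof.
move=> fP i_n; set a := ord_lo i; set b := ord_hi i.
have nSE : ~ (((f a).1 <= (f b).1)%N /\ ((f a).2 <= (f b).2)%N).
  by move=> [h1 h2]; have := rsyt_mono fP h1 h2; rewrite /a /b ord_loE ?ord_hiE // ltnn.
have bet r c : ((f b).1 <= r <= (f a).1)%N -> ((f b).2 <= c <= (f a).2)%N ->
    (r = (f a).1 /\ c = (f a).2) \/ (r = (f b).1 /\ c = (f b).2).
  move=> h1 h2; have [k [<- <- h]] := rsyt_between fP h1 h2.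
  by case: (ord_between i_n h) => ->; [left|right].
have [r_lt|r_gt|r_eq] := ltngtP (f a).1 (f b).1.
- have [c_lt|c_gt|c_eq] := ltngtP (f a).2 (f b).2.
  + by case: nSE; split; apply: ltnW.
  + exact: PosNE.
  + by case: nSE; split; [exact: ltnW|rewrite c_eq].
- have [c_lt|c_gt|c_eq] := ltngtP (f a).2 (f b).2.
  + exact: PosSW.
  + by have := bet (f b).1 (f a).2; lia.
  + apply: PosCol; first exact: val_inj.
    rewrite -/a -/b; have := bet (f b).1.+1 (f b).2; rewrite c_eq !leqnn r_gt leqnSn => /(_ isT isT).
    by case=> -[e _]; lia.
- have [c_lt|c_gt|c_eq] := ltngtP (f a).2 (f b).2.
  + by case: nSE; split; [rewrite r_eq|exact: ltnW].
  + apply: PosRow; first exact: val_inj.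
    rewrite -/a -/b; have := bet (f b).1 (f b).2.+1; rewrite r_eq !leqnn c_gt leqnSn => /(_ isT isT).
    by case=> -[_ e]; lia.
  + by case: nSE; rewrite r_eq c_eq.
Qed.

Lemma rsyt_ct_neq (f : F) i : is_rsyt t f -> (i < n)%N -> ct f (ord_lo i) != ct f (ord_hi i).
Proof.
move=> fP i_n; rewrite /ct; case: (rsyt_pos fP i_n) => [-> ->|-> ->|h1 h2|h1 h2]; lia.
Qed.

(** On a common diagonal, the cells to the right of and below the upper one would both have to carry
    the single entry strictly between the two. This keeps the denominators of the braid relation
    nonzero. *)
Lemma rsyt_ct_neq2 (f : F) i : is_rsyt t f -> (i.+1 < n)%N ->
  ct f (ord_lo i) != ct f (ord_hi i.+1).
Proof.
move=> fP i_n; have i_n' := ltnW i_n; set a := ord_lo i; set b := ord_hi i.+1.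
apply/eqP; rewrite /ct => e.
have aE : a = i :> nat by rewrite ord_loE.
have bE : b = i.+2 :> nat by rewrite ord_hiE.
have [r_le|r_gt] := leqP (f a).1 (f b).1.
  have := @rsyt_mono f a b fP r_le; rewrite aE bE; lia.
have [k1 [r1 c1 h1]] := @rsyt_between f b a (f b).1 (f b).2.+1 fP ltac:(lia) ltac:(lia).
have [k2 [r2 c2 h2]] := @rsyt_between f b a (f b).1.+1 (f b).2 fP ltac:(lia) ltac:(lia).
have kE (k : 'I_N) : (a <= k <= b)%N -> (f k).1 <> (f a).1 :> nat \/ (f k).2 <> (f a).2 :> nat ->
  (f k).1 <> (f b).1 :> nat \/ (f k).2 <> (f b).2 :> nat -> k = i.+1 :> nat.
  rewrite aE bE => h ka kb.
  have [e1|[e1|//]] : (k = i :> nat) \/ (k = i.+2 :> nat) \/ (k = i.+1 :> nat) by lia.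
    have ea : k = a by apply: val_inj; rewrite /= aE.
    by case: ka; rewrite ea.
  have eb : k = b by apply: val_inj; rewrite /= bE.
  by case: kb; rewrite eb.
have e1 := kE k1 h1 ltac:(lia) ltac:(lia).
have e2 := kE k2 h2 ltac:(lia) ltac:(lia).
have e12 : k1 = k2 by apply: val_inj; rewrite /= e1 e2.
by rewrite e12 in r1 c1; lia.
Qed.

Definition fswap (f : F) (i : nat) : F := [ffun k => f (stp n i k)].

Lemma stpK i : involutive (stp n i).
Proof. by move=> k; rewrite /stp tpermK. Qed.

Lemma fswapK i : involutive (fswap ^~ i).
Proof. by move=> f; apply/ffunP => k; rewrite !ffunE stpK. Qed.

Lemma ct_fswap f i k : ct (fswap f i) k = ct f (stp n i k).
Proof. by rewrite /ct ffunE. Qed.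

Lemma stp_invert i (j k : 'I_N) : (i < n)%N -> (stp n i k < stp n i j)%N -> (j <= k)%N ->
  j = ord_lo i /\ k = ord_hi i.
Proof. clear tP.
move=> i_n; rewrite !stpE // /adj_swap => h jk.
have [ji ki] : (j = i :> nat) /\ (k = i.+1 :> nat).
  by move: h; repeat case: eqP; lia.
by split; apply: val_inj; [rewrite [RHS]ord_loE|rewrite [RHS]ord_hiE].
Qed.

Lemma stp_lo i : stp n i (ord_lo i) = ord_hi i.
Proof. by rewrite /stp tpermL. Qed.
Lemma stp_hi i : stp n i (ord_hi i) = ord_lo i.
Proof. by rewrite /stp tpermR. Qed.

Lemma fswap_valid (f : F) i : is_rsyt t f -> (i < n)%N ->
  (f (ord_lo i)).1 != (f (ord_hi i)).1 -> (f (ord_lo i)).2 != (f (ord_hi i)).2 ->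
  is_rsyt t (fswap f i).
Proof.
move=> fP i_n rr cc; apply/and4P; split.
- by apply/injectiveP => x y; rewrite !ffunE => /(rsyt_inj fP)/perm_inj.
- by apply/forallP => x; rewrite ffunE rsyt_in.
- apply/forallP => j; apply/forallP => k; apply/implyP; rewrite !ffunE => /andP[/eqP e1 e2].
  rewrite ltnNge; apply/negP => jk.
  have [ej ek] := stp_invert i_n (rsyt_row fP e1 e2) jk.
  by move: e1 rr; rewrite ej ek stp_lo stp_hi => ->; rewrite eqxx.
- apply/forallP => j; apply/forallP => k; apply/implyP; rewrite !ffunE => /andP[/eqP e1 e2].
  rewrite ltnNge; apply/negP => jk.
  have [ej ek] := stp_invert i_n (rsyt_col fP e1 e2) jk.
  by move: e1 cc; rewrite ej ek stp_lo stp_hi => ->; rewrite eqxx.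
Qed.

(** The exchange can fail only for adjacent cells, and there [pcoef] vanishes. *)
Lemma fswap_invalid (f : F) i : is_rsyt t f -> (i < n)%N -> ~~ is_rsyt t (fswap f i) ->
  `|ct f (ord_lo i) - ct f (ord_hi i)| = 1.
Proof.
move=> fP i_n nP; rewrite /ct; case: (rsyt_pos fP i_n) => [-> ->|-> ->|h1 h2|h1 h2]; try lia.
  by case/negP: nP; apply: fswap_valid => //; apply/eqP => /(congr1 val) /=; lia.
by case/negP: nP; apply: fswap_valid => //; apply/eqP => /(congr1 val) /=; lia.
Qed.

Lemma fswap_row (f : F) i : is_rsyt t f -> (i < n)%N ->
  (f (ord_lo i)).1 = (f (ord_hi i)).1 -> is_rsyt t (fswap f i) = false.
Proof.
move=> fP i_n e; apply/negP => gP; have /= e' := congr1 (@nat_of_ord _) e.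
case: (rsyt_pos fP i_n) => [e1 e2|e1 e2|e1 e2|e1 e2]; try lia.
case: (rsyt_pos gP i_n); rewrite !ffunE !stp_lo !stp_hi => q1 q2;
  try (move/(congr1 (@nat_of_ord _)): q1 => /= q1); lia.
Qed.

Lemma fswap_col (f : F) i : is_rsyt t f -> (i < n)%N ->
  (f (ord_lo i)).2 = (f (ord_hi i)).2 -> is_rsyt t (fswap f i) = false.
Proof.
move=> fP i_n e; apply/negP => gP; have /= e' := congr1 (@nat_of_ord _) e.
case: (rsyt_pos fP i_n) => [e1 e2|e1 e2|e1 e2|e1 e2]; try lia.
case: (rsyt_pos gP i_n); rewrite !ffunE !stp_lo !stp_hi => q1 q2;
  try (move/(congr1 (@nat_of_ord _)): q1 => /= q1); lia.
Qed.

End Tableaux.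

(** * The seminormal representation *)

Section Representation.
Variables (R : realType) (n : nat) (t : seq nat).
Local Notation N := n.+1.
Local Notation F := {ffun 'I_N -> 'I_N * 'I_N}.
Local Notation Y := (rsyt N t).
Local Notation C := R[i].
Local Notation V := (V R N t).
Hypothesis tP : is_partition_of N t.

(** Coefficient with which a tableau is reached from its swap, in terms of its own contents [a] of
    [i] and [b] of [i+1]. For two nonadjacent consecutive entries the order of the contents is
    opposite to that of the rows, so contents alone decide the case. *)
Definition pcoef (a b : int) : C :=
  if `|a - b| <= 1 then 0 else if a < b then 1 else 1 - ((a - b)%:~R ^+ 2)^-1.

Lemma intr_neq0 (a b : int) : a != b -> ((a%:~R : C) - b%:~R) != 0.
Proof. by move=> ab; rewrite -intrB intr_eq0 subr_eq0. Qed.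

Lemma pcoefM a b : a != b -> pcoef a b * pcoef b a = 1 - (((a - b)%:~R : C) ^+ 2)^-1.
Proof.
move=> ab; rewrite /pcoef (distrC b a).
have [h|h] := leP `|a - b| 1.
  have [->|->] : a - b = 1 \/ a - b = -1 by lia.
    by rewrite mul0r expr1n invr1 subrr.
  by rewrite mul0r intrN sqrrN expr1n invr1 subrr.
have [ab'|ab'|e] := ltgtP a b; last by rewrite e eqxx in ab.
  by rewrite mul1r -[b - a]opprB intrN sqrrN.
by rewrite mulr1.
Qed.

(* The seminormal action extended to functions on all fillings, where entries i
   and i+1 can be exchanged freely; functions supported on tableaux are preserved
   because pcoef vanishes when the exchange leaves the set of tableaux. *)
Definition fact (i : nat) (v : F -> C) : F -> C := fun f =>
  v f / (ct f (ord_lo n i) - ct f (ord_hi n i))%:~R +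
  pcoef (ct f (ord_lo n i)) (ct f (ord_hi n i)) * v (fswap f i).

Definition vext (v : V) : F -> C := fun f => if insub f is Some T then v T else 0.

Definition vact (i : nat) (v : V) : V := [ffun T => fact i (vext v) (val T)].

Lemma vext_val v (T : Y) : vext v (val T) = v T.
Proof. by rewrite /vext valK. Qed.

Lemma vext_invalid v f : is_rsyt t f = false -> vext v f = 0.
Proof. by move=> h; rewrite /vext insubF. Qed.

Lemma vext_inj u v : (forall f, is_rsyt t f -> vext u f = vext v f) -> u = v.
Proof. by move=> e; apply/ffunP => T; rewrite -!vext_val e //; apply: valP. Qed.

(** Off the tableaux the only term that may survive comes from a swap that is a tableau, and its
    coefficient [pcoef] is zero. The Coxeter relations can therefore be checked on [fact]. *)
Lemma vext_act i v f : (i < n)%N -> vext (vact i v) f = fact i (vext v) f.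
Proof.
move=> i_n; case: (boolP (is_rsyt t f)) => fP.
  by rewrite /vext insubT ffunE /=.
rewrite vext_invalid ?(negPf fP) // /fact vext_invalid ?(negPf fP) // mul0r add0r.
case: (boolP (is_rsyt t (fswap f i))) => gP; last by rewrite vext_invalid ?(negPf gP) ?mulr0.
have := fswap_invalid tP gP i_n; rewrite fswapK => /(_ fP).
by rewrite !ct_fswap stp_lo stp_hi /pcoef distrC => ->; rewrite lexx mul0r.
Qed.

Lemma ct_fswap_lo (f : F) i : ct (fswap f i) (ord_lo n i) = ct f (ord_hi n i).
Proof. by rewrite ct_fswap stp_lo. Qed.
Lemma ct_fswap_hi (f : F) i : ct (fswap f i) (ord_hi n i) = ct f (ord_lo n i).
Proof. by rewrite ct_fswap stp_hi. Qed.

Lemma stp_id i (k : 'I_N) : (i < n)%N -> k != i :> nat -> k != i.+1 :> nat -> stp n i k = k.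
Proof.
by move=> i_n h1 h2; apply: val_inj; rewrite /= stpE // /adj_swap (negPf h1) (negPf h2).
Qed.

Lemma stpC i j (k : 'I_N) : (i.+1 < j)%N -> (j < n)%N ->
  stp n i (stp n j k) = stp n j (stp n i k).
Proof.
move=> ij jn; apply: val_inj; rewrite /= !stpE //; [|lia..].
by case: (coxeter_adj_swap n) => _ /(_ i j _ ij jn).
Qed.

Lemma stp_braid i (k : 'I_N) : (i.+1 < n)%N ->
  stp n i (stp n i.+1 (stp n i k)) = stp n i.+1 (stp n i (stp n i.+1 k)).
Proof.
move=> i_n; apply: val_inj; rewrite /= !stpE //; [|lia..].
by case: (coxeter_adj_swap n) => _ _ /(_ i _ i_n).
Qed.

Lemma fact_braid i (w : F -> C) (f : F) : (i.+1 < n)%N -> is_rsyt t f ->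
  fact i (fact i.+1 (fact i w)) f = fact i.+1 (fact i (fact i.+1 w)) f.
Proof.
move=> i_n fP; have i_n' := ltnW i_n; rewrite /fact !fswapK.
  have -> : fswap (fswap (fswap f i) i.+1) i = fswap (fswap (fswap f i.+1) i) i.+1.
    by apply/ffunP => k; rewrite !ffunE stp_braid.
  have e1 : stp n i (ord_hi n i.+1) = ord_hi n i.+1.
    by apply: stp_id; rewrite // ord_hiE //; lia.
  have e2 : stp n i.+1 (ord_lo n i) = ord_lo n i.
    by apply: stp_id; rewrite // ord_loE //; lia.
  have e3 : stp n i.+1 (ord_hi n i) = ord_hi n i.+1 by apply: stp_lo.
  have e4 : stp n i.+1 (ord_hi n i.+1) = ord_hi n i by apply: stp_hi.
  have e5 : ord_lo n i.+1 = ord_hi n i by [].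
  rewrite !e5 !ct_fswap ?(stp_lo, stp_hi, e1, e2, e3, e4).
  have ab := rsyt_ct_neq tP fP i_n'.
  have bc := rsyt_ct_neq tP fP i_n; rewrite e5 in bc.
  have ac := rsyt_ct_neq2 tP fP i_n.
  move: (ct f (ord_lo n i)) (ct f (ord_hi n i)) (ct f (ord_hi n i.+1)) ab bc ac => a b c ab bc ac.
  have E1 := pcoefM ab; have E2 := pcoefM bc.
  have ab0 := intr_neq0 ab; have bc0 := intr_neq0 bc; have ac0 := intr_neq0 ac.
  rewrite !intrB in E1 E2 *.
  have ba0 : (b%:~R : C) - a%:~R != 0 by rewrite -oppr_eq0 opprB.
  have cb0 : (c%:~R : C) - b%:~R != 0 by rewrite -oppr_eq0 opprB.
  have ca0 : (c%:~R : C) - a%:~R != 0 by rewrite -oppr_eq0 opprB.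
  move: (w f) (w (fswap f i)) (w (fswap f i.+1)) (w (fswap _ _)) (w (fswap _ _))
    (w (fswap _ _)) => v0 v1 v2 v3 v4 v5.
  move: (pcoef a b) (pcoef b a) E1 (pcoef b c) (pcoef c b) E2 (pcoef a c) => p q E1 r s E2 u.
  move: (a%:~R : C) (b%:~R : C) (c%:~R : C) ab0 bc0 ac0 ba0 cb0 ca0 E1 E2 => x y z ab0 bc0 ac0 ba0 cb0 ca0 E1 E2.
  apply/eqP; rewrite -subr_eq0; apply/eqP.
  (* The two sides agree as rational functions modulo the relations [E1] and [E2]; this is the
     combination of them by which they differ. *)
  transitivity ((p * q - (1 - (x - y) ^- 2)) * v0 / (x - z) - (r * s - (1 - (y - z) ^- 2)) * v0 / (x - z)).
    field; rewrite ?ab0 ?bc0 ?ac0 ?ba0 ?cb0 ?ca0 //.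
  have -> : p * q - (1 - (x - y) ^- 2) = 0 by rewrite E1 subrr.
  have -> : r * s - (1 - (y - z) ^- 2) = 0 by rewrite E2 subrr.
  by rewrite !mul0r subrr.
Qed.

Lemma vact_coxeter : coxeter vact n.
Proof.
have vextE j u : (j < n)%N -> vext (vact j u) = fact j (vext u).
  by move=> j_n; apply: boolp.funext => f; apply: vext_act.
split=> [i v i_n|i j v ij jn|i v i_n].
- apply: vext_inj => f fP; rewrite vext_act //.
  have ab := rsyt_ct_neq tP fP i_n.
  rewrite /fact !vext_act // /fact fswapK ct_fswap_lo ct_fswap_hi.
  move: (ct f (ord_lo n i)) (ct f (ord_hi n i)) ab => a b ab.
  rewrite mulrDr mulrDl addrACA mulrCA.
  rewrite [_ * (pcoef b a * _)]mulrA pcoefM // -[b - a]opprB !intrN.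
  have ab0 : ((a - b)%:~R : C) != 0 by rewrite intr_eq0 subr_eq0.
  rewrite invrN; move: ((a - b)%:~R : C) ab0 (vext v f) (vext v (fswap f i)) (pcoef a b) => d d0 x y p.
  by field.
- have i_n : (i < n)%N by lia.
  have E2 a b w : (a < n)%N -> (b < n)%N -> vext (vact a (vact b w)) = fact a (fact b (vext w)).
    by move=> a_n b_n; rewrite vextE // vextE.
  apply: vext_inj => f fP; apply: (etrans (congr1 (fun g : F -> C => g f) (E2 i j v i_n jn))).
  apply/esym; apply: (etrans (congr1 (fun g : F -> C => g f) (E2 j i v jn i_n))).
  rewrite /fact.
  have -> : fswap (fswap f i) j = fswap (fswap f j) i.
    by apply/ffunP => k; rewrite !ffunE stpC.
  have lo_i := ord_loE i_n; have hi_i := ord_hiE i_n.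
  have lo_j := ord_loE jn; have hi_j := ord_hiE jn.
  rewrite !ct_fswap (@stp_id j (ord_lo n i)) ?(@stp_id j (ord_hi n i)) //; [|rewrite ?lo_i ?hi_i; lia..].
  rewrite (@stp_id i (ord_lo n j)) ?(@stp_id i (ord_hi n j)) //; [|rewrite ?lo_j ?hi_j; lia..].
  move: (_^-1) (_^-1) (pcoef _ _) (pcoef _ _) => x y p q; ring.
- apply: vext_inj => f fP; have i_n' := ltnW i_n.
  have E3 a b c w : (a < n)%N -> (b < n)%N -> (c < n)%N ->
      vext (vact a (vact b (vact c w))) = fact a (fact b (fact c (vext w))).
    by move=> a_n b_n c_n; rewrite vextE // vextE // vextE.
  apply: (etrans (congr1 (fun g : F -> C => g f) (E3 i i.+1 i v i_n' i_n i_n'))).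
  apply/esym; apply: (etrans (congr1 (fun g : F -> C => g f) (E3 i.+1 i i.+1 v i_n i_n' i_n))).
  by apply/esym; apply: fact_braid.
Qed.
Lemma opv_is_additive (A : Op R N t) (u v : V) : opv A (u + v) = opv A u + opv A v.
Proof.
by apply/ffunP => T; rewrite !ffunE -big_split; apply: eq_bigr => T' _; rewrite ffunE mulrDr.
Qed.

Lemma VZE (a : C) (v : V) T : (a *: v) T = a * v T.
Proof. by rewrite ffunE. Qed.

Lemma VDE (u v : V) T : (u + v) T = u T + v T.
Proof. by rewrite ffunE. Qed.

Lemma opvZ (A : Op R N t) (a : C) (v : V) : opv A (a *: v) = a *: opv A v.
Proof.
apply/ffunP => T; rewrite VZE !ffunE big_distrr; apply: eq_bigr => T' _ /=.
by rewrite VZE mulrCA.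
Qed.

Lemma opv_opmul (A B : Op R N t) (v : V) : opv (opmul A B) v = opv A (opv B v).
Proof.
apply/ffunP => T; rewrite !ffunE.
under eq_bigr do rewrite big_distrl /=; rewrite exchange_big /=; apply: eq_bigr => T' _.
by rewrite ffunE big_distrr; apply: eq_bigr => T'' _ /=; rewrite mulrA.
Qed.

Lemma basisvE (v : V) : v = \sum_T v T *: basisv R T.
Proof.
apply/ffunP => T; rewrite sum_ffunE (bigD1 T) //= big1 => [|T' h]; last first.
  by rewrite VZE ffunE eq_sym (negPf h) mulr0.
by rewrite VZE ffunE eqxx mulr1 addr0.
Qed.

Lemma vact_linear i (a : C) (u v : V) : vact i (a *: u + v) = a *: vact i u + vact i v.
Proof.
apply/ffunP => T; rewrite VDE VZE ![vact _ _ _]ffunE /fact /vext !valK; case: insubP => [T' _ _|_];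
  rewrite !VDE !VZE; move: (_^-1) (pcoef _ _) => x p; ring.
Qed.

(** [tau_s] describes the image of [T], while [fact] computes a value at [T']. When [T'] is the swap
    its contents are those of [T] exchanged, hence the reversed inequality in [pcoef]. *)
Lemma vact_tau_s i (i_n : (i < n)%N) T T' :
  vact i (basisv R T) T' = tau_s R (ord_lo n i) (ord_hi n i) T' T.
Proof.
have vextb f : vext (basisv R T) f = (f == val T)%:R.
  rewrite /vext; case: insubP => [T'' _ <-|/negPf h]; first by rewrite ffunE val_eqE.
  by case: eqP => // e; rewrite e (valP T) in h.
rewrite ffunE /fact !vextb val_eqE /tau_s !contentE /rw /cm. rewrite !eqSS.
have -> : swap_filling T (ord_lo n i) (ord_hi n i) = fswap (val T) i by [].
have -> : (fswap (val T') i == val T) = (val T' == fswap (val T) i).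
  by apply/eqP/eqP => [<-|->]; rewrite fswapK.
rewrite ltnS.
have rowE : ((val T (ord_lo n i)).1 == (val T (ord_hi n i)).1 :> nat) -> is_rsyt t (fswap (val T) i) = false.
  by move=> h; apply: (fswap_row tP (valP T) i_n); apply/eqP.
have colE : ((val T (ord_lo n i)).2 == (val T (ord_hi n i)).2 :> nat) -> is_rsyt t (fswap (val T) i) = false.
  by move=> h; apply: (fswap_col tP (valP T) i_n); apply/eqP.
have nE : is_rsyt t (fswap (val T) i) = false -> (val T' == fswap (val T) i) = false.
  by move=> h; apply/negP => /eqP e; rewrite -e (valP T') in h.
have [e|ne] := eqVneq T' T; last first.
  rewrite mul0r add0r.
  case: ifP => [/rowE/nE ->|hr]; first by rewrite mulr0.
  case: ifP => [/colE/nE ->|hc]; first by rewrite mulr0 oppr0.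
  rewrite addr0; case: eqP => [e|_]; last by rewrite mulr0.
  rewrite mulr1 e !ct_fswap_lo !ct_fswap_hi /pcoef /ct.
  case: (rsyt_pos tP (valP T) i_n) => [h1 h2|h1 h2|h1 h2|h1 h2].
  - by rewrite h1 eqxx in hr.
  - by rewrite h1 eqxx in hc.
  - rewrite h1; case: ifP => [|_]; first lia.
    by case: ifP => //; lia.
  - have -> : (nat_of_ord (val T (ord_lo n i)).1 < (val T (ord_hi n i)).1)%N = false by lia.
    case: ifP => [|_]; first lia.
    case: ifP => [|_]; first lia.
    by rewrite exprVn; congr (_ - _^-1); rewrite -sqrrN -intrN opprB.
have nfix : (val T' == fswap (val T) i) = false.
  apply/negP => /eqP; rewrite e => /(congr1 (fun f : F => ct f (ord_lo n i))); rewrite /= ct_fswap_lo => h.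
  by have := rsyt_ct_neq tP (valP T) i_n; rewrite h eqxx.
rewrite nfix mulr0 addr0 add0r e mul1r.
case: (rsyt_pos tP (valP T) i_n) => [h1 h2|h1 h2|h1 h2|h1 h2].
- have -> : ct (val T) (ord_lo n i) - ct (val T) (ord_hi n i) = 1 by rewrite /ct h1; lia.
  by rewrite h1 eqxx invr1.
- have -> : ct (val T) (ord_lo n i) - ct (val T) (ord_hi n i) = -1 by rewrite /ct h1; lia.
  by rewrite ifN ?h1 ?eqxx ?intrN ?invrN ?invr1 //; lia.
- by rewrite !ifN //; lia.
- by rewrite !ifN //; lia.
Qed.

(** The action on words provides the witness for [epsilon]: its maps are linear, by the second
    clause of [coxeter_action], hence given by matrices. *)
Lemma rep_spec : is_tau_rep (@rep R N t).
Proof.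
apply: ClassicalEpsilon.epsilon_spec.
have [rho [rhoM rhoS] rhoP] := coxeter_action vact_coxeter.
have rhoL w (a : C) u v : rho w (a *: u + v) = a *: rho w u + rho w v.
  apply: (rhoP (fun f => forall a u v, f (a *: u + v) = a *: f u + f v)) => [//|i f i_n h b u' v' /=].
  by rewrite h vact_linear.
have rhoE w v T : rho w v T = \sum_T' rho w (basisv R T') T * v T'.
  have r0 : rho w 0 = 0 by have := rhoL w (-1) 0 0; rewrite scaler0 add0r scaleN1r addNr.
  rewrite {1}(basisvE v).
  elim/big_rec2: _ => [|T' x y _ IH]; first by rewrite r0 ffunE.
  by rewrite rhoL ffunE VZE IH mulrC.
exists (fun w T' T => rho w (basisv R T) T'); split.
  move=> u v; apply: boolp.funext => T'; apply: boolp.funext => T.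
  by rewrite rhoM rhoE.
move=> i h; apply: boolp.funext => T'; apply: boolp.funext => T.
have i_n : (i < n)%N by [].
have e1 : i = ord_lo n i by apply: val_inj; rewrite /= inordK.
have e2 : Ordinal h = ord_hi n i by apply: val_inj; rewrite /= inordK.
rewrite (_ : tperm i _ = stp n i) ?rhoS // ?vact_tau_s // ?e2 -?e1 //.
by rewrite /stp -/(ord_lo n i) -e1 -/(ord_hi n i).
Qed.

Lemma opv_repM u v (x : V) : opv (@rep R N t (v * u)%g) x = opv (@rep R N t u) (opv (@rep R N t v) x).
Proof. by case: rep_spec => h _; rewrite h opv_opmul. Qed.

Lemma opv_rep_stp i x : (i < n)%N -> opv (@rep R N t (stp n i)) x = vact i x.
Proof.
move=> i_n.
have h : ((ord_lo n i).+1 < N)%N by rewrite ord_loE.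
case: rep_spec => _ /(_ (ord_lo n i) h).
have -> : Ordinal h = ord_hi n i by apply: val_inj; rewrite /= !inordK // ltnW.
rewrite -/(stp n i) => ->.
apply/ffunP => T; rewrite {2}(basisvE x).
have v0 : vact i 0 = 0 by have := vact_linear i (-1) 0 0; rewrite scaler0 add0r scaleN1r addNr.
rewrite ffunE; elim/big_rec2: _ => [|T' y z _ IH]; first by rewrite v0 ffunE.
by rewrite vact_linear ffunE VZE -IH -vact_tau_s // mulrC.
Qed.

Hypothesis n_gt0 : (0 < n)%N.

(** [is_tau_rep] does not prescribe the value at 1; it is recovered as the square of [s_0], which
    exists since [n > 0]. *)
Lemma opv_rep1 x : opv (@rep R N t 1%g) x = x.
Proof.
have <- : (stp n 0 * stp n 0)%g = 1%g by rewrite /stp tperm2.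
by rewrite opv_repM !opv_rep_stp //; case: vact_coxeter => -> .
Qed.

Lemma opv_repK u x : opv (@rep R N t u^-1) (opv (@rep R N t u) x) = x.
Proof. by rewrite -opv_repM mulgV opv_rep1. Qed.

Lemma opv_repVK u x : opv (@rep R N t u) (opv (@rep R N t u^-1) x) = x.
Proof. by rewrite -opv_repM mulVg opv_rep1. Qed.

(* Jucys-Murphy elements *)
Definition jm (i : 'I_N) (x : V) : V := \sum_(j < N | (i < j)%N) opv (@rep R N t (tperm i j)) x.

Lemma opv_sum (A : Op R N t) I (r : seq I) P (G : I -> V) :
  opv A (\sum_(i <- r | P i) G i) = \sum_(i <- r | P i) opv A (G i).
Proof.
elim/big_rec2: _ => [|i x y _ IH]; last by rewrite opv_is_additive IH.
by have := opvZ A 0 0; rewrite !scale0r.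
Qed.

Lemma jm_rec i x : (i < n)%N ->
  jm (ord_lo n i) x = vact i (jm (ord_hi n i) (vact i x)) + vact i x.
Proof.
move=> i_n; have lo_i := ord_loE i_n; have hi_i := ord_hiE i_n.
rewrite -!opv_rep_stp // /jm opv_sum.
rewrite (bigD1 (ord_hi n i)) /=; last by rewrite lo_i hi_i.
rewrite addrC; congr (_ + _).
apply: eq_big => [j|j /andP[ij jhi]].
  rewrite -(val_eqE j) lo_i hi_i /=; lia.
rewrite -!opv_repM; congr (opv (@rep R N t _) _).
have ji : ord_lo n i != j by rewrite -(val_eqE _ j) /= neq_ltn ij.
have -> : tperm (ord_lo n i) j = (tperm (ord_hi n i) j ^ stp n i)%g.
  by rewrite tpermJ stp_hi /stp tpermD // eq_sym.
by rewrite conjgE /stp tpermV mulgA.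
Qed.

(** Descending induction. For the largest entry the sum is empty, and this entry sits in the corner
    cell, of content 0. The step is [jm_rec], evaluated on [T] and its swap. *)
Lemma jmE i x T : jm i x T = (Defs.content i T)%:~R * x T.
Proof.
have [k] := ubnP (n - i)%N; elim: k => // k IH in i x T *; rewrite ltnS => ik.
have [i_n|n_i] := ltnP i n; last first.
  have iE : i = n :> nat by have := ltn_ord i; lia.
  rewrite /jm big_pred0 ?ffunE; last by move=> j; have := ltn_ord j; lia.
  suff c0 : ct (val T) i = 0 by rewrite contentE c0 mul0r.
  have rn : (0 < size t)%N.
    case: (t) tP => // /and3P[_ _ /=]; lia.
  have cn : (0 < nth 0 t 0)%N.
    case/and3P: tP => _ /allP/(_ (nth 0%N t 0)) h _; apply: h; exact: mem_nth.
  have [j fj] := @rsyt_surj n t tP (val T) (ord0, ord0) (valP T) ltac:(by rewrite /in_diagram /= rn cn).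
  have : (i <= j)%N by apply: (rsyt_mono tP (valP T)); rewrite fj.
  move=> ij; have -> : i = j by apply: val_inj => /=; have := ltn_ord j; lia.
  by rewrite /ct fj.
have lo_i := ord_loE i_n; have hi_i := ord_hiE i_n.
have {1 2}-> : i = ord_lo n i by apply: val_inj; rewrite /= lo_i.
have jmV y f : vext (jm (ord_hi n i) y) f = (ct f (ord_hi n i))%:~R * vext y f.
  rewrite /vext; case: insubP => [T' _ <-|_]; last by rewrite mulr0.
  by rewrite IH ?contentE // hi_i; lia.
rewrite jm_rec // ffunE !contentE.
have E f y : vext (vact i y) f = fact i (vext y) f by apply: vext_act.
rewrite -[vact i (jm _ _) T]vext_val -[vact i x T]vext_val !E /fact !jmV !E /fact fswapK ct_fswap_lo ct_fswap_hi vext_val.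
have ab := rsyt_ct_neq tP (valP T) i_n.
move: (ct (val T) (ord_lo n i)) (ct (val T) (ord_hi n i)) ab (vext x _) => a b ab y.
have E1 := pcoefM ab; have ab0 := intr_neq0 ab; rewrite !intrB in E1 *.
move: (pcoef a b) (pcoef b a) E1 => p q E1.
have ba0 : (b%:~R : C) - a%:~R != 0 by rewrite -oppr_eq0 opprB.
move: (a%:~R : C) (b%:~R : C) ab0 ba0 E1 (x T) => u w ab0 ba0 E1 v.
(* What is left over is a multiple of the relation [E1]. *)
transitivity (u * v + (p * q - (1 - (u - w) ^- 2)) * v * u).
  by field; rewrite ab0.
by rewrite E1 subrr !mul0r addr0.
Qed.

End Representation.

(** * Laurent polynomials and Cherednik-Dunkl operators *)

Section LaurentBase.
Variables (R : realType) (n : nat) (t : seq nat).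
Local Notation N := n.+1.
Local Notation C := R[i].
Local Notation V := (V R N t).
Local Notation K := (K N).
Local Notation LP := (K -> V).

Lemma lp_ext (p q : LP) : (forall k T, p k T = q k T) -> p = q.
Proof. by move=> h; apply: boolp.funext => k; apply/ffunP => T. Qed.

Lemma lpDE (p q : LP) k : (p + q) k = p k + q k. Proof. by []. Qed.
Lemma lpZE (a : C) (p : LP) k : (a *: p) k = a *: p k. Proof. by []. Qed.
Lemma lpNE (p : LP) k : (- p) k = - p k. Proof. by []. Qed.
Lemma VNE (v : V) T : (- v) T = - v T. Proof. by rewrite ffunE. Qed.
Lemma V0E T : (0 : V) T = 0. Proof. by rewrite ffunE. Qed.
Lemma lp_sumE I (r : seq I) P (G : I -> LP) k :
  (\sum_(i <- r | P i) G i) k = \sum_(i <- r | P i) G i k.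
Proof. by elim/big_rec2: _ => // i x y _ <-. Qed.
End LaurentBase.

(* Decides linear identities after generalizing the non-linear subterms, on which
   the unification performed by [ring] would diverge. *)
Ltac lpatom e :=
  lazymatch e with
  | (?a + ?b)%R => first [lpatom a | lpatom b]
  | (- ?a)%R => lpatom a
  | (_ *: ?a)%R => lpatom a
  | _ => tryif is_var e then fail else (let x := fresh "x" in set x := e; clearbody x)
  end.
Ltac lpring :=
  repeat match goal with |- ?l = ?r => first [lpatom l | lpatom r] end;
  apply: lp_ext => ? ?; rewrite ?(lpDE, lpZE, lpNE, VDE, VNE, VZE); ring.

Section Laurent.
Variables (R : realType) (n : nat) (t : seq nat).
Local Notation N := n.+1.
Local Notation C := R[i].
Local Notation V := (V R N t).
Local Notation K := (K N).
Local Notation LP := (K -> V).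
Local Notation rep := (@rep R N t).
Local Notation is_lp := (@is_lp R N t).
Local Notation mulx := (@lp_mulx R N t).
Local Notation mono := (@lp_mono R N t).
Local Notation lop := (@lp_op R N t).
Hypothesis tP : is_partition_of N t.
Hypothesis n_gt0 : (0 < n)%N.

Lemma is_lp0 : is_lp 0.
Proof. by exists [::] => k; rewrite eqxx. Qed.

Lemma is_lpD p q : is_lp p -> is_lp q -> is_lp (p + q).
Proof.
move=> [s ps] [s' qs]; exists (s ++ s') => k; rewrite mem_cat lpDE => h.
have [p0|/ps -> //] := eqVneq (p k) 0; rewrite p0 add0r in h.
by rewrite qs ?orbT.
Qed.

Lemma is_lpZ a p : is_lp p -> is_lp (a *: p).
Proof.
move=> [s ps]; exists s => k h; apply: ps; apply: contra_neq h => h.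
by rewrite lpZE h scaler0.
Qed.

Lemma is_lpN p : is_lp p -> is_lp (- p).
Proof. by rewrite -scaleN1r; apply: is_lpZ. Qed.

Lemma is_lpB p q : is_lp p -> is_lp q -> is_lp (p - q).
Proof. by move=> hp hq; apply/is_lpD/is_lpN. Qed.

Lemma is_lp_sum I (r : seq I) (P : pred I) (G : I -> LP) :
  (forall i, P i -> is_lp (G i)) -> is_lp (\sum_(i <- r | P i) G i).
Proof. by move=> h; apply: big_ind => //; [exact: is_lp0|exact: is_lpD]. Qed.

Lemma is_lp_mulx e p : is_lp p -> is_lp (mulx e p).
Proof.
move=> [s ps]; exists [seq k + e | k <- s] => k h.
by apply/mapP; exists (k - e); rewrite ?subrK //; apply: ps.
Qed.

Lemma is_lp_mono a v : is_lp (mono a v).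
Proof.
exists [:: a] => k; rewrite /lp_mono inE; apply: contraNT => /negPf ->.
exact: eqxx.
Qed.

Lemma opv0 (A : Op R N t) : opv A 0 = 0.
Proof. by have := opvZ A 0 0; rewrite !scale0r. Qed.

Lemma opvN (A : Op R N t) v : opv A (- v) = - opv A v.
Proof. by rewrite -scaleN1r opvZ scaleN1r. Qed.

Lemma is_lp_op A p : is_lp p -> is_lp (lop A p).
Proof.
move=> [s ps]; exists s => k h; apply: ps; apply: contra_neq h => h.
by rewrite /lp_op h opv0.
Qed.

Lemma lp_expand p s : uniq s -> (forall k, p k != 0 -> k \in s) ->
  p = \sum_(k <- s) mono k (p k).
Proof.
move=> us ps; apply: boolp.funext => k; rewrite lp_sumE /lp_mono.
have [ks|ks] := boolP (k \in s).
  rewrite (bigD1_seq k) //= eqxx big1 ?addr0 // => j jk.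
  by rewrite eq_sym (negPf jk).
rewrite big_seq big1; first by apply/eqP; apply: contraNT ks; apply: ps.
by move=> j js; case: eqP => // e; rewrite e js in ks.
Qed.

Lemma lp_ind (P : LP -> Prop) : P 0 -> (forall p q, P p -> P q -> P (p + q)) ->
  (forall a v, P (mono a v)) -> forall p, is_lp p -> P p.
Proof.
move=> P0 PD Pm p [s ps]; rewrite (@lp_expand p (undup s)) ?undup_uniq //.
  by apply: big_ind.
by move=> k; rewrite mem_undup; apply: ps.
Qed.

Definition kact (w : {perm 'I_N}) (k : K) : K := [ffun i => k (w i)].

Lemma kactM u v k : kact (u * v)%g k = kact u (kact v k).
Proof. by apply/ffunP => i; rewrite !ffunE permM. Qed.
Lemma kact1 k : kact 1%g k = k.
Proof. by apply/ffunP => i; rewrite !ffunE perm1. Qed.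
Lemma kactK w : cancel (kact w) (kact w^-1%g).
Proof. by move=> k; rewrite -kactM mulVg kact1. Qed.
Lemma kactVK w : cancel (kact w^-1%g) (kact w).
Proof. by move=> k; rewrite -kactM mulgV kact1. Qed.
Lemma kactD w k l : kact w (k + l) = kact w k + kact w l.
Proof. by apply/ffunP => i; rewrite !ffunE. Qed.
Lemma kactN w k : kact w (- k) = - kact w k.
Proof. by apply/ffunP => i; rewrite !ffunE. Qed.
Lemma kact_unit w i : kact w (unitK (w i)) = unitK i.
Proof. by apply/ffunP => j; rewrite !ffunE (inj_eq perm_inj). Qed.
Lemma kact_const w m : kact w (constK N m) = constK N m.
Proof. by apply/ffunP => j; rewrite !ffunE. Qed.

(** Coefficientwise form of [(w p)(x) = tau(w) p(x w)]: the coefficient of [x^k] in [p(x w)] is that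
    of [p] at the exponent [i |-> k (w i)]. *)
Definition act (w : {perm 'I_N}) (p : LP) : LP := fun k => opv (rep w) (p (kact w k)).

Lemma actM u v p : act (v * u)%g p = act u (act v p).
Proof. by apply: boolp.funext => k; rewrite /act opv_repM // kactM. Qed.
Lemma act1 p : act 1%g p = p.
Proof. by apply: boolp.funext => k; rewrite /act opv_rep1 // kact1. Qed.
Lemma actK w : cancel (act w) (act w^-1%g).
Proof. by move=> p; rewrite -actM mulgV act1. Qed.
Lemma actD w p q : act w (p + q) = act w p + act w q.
Proof. by apply: boolp.funext => k; rewrite /act lpDE opv_is_additive. Qed.
Lemma actZ w a p : act w (a *: p) = a *: act w p.
Proof. by apply: boolp.funext => k; rewrite /act lpZE opvZ. Qed.
Lemma actN w p : act w (- p) = - act w p.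
Proof. by rewrite -scaleN1r actZ scaleN1r. Qed.
Lemma act0 w : act w 0 = 0.
Proof. by have := actZ w 0 0; rewrite !scale0r. Qed.
Lemma act_sum w I (r : seq I) P (G : I -> LP) :
  act w (\sum_(i <- r | P i) G i) = \sum_(i <- r | P i) act w (G i).
Proof. by apply: (big_morph (act w)); [exact: actD|exact: act0]. Qed.

Lemma is_lp_act w p : is_lp p -> is_lp (act w p).
Proof.
move=> [s ps]; exists (map (kact w^-1%g) s) => k h.
rewrite -[k](kactK w); apply: map_f; apply: ps; apply: contra_neq h => h.
by rewrite /act h opv0.
Qed.

Lemma mulxD e p q : mulx e (p + q) = mulx e p + mulx e q.
Proof. by []. Qed.
Lemma mulxN e p : mulx e (- p) = - mulx e p.
Proof. by []. Qed.
Lemma mulxZ e a p : mulx e (a *: p) = a *: mulx e p.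
Proof. by []. Qed.
Lemma mulx_sum e I (r : seq I) P (G : I -> LP) :
  mulx e (\sum_(i <- r | P i) G i) = \sum_(i <- r | P i) mulx e (G i).
Proof. by apply: (big_morph (mulx e)). Qed.
Lemma mulxA e f p : mulx e (mulx f p) = mulx (e + f) p.
Proof. by apply: boolp.funext => k; rewrite /lp_mulx opprD addrA. Qed.
Lemma mulx0 p : mulx 0 p = p.
Proof. by apply: boolp.funext => k; rewrite /lp_mulx subr0. Qed.
Lemma mulxC e f p : mulx e (mulx f p) = mulx f (mulx e p).
Proof. by rewrite !mulxA addrC. Qed.
Lemma mulxK e : cancel (mulx e) (mulx (- e)).
Proof. by move=> p; rewrite mulxA addNr mulx0. Qed.
Lemma mulxVK e : cancel (mulx (- e)) (mulx e).
Proof. by move=> p; rewrite mulxA addrN mulx0. Qed.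

Lemma act_mulx w e p : act w (mulx (kact w e) p) = mulx e (act w p).
Proof. by apply: boolp.funext => k; rewrite /act /lp_mulx kactD kactN. Qed.

Lemma act_mulx_unit w i p : act w (mulx (unitK i) p) = mulx (unitK (w i)) (act w p).
Proof. by rewrite -act_mulx kact_unit. Qed.

Lemma mulx_mono e a v : mulx e (mono a v) = mono (a + e) v.
Proof. by apply: boolp.funext => k; rewrite /lp_mulx /lp_mono subr_eq. Qed.

Lemma act_mono w a v : act w (mono a v) = mono (kact w^-1%g a) (opv (rep w) v).
Proof.
apply: boolp.funext => k; rewrite /act /lp_mono (can2_eq (kactK w) (kactVK w)).
by case: eqP => // _; rewrite opv0.
Qed.

Lemma lop_mulx A e p : lop A (mulx e p) = mulx e (lop A p).
Proof. by []. Qed.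

Lemma lopD A p q : lop A (p + q) = lop A p + lop A q.
Proof. by apply: boolp.funext => k; rewrite /lp_op lpDE opv_is_additive. Qed.
Lemma lopN A p : lop A (- p) = - lop A p.
Proof. by apply: boolp.funext => k; rewrite /lp_op lpNE opvN. Qed.
Lemma lopZ A a p : lop A (a *: p) = a *: lop A p.
Proof. by apply: boolp.funext => k; rewrite /lp_op lpZE opvZ. Qed.

Lemma lp_far p (k d : K) i : is_lp p -> d i = 1 ->
  exists M, forall m, (M <= m)%N -> p (k + d *+ m) = 0.
Proof.
move=> [s ps] di; exists (`|k i| + \sum_(x <- s) `|x i|)%N.+1 => m Mm.
apply/eqP; apply/negPn/negP => /ps ks.
have e : (k + d *+ m) i = k i + m%:Z by rewrite ffunE ffunMnE di natz.
have : (`|((k + d *+ m)%R : K) i| <= \sum_(x <- s) `|x i|)%N.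
  by rewrite (big_rem _ ks) /= leq_addr.
rewrite e; lia.
Qed.

(** A finitely supported function that is constant along a ray vanishes on it. This is what makes
    multiplication by [x_i - x_j] injective. *)
Lemma lp_ray y (k d : K) i : is_lp y -> d i = 1 ->
  (forall m, y (k + d *+ m) - y (k + d *+ m + d) = 0) -> y k = 0.
Proof.
move=> ylp di h; have [M hM] := lp_far k ylp di.
have e m : y k = y (k + d *+ m).
  elim: m => [|m ->]; first by rewrite mulr0n addr0.
  by have /subr0_eq -> := h m; rewrite mulrSr addrA.
by rewrite (e M) hM.
Qed.

Lemma unitK_diff i j : i != j -> (unitK i - unitK j : K) i = 1.
Proof. by move=> ij; rewrite !ffunE eqxx (negPf ij) subr0. Qed.

Lemma mulx_diff_inj i j q : i != j -> is_lp q ->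
  mulx (unitK i) q - mulx (unitK j) q = 0 -> q = 0.
Proof.
move=> ij qlp h; apply: boolp.funext => k.
apply: (@lp_ray q k (unitK i - unitK j) i qlp); first exact: unitK_diff.
move=> m; move: (k + _ *+ m) => l.
have := congr1 (fun g : LP => g (l + unitK i)) h.
by rewrite lpDE lpNE /lp_mulx addrK addrA.
Qed.

Lemma kact_tperm_eq i j (a : K) (m : nat) : a i = a j + m%:Z ->
  kact (tperm i j) a = a - (unitK i - unitK j) *+ m.
Proof.
move=> e; apply/ffunP => l; rewrite !ffunE ffunMnE !ffunE.
have e1 : ((true : nat)%:Z - (false : nat)%:Z) *+ m = m%:Z by rewrite subr0 -[RHS]natz.
case: tpermP => [->|->|/eqP li /eqP lj].
- rewrite eqxx; have [<-|ij] := eqVneq i j; first by rewrite subrr mul0rn subr0.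
  by rewrite e1 e addrK.
- rewrite eqxx; have [->|ij] := eqVneq j i; first by rewrite subrr mul0rn subr0.
  have -> : ((false : nat)%:Z - (true : nat)%:Z) *+ m = - m%:Z by rewrite -e1 -mulNrn opprB.
  by rewrite opprK e.
- by rewrite (negPf li) (negPf lj) subrr mul0rn subr0.
Qed.

Lemma kact_tpermK i j : involutive (kact (tperm i j)).
Proof. by move=> k; rewrite -kactM tperm2 kact1. Qed.

(** By linearity [p] is a monomial [x^b]; if [b i >= b j] the quotient is a geometric sum, checked
    by telescoping, and otherwise the opposite of the quotient for the exchanged exponent. *)
Lemma divdiff_ex i j p : is_lp p -> exists q, is_lp q /\
  mulx (unitK i) q - mulx (unitK j) q = p - lp_swapx i j p.
Proof.
move: p; apply: lp_ind.
- by exists 0; split; [exact: is_lp0|apply: lp_ext => k T; rewrite !lpDE !lpNE /lp_mulx !VDE !VNE !V0E].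
- move=> p q [p' [hp ep]] [q' [hq eq]]; exists (p' + q'); split; first exact: is_lpD.
  rewrite !mulxD !opprD addrACA ep eq addrACA; congr (_ + _).
move=> a v.
have pos (b : K) m : b i = b j + m%:Z -> exists q, is_lp q /\
    mulx (unitK i) q - mulx (unitK j) q = mono b v - mono (kact (tperm i j) b) v.
  move=> e; exists (\sum_(l < m) mono (b - unitK i - (unitK i - unitK j) *+ l) v); split.
    by apply: is_lp_sum => l _; apply: is_lp_mono.
  rewrite !mulx_sum -sumrB (kact_tperm_eq e).
  have -> : mono b v = mono (b - (unitK i - unitK j) *+ 0) v by rewrite mulr0n subr0.
  pose f l := mono (b - (unitK i - unitK j) *+ l) v.
  transitivity (- (\sum_(0 <= l < m) (f l.+1 - f l))); last by rewrite telescope_sumr // opprB.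
  rewrite big_mkord -sumrN; apply: eq_bigr => l _; rewrite !mulx_mono opprB /f.
  congr (mono _ v - mono _ v).
    by rewrite addrAC subrK.
  by rewrite mulrS; apply/ffunP => x; rewrite !ffunE; ring.
have [le|lt] := lerP (a j) (a i).
  have [q [qlp e]] := pos a `|a i - a j|%N ltac:(lia).
  exists q; split => //; rewrite e; congr (_ - _).
  apply: boolp.funext => k; rewrite /lp_swapx -/(kact (tperm i j) k) /lp_mono.
  by rewrite (can2_eq (kact_tpermK i j) (kact_tpermK i j)).
have [|q [qlp e]] := pos (kact (tperm i j) a) `|a i - a j|%N.
  by rewrite !ffunE tpermL tpermR; lia.
exists (- q); split; first exact: is_lpN.
rewrite !mulxN -opprD e kact_tpermK opprB; congr (_ - _).
apply: boolp.funext => k; rewrite /lp_swapx -/(kact (tperm i j) k) /lp_mono.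
by rewrite (can2_eq (kact_tpermK i j) (kact_tpermK i j)).
Qed.

Lemma divdiffP i j p : is_lp p -> is_lp (lp_divdiff i j p) /\
  mulx (unitK i) (lp_divdiff i j p) - mulx (unitK j) (lp_divdiff i j p) = p - lp_swapx i j p.
Proof. by move=> /(divdiff_ex i j) h; apply: (ClassicalEpsilon.epsilon_spec _ _ h). Qed.

(** The summand of the Dunkl operator. Equivariance and the product rules are all verified on the
    equation [tdiffP], which determines it by [tdiff_uniq]. *)
Definition tdiff i j (p : LP) : LP := lop (rep (tperm i j)) (lp_divdiff i j p).

Lemma is_lp_tdiff i j p : is_lp p -> is_lp (tdiff i j p).
Proof. by move=> /(divdiffP i j)[h _]; apply: is_lp_op. Qed.

Lemma tdiffP i j p : is_lp p ->
  mulx (unitK i) (tdiff i j p) - mulx (unitK j) (tdiff i j p) =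
  lop (rep (tperm i j)) p - act (tperm i j) p.
Proof.
by move=> /(divdiffP i j)[_ h]; rewrite -!lop_mulx -lopN -lopD h lopD lopN.
Qed.

Lemma tdiff_uniq i j p q : i != j -> is_lp p -> is_lp q ->
  mulx (unitK i) q - mulx (unitK j) q = lop (rep (tperm i j)) p - act (tperm i j) p ->
  tdiff i j p = q.
Proof.
move=> ij hp hq e; apply/eqP; rewrite -subr_eq0; apply/eqP.
apply: (mulx_diff_inj ij); first by apply/is_lpB => //; apply: is_lp_tdiff.
rewrite -[RHS](subrr (lop (rep (tperm i j)) p - act (tperm i j) p)) -{2}e -tdiffP // !mulxD !mulxN.
by lpring.
Qed.

Lemma lop_act i j (w : {perm 'I_N}) p :
  lop (rep (tperm (w i) (w j))) (act w p) = act w (lop (rep (tperm i j)) p).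
Proof.
apply: boolp.funext => k; rewrite /lp_op /act -!opv_repM //; congr (opv (rep _) _).
by rewrite -tpermJ conjgE !mulgA mulgV mul1g.
Qed.

Lemma act_tperm_act i j (w : {perm 'I_N}) p : act (tperm (w i) (w j)) (act w p) = act w (act (tperm i j) p).
Proof. by rewrite -!actM -tpermJ conjgE !mulgA mulgV mul1g. Qed.

Lemma tdiff_act i j (w : {perm 'I_N}) p : i != j -> is_lp p ->
  tdiff (w i) (w j) (act w p) = act w (tdiff i j p).
Proof.
move=> ij hp; apply: tdiff_uniq.
- by rewrite (inj_eq perm_inj).
- exact: is_lp_act.
- by apply/is_lp_act/is_lp_tdiff.
- have := congr1 (act w) (tdiffP i j hp).
  by rewrite !(actD, actN) !act_mulx_unit => ->; rewrite lop_act act_tperm_act.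
Qed.

Lemma tdiff_linear i j (a : C) p q : i != j -> is_lp p -> is_lp q ->
  tdiff i j (a *: p + q) = a *: tdiff i j p + tdiff i j q.
Proof.
move=> ij hp hq; apply: tdiff_uniq => //.
- by apply: is_lpD => //; apply: is_lpZ.
- by apply: is_lpD; [apply/is_lpZ|]; apply: is_lp_tdiff.
rewrite !mulxD !mulxZ opprD addrACA -scalerBr !tdiffP // lopD lopZ actD actZ.
by rewrite opprD addrACA scalerBr.
Qed.

Lemma kact_tperm_unit i j : kact (tperm i j) (unitK j) = unitK i.
Proof. by rewrite -[in unitK j](tpermL i j) kact_unit. Qed.

Lemma kact_tperm_unit' i j : kact (tperm i j) (unitK i) = unitK j.
Proof. by rewrite -[in unitK i](tpermR i j) kact_unit. Qed.

Lemma tdiff_mulx_other i j e p : i != j -> is_lp p -> kact (tperm i j) e = e ->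
  tdiff i j (mulx e p) = mulx e (tdiff i j p).
Proof.
move=> ij hp ee; apply: tdiff_uniq => //; first exact: is_lp_mulx.
  by apply/is_lp_mulx/is_lp_tdiff.
rewrite -[in act _ (mulx e p)]ee act_mulx lop_mulx !(mulxC _ e) -!mulxN -!mulxD.
by rewrite tdiffP.
Qed.

Lemma tdiff_mulx_fst i j p : i != j -> is_lp p ->
  tdiff i j (mulx (unitK i) p) = mulx (unitK i) (tdiff i j p) + act (tperm i j) p.
Proof.
move=> ij hp; apply: tdiff_uniq => //; first exact: is_lp_mulx.
  by apply: is_lpD; [apply/is_lp_mulx/is_lp_tdiff|apply: is_lp_act].
have e : act (tperm i j) (mulx (unitK i) p) = mulx (unitK j) (act (tperm i j) p).
  by rewrite -act_mulx kact_tperm_unit.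
have := congr1 (mulx (unitK i)) (tdiffP i j hp).
rewrite e lop_mulx !mulxD !mulxN (mulxC (unitK j)) => h.
by rewrite -[X in _ = X - _](subrK (mulx (unitK i) (act (tperm i j) p))) -h; lpring.
Qed.

Lemma tdiff_mulx_snd i j p : i != j -> is_lp p ->
  tdiff i j (mulx (unitK j) p) = mulx (unitK j) (tdiff i j p) - act (tperm i j) p.
Proof.
move=> ij hp; apply: tdiff_uniq => //; first exact: is_lp_mulx.
  by apply: is_lpB; [apply/is_lp_mulx/is_lp_tdiff|apply: is_lp_act].
have e : act (tperm i j) (mulx (unitK j) p) = mulx (unitK i) (act (tperm i j) p).
  by rewrite -act_mulx kact_tperm_unit'.
have := congr1 (mulx (unitK j)) (tdiffP i j hp).
rewrite e lop_mulx !mulxD !mulxN (mulxC (unitK j) (unitK i)) => h.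
by rewrite -[X in _ = X - _](subrK (mulx (unitK j) (act (tperm i j) p))) -h; lpring.
Qed.
Variable kappa : R.
Local Notation kc := (kappa%:C).

Definition euler i (p : LP) : LP := fun k => ((k i + 1)%:~R : C) *: p k.

(* [x_i D_i + 1] *)
Definition dunklE i (p : LP) : LP :=
  euler i p + kc *: \sum_(j < N | j != i) mulx (unitK i) (tdiff i j p).

(* [D_i x_i = x_i D_i + 1 + kappa * sum_{j != i} act (i,j)], and the terms [j < i] cancel
   in the Cherednik-Dunkl operator. *)
Definition cherU i (p : LP) : LP :=
  dunklE i p + kc *: \sum_(j < N | (i < j)%N) act (tperm i j) p.

Lemma euler_linear i (a : C) p q : euler i (a *: p + q) = a *: euler i p + euler i q.
Proof. by apply: lp_ext => k T; rewrite /euler !(lpDE, lpZE, VDE, VZE); ring. Qed.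

Lemma act_euler w i p : act w (euler i p) = euler (w i) (act w p).
Proof.
by apply: boolp.funext => k; rewrite /act /euler opvZ ffunE.
Qed.

Lemma euler_mulx i e p : euler i (mulx e p) = mulx e (euler i p + (e i)%:~R *: p).
Proof.
apply: boolp.funext => k; rewrite /lp_mulx lpDE lpZE /euler -scalerDl !ffunE.
by congr (_ *: _); rewrite -intrD; congr (_%:~R); rewrite addrAC subrK.
Qed.

Lemma cdunkl_split i p : is_lp p -> cdunkl kappa i p =
  euler i p + kc *: (\sum_(j < N | j != i) tdiff i j (mulx (unitK i) p))
  - kc *: (\sum_(j < N | (j < i)%N) act (tperm i j) p).
Proof.
move=> hp; apply: boolp.funext => k; rewrite !lpDE lpNE !lpZE !lp_sumE.
have e : lp_deriv i (mulx (unitK i) p) k = euler i p k by rewrite /lp_deriv /lp_mulx addrK.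
by rewrite /cdunkl /dunkl e; reflexivity.
Qed.

Lemma dunklEE i p : dunklE i p =
  euler i p + kc *: \sum_(j < N | j != i) mulx (unitK i) (tdiff i j p).
Proof. by []. Qed.

Lemma cherUE i p : cherU i p =
  dunklE i p + kc *: \sum_(j < N | (i < j)%N) act (tperm i j) p.
Proof. by []. Qed.

(* Unfolding these during unification makes rewriting intractable. *)
#[local] Opaque act tdiff lp_mulx lp_op dunklE cherU euler.

Lemma cdunklE i p : is_lp p -> cdunkl kappa i p = cherU i p.
Proof.
move=> hp; rewrite cdunkl_split // cherUE dunklEE.
have -> : \sum_(j < N | j != i) tdiff i j (mulx (unitK i) p) =
    \sum_(j < N | j != i) mulx (unitK i) (tdiff i j p) +
    \sum_(j < N | j != i) act (tperm i j) p.
  by rewrite -big_split; apply: eq_bigr => j ji /=; rewrite tdiff_mulx_fst 1?eq_sym.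
have -> : \sum_(j < N | j != i) act (tperm i j) p =
    \sum_(j < N | (j < i)%N) act (tperm i j) p + \sum_(j < N | (i < j)%N) act (tperm i j) p.
  rewrite (bigID (fun j : 'I_N => (j < i)%N)) /=.
  by congr (_ + _); apply: eq_bigl => j; rewrite -val_eqE /=; lia.
lpring.
Qed.

Lemma dunklE_linear i (a : C) p q : is_lp p -> is_lp q ->
  dunklE i (a *: p + q) = a *: dunklE i p + dunklE i q.
Proof.
move=> hp hq; rewrite !dunklEE euler_linear.
have -> : \sum_(j < N | j != i) mulx (unitK i) (tdiff i j (a *: p + q)) =
   a *: (\sum_(j < N | j != i) mulx (unitK i) (tdiff i j p)) +
   \sum_(j < N | j != i) mulx (unitK i) (tdiff i j q).
  rewrite scaler_sumr -big_split; apply: eq_bigr => j ji /=.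
  by rewrite tdiff_linear 1?eq_sym // mulxD mulxZ.
by lpring.
Qed.

Lemma cherU_linear i (a : C) p q : is_lp p -> is_lp q ->
  cherU i (a *: p + q) = a *: cherU i p + cherU i q.
Proof.
move=> hp hq; rewrite !cherUE dunklE_linear //.
have -> : \sum_(j < N | (i < j)%N) act (tperm i j) (a *: p + q) =
   a *: (\sum_(j < N | (i < j)%N) act (tperm i j) p) +
   \sum_(j < N | (i < j)%N) act (tperm i j) q.
  by rewrite scaler_sumr -big_split; apply: eq_bigr => j ji /=; rewrite actD actZ.
by lpring.
Qed.

Lemma act_dunklE w i p : is_lp p -> act w (dunklE i p) = dunklE (w i) (act w p).
Proof.
move=> hp; rewrite !dunklEE actD actZ act_euler act_sum; congr (_ + _ *: _).
rewrite [RHS](reindex_inj (@perm_inj _ w)) /=.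
apply: eq_big => [j|j ji]; first by rewrite (inj_eq perm_inj).
by rewrite act_mulx_unit tdiff_act // eq_sym.
Qed.

(** The term [j = i+1] of [U_i] is [kappa * s_i], whose product with [s_i] is the constant [kappa];
    the other terms are conjugated into those of [U_(i+1)]. *)
Lemma cherU_lo i p : (i < n)%N -> is_lp p ->
  act (stp n i) (cherU (ord_lo n i) p) = cherU (ord_hi n i) (act (stp n i) p) + kc *: p.
Proof.
move=> i_n hp; rewrite !cherUE actD actZ act_dunklE // stp_lo act_sum.
rewrite (bigD1 (ord_hi n i)) /=; last by rewrite ord_loE ?ord_hiE.
have -> : act (stp n i) (act (tperm (ord_lo n i) (ord_hi n i)) p) = p.
  by rewrite -actM /stp tperm2 act1.
have -> : \sum_(j < N | (ord_lo n i < j)%N && (j != ord_hi n i))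
     act (stp n i) (act (tperm (ord_lo n i) j) p) =
   \sum_(j < N | (ord_hi n i < j)%N) act (tperm (ord_hi n i) j) (act (stp n i) p).
  apply: eq_big => [j|j /andP[h1 h2]].
    by rewrite -val_eqE /= ord_hiE // ord_loE //; lia.
  rewrite -act_tperm_act stp_lo stp_id //.
    by move: h1; rewrite ord_loE //; lia.
  by move: h2; rewrite -val_eqE /= ord_hiE.
by lpring.
Qed.

Lemma act_stpK i q : act (stp n i) (act (stp n i) q) = q.
Proof. by rewrite -actM /stp tperm2 act1. Qed.

Lemma cherU_hi i p : (i < n)%N -> is_lp p ->
  act (stp n i) (cherU (ord_hi n i) p) = cherU (ord_lo n i) (act (stp n i) p) - kc *: p.
Proof.
move=> i_n hp.
have := cherU_lo i_n (is_lp_act (stp n i) hp); rewrite act_stpK => /(congr1 (act (stp n i))).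
by rewrite act_stpK actD actZ act_stpK => ->; rewrite addrK.
Qed.

Lemma cherU_other i j p : (i < n)%N -> is_lp p -> j != ord_lo n i -> j != ord_hi n i ->
  act (stp n i) (cherU j p) = cherU j (act (stp n i) p).
Proof.
move=> i_n hp jlo jhi.
have sj : stp n i j = j.
  by apply: stp_id => //; [move: jlo; rewrite -val_eqE /= ord_loE|move: jhi; rewrite -val_eqE /= ord_hiE].
rewrite !cherUE actD actZ act_dunklE // sj act_sum; congr (_ + _ *: _).
rewrite [RHS](reindex_inj (@perm_inj _ (stp n i))) /=.
apply: eq_big => [l|l jl]; last by rewrite -act_tperm_act sj.
move: jlo jhi; rewrite -!val_eqE /= ord_loE ?ord_hiE // => jlo jhi.
by rewrite stpE // /adj_swap; repeat case: eqP; lia.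
Qed.

Lemma kact_tperm_other i j l : l != i -> l != j -> kact (tperm i j) (unitK l) = unitK l.
Proof. by move=> li lj; rewrite -[in LHS](tpermD (x := i) (y := j) (z := l)) 1?eq_sym // kact_unit. Qed.

Lemma mulx_lin2 e a p I (r : seq I) P (G : I -> LP) :
  mulx e (p + a *: \sum_(i <- r | P i) G i) = mulx e p + a *: \sum_(i <- r | P i) mulx e (G i).
Proof. by rewrite -mulx_sum. Qed.

Lemma mulx_lin3 e a b p I (r : seq I) P (G : I -> LP) J (s : seq J) Q (H : J -> LP) :
  mulx e (p + a *: (\sum_(i <- r | P i) G i) + b *: \sum_(i <- s | Q i) H i) =
  mulx e p + a *: (\sum_(i <- r | P i) mulx e (G i)) + b *: \sum_(i <- s | Q i) mulx e (H i).
Proof. by rewrite -!mulx_sum. Qed.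

Lemma dunklE_x0 i p : i != ord0 -> is_lp p ->
  dunklE i (mulx (unitK ord0) p) =
  mulx (unitK ord0) (dunklE i p) - kc *: act (tperm i ord0) (mulx (unitK ord0) p).
Proof.
move=> i0 hp; rewrite !dunklEE mulxD mulxZ mulx_sum.
have -> : euler i (mulx (unitK ord0) p) = mulx (unitK ord0) (euler i p).
  by rewrite euler_mulx !ffunE (negPf i0) scale0r addr0.
have -> : act (tperm i ord0) (mulx (unitK ord0) p) = mulx (unitK i) (act (tperm i ord0) p).
  by rewrite -act_mulx kact_tperm_unit'.
have -> : \sum_(j < N | j != i) mulx (unitK i) (tdiff i j (mulx (unitK ord0) p)) =
    \sum_(j < N | j != i) mulx (unitK ord0) (mulx (unitK i) (tdiff i j p)) -
    mulx (unitK i) (act (tperm i ord0) p).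
  rewrite (bigD1 ord0) 1?eq_sym //= [X in X - _](bigD1 ord0) 1?eq_sym //=.
  rewrite tdiff_mulx_snd // mulxD mulxN (mulxC (unitK i)) addrAC; congr (_ + _ - _).
  apply: eq_bigr => j /andP[ji j0].
  by rewrite tdiff_mulx_other 1?eq_sym // ?(mulxC (unitK i)) // kact_tperm_other // eq_sym.
lpring.
Qed.

Lemma dunklE_x0_0 p : is_lp p ->
  dunklE ord0 (mulx (unitK ord0) p) =
  mulx (unitK ord0) (dunklE ord0 p + p + kc *: \sum_(j < N | j != ord0) act (tperm ord0 j) p).
Proof.
move=> hp; rewrite !dunklEE [RHS]mulx_lin2 mulxD mulx_lin2.
have -> : euler ord0 (mulx (unitK ord0) p) = mulx (unitK ord0) (euler ord0 p) + mulx (unitK ord0) p.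
  by rewrite euler_mulx !ffunE eqxx scale1r mulxD.
have -> : \sum_(j < N | j != ord0) mulx (unitK ord0) (tdiff ord0 j (mulx (unitK ord0) p)) =
    \sum_(j < N | j != ord0) mulx (unitK ord0) (mulx (unitK ord0) (tdiff ord0 j p)) +
    \sum_(j < N | j != ord0) mulx (unitK ord0) (act (tperm ord0 j) p).
  by rewrite -big_split; apply: eq_bigr => j j0 /=; rewrite tdiff_mulx_fst 1?eq_sym // mulxD.
lpring.
Qed.

Definition cyc : {perm 'I_N} := perm (can_inj (@ord_predK N)).

Lemma cyc0 : cyc ord0 = ord_max.
Proof. by apply: val_inj; rewrite permE /= modn_small. Qed.

Lemma cycE (i : 'I_N) : i != ord0 -> cyc i = i.-1 :> nat.
Proof.
clear tP n_gt0.
rewrite -val_eqE /= => i0; rewrite permE /=.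
have -> : (i + N).-1 = (i.-1 + N)%N by lia.
by rewrite modnDr modn_small //; have := ltn_ord i; lia.
Qed.

(* The affine step: it maps zeta_{a,T} to zeta_{aff a,T}. *)
Definition omega (p : LP) : LP := act cyc (mulx (unitK ord0) p).

Lemma omegaE p : omega p = act cyc (mulx (unitK ord0) p).
Proof. by []. Qed.

Lemma is_lp_omega p : is_lp p -> is_lp (omega p).
Proof. by move=> hp; apply/is_lp_act/is_lp_mulx. Qed.
#[local] Opaque omega.

Lemma cherU_omega_max p : is_lp p -> cherU ord_max (omega p) = omega (cherU ord0 p + p).
Proof.
move=> hp; rewrite !cherUE big_pred0; last first.
  by move=> j /=; have := ltn_ord j; lia.
rewrite !omegaE -cyc0 -act_dunklE; last exact: is_lp_mulx.
rewrite dunklE_x0_0 // scaler0 addr0; congr (act _ (mulx _ _)).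
have -> : \sum_(j < N | ((ord0 : 'I_N) < j)%N) act (tperm ord0 j) p = \sum_(j < N | j != ord0) act (tperm ord0 j) p.
  by apply: eq_bigl => j; rewrite -val_eqE /=; lia.
lpring.
Qed.

(** The commutator of the Dunkl part with [x_1] is [- kappa] times the exchange of [i] and the first
    index. The cycle sends the first index to the last, so this cancels the extra term [j = ord_max]
    of the sum for [cyc i]. *)
Lemma cherU_omega (i : 'I_N) p : i != ord0 -> is_lp p ->
  cherU (cyc i) (omega p) = omega (cherU i p).
Proof.
move=> i0 hp; have hx := is_lp_mulx (unitK ord0) hp.
rewrite !cherUE !omegaE [X in _ = act _ X]mulx_lin2 -(act_dunklE cyc i hx) (dunklE_x0 i0 hp).
have -> : \sum_(j < N | (cyc i < j)%N) act (tperm (cyc i) j) (act cyc (mulx (unitK ord0) p)) =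
    act cyc (act (tperm i ord0) (mulx (unitK ord0) p)) +
    act cyc (\sum_(j < N | (i < j)%N) mulx (unitK ord0) (act (tperm i j) p)).
  rewrite (bigD1 ord_max) /=; last first.
    by rewrite cycE //; have := ltn_ord i; move: i0; rewrite -val_eqE /=; lia.
  rewrite -{1}cyc0 act_tperm_act; congr (_ + _).
  rewrite act_sum (reindex_inj (@perm_inj _ cyc)) /=; apply: eq_big => [j|j /andP[h1 h2]].
    rewrite -cyc0 (inj_eq perm_inj) cycE //.
    have [->|j0] := eqVneq j ord0; first by rewrite andbF.
    by rewrite andbT cycE //; move: i0 j0; rewrite -!val_eqE /=; lia.
  rewrite act_tperm_act; congr (act _ _); rewrite -act_mulx kact_tperm_other // eq_sym //.
  by move: h2; rewrite -cyc0 (inj_eq perm_inj).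
rewrite actD actN actZ [RHS]actD actZ; lpring.
Qed.

Lemma cherU_const i m p : is_lp p ->
  cherU i (mulx (constK N m) p) = mulx (constK N m) (cherU i p + m%:~R *: p).
Proof.
move=> hp; rewrite !cherUE !dunklEE (mulxD _ (_ + _ + _)) mulx_lin3 mulxZ.
have -> : euler i (mulx (constK N m) p) = mulx (constK N m) (euler i p) + m%:~R *: mulx (constK N m) p.
  by rewrite euler_mulx !ffunE mulxD mulxZ.
have -> : \sum_(j < N | j != i) mulx (unitK i) (tdiff i j (mulx (constK N m) p)) =
    \sum_(j < N | j != i) mulx (constK N m) (mulx (unitK i) (tdiff i j p)).
  by apply: eq_bigr => j ji; rewrite tdiff_mulx_other 1?eq_sym // ?kact_const // (mulxC (unitK i)).
have -> : \sum_(j < N | (i < j)%N) act (tperm i j) (mulx (constK N m) p) =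
    \sum_(j < N | (i < j)%N) mulx (constK N m) (act (tperm i j) p).
  by apply: eq_bigr => j ji; rewrite -act_mulx kact_const.
lpring.
Qed.

End Laurent.

(** * The order on compositions *)

Section Compositions.
Variable n : nat.
Local Notation N := n.+1.
Local Notation K := (K N).
Local Notation dom := (@Defs.dom N).

Definition vals (a : K) : seq int := [seq a i | i <- enum 'I_N].

Lemma size_vals a : size (vals a) = N.
Proof. by rewrite size_map size_enum_ord. Qed.

Lemma plus_sort a : exists2 s, perm_eq s (vals a) &
  sorted (fun x y : int => y <= x) s /\ forall i : 'I_N, plus a i = nth 0 s i.
Proof.
exists (sort (fun x y : int => y <= x) (vals a)); first by rewrite perm_sort.
split; first by apply: sort_sorted => x y; exact: le_total.
by move=> i; rewrite ffunE.
Qed.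

Lemma sum_vals (f : int -> int) (a : K) : \sum_(i < N) f (a i) = \sum_(x <- vals a) f x.
Proof. by rewrite big_map enumT. Qed.

Lemma sum_nth (f : int -> int) (s : seq int) : size s = N ->
  \sum_(i < N) f (nth 0 s i) = \sum_(x <- s) f x.
Proof. by move=> <-; rewrite (big_nth 0) big_mkord. Qed.

Lemma sum_plus (f : int -> int) (a : K) : \sum_(i < N) f (plus a i) = \sum_(i < N) f (a i).
Proof.
have [s sa [_ e]] := plus_sort a.
transitivity (\sum_(x <- s) f x); last by rewrite sum_vals; apply: perm_big.
rewrite -sum_nth; last by rewrite (perm_size sa) size_vals.
by apply: eq_bigr => i _; rewrite e.
Qed.

Lemma plus_nincr a (i j : 'I_N) : (i <= j)%N -> plus a j <= plus a i.
Proof.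
have [s sa [ss e]] := plus_sort a; rewrite !e => ij.
have sN : size s = N by rewrite (perm_size sa) size_vals.
apply: (@sorted_leq_nth _ (fun x y : int => y <= x) _ _ 0 s ss) => //; rewrite ?inE ?sN //.
by move=> x y z /= h1 h2; apply: le_trans h2 h1.
Qed.

Lemma plus_kact (w : {perm 'I_N}) (a : K) : plus (kact w a) = plus a.
Proof.
have p : perm_eq (vals (kact w a)) (vals a).
  apply/seq.permP => P; rewrite !count_map -!size_filter -!sum1_size !big_filter /=.
  rewrite -!enumT !big_enum_cond /= [RHS](reindex_inj (@perm_inj _ w)) /=.
  by apply: eq_bigl => i; rewrite /= ffunE.
apply/ffunP => i; rewrite !ffunE; congr (nth _ _ _).
apply/(@perm_sortP _ (fun x y : int => y <= x)) => //.
- by move=> x y; exact: le_total.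
- by move=> x y z /= h1 h2; apply: le_trans h2 h1.
- by move=> x y /= h; apply/eqP; rewrite eq_le andbC.
Qed.

(* The dominance order on partitions is tested by these sums: [excess a s] does not depend
   on the order of the entries and bounds every partial sum. *)
Definition excess (a : K) (s : int) : int := \sum_(i < N) Num.max (a i - s) 0.

Lemma card_ord_leq (i : 'I_N) : #|[pred j : 'I_N | (j <= i)%N]| = i.+1.
Proof.
rewrite -[RHS]card_ord -(@fintype.card_image _ _ (widen_ord (ltn_ord i))); last first.
  by move=> x y /(congr1 val)/= /val_inj.
apply: eq_card => c; apply/idP/fintype.imageP => [h|[x _ ->]]; last exact: (ltn_ord x).
by exists (Ordinal (h : (c < i.+1)%N)) => //; apply: val_inj.
Qed.

Lemma psum_le_excess a s i : psum a i <= (i.+1)%:Z * s + excess a s.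
Proof.
rewrite /psum /excess.
have -> : (i.+1)%:Z * s = \sum_(j < N | (j <= i)%N) s.
  rewrite sumr_const -mulr_natl natz; congr (_%:Z * _).
  exact/esym/card_ord_leq.
rewrite [X in _ + X](bigID (fun j : 'I_N => (j <= i)%N)) /= addrA -big_split /= -[X in X <= _]addr0.
apply: lerD; last by apply: sumr_ge0 => j _; rewrite le_max lexx orbT.
by apply: ler_sum => j _; lia.
Qed.

(** For a partition the bound [psum_le_excess] is attained at [s = plus a i], so dominance can be
    read off from [excess]. *)
Lemma psum_plus_excess a (i : 'I_N) :
  psum (plus a) i = (i.+1)%:Z * plus a i + excess (plus a) (plus a i).
Proof.
rewrite /psum /excess.
have -> : (i.+1)%:Z * plus a i = \sum_(j < N | (j <= i)%N) plus a i.
  rewrite sumr_const -mulr_natl natz; congr (_%:Z * _).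
  exact/esym/card_ord_leq.
rewrite [X in _ + X](bigID (fun j : 'I_N => (j <= i)%N)) /= addrA -big_split /= -[LHS]addr0.
congr (_ + _).
  by apply: eq_bigr => j ji; have := plus_nincr a ji; lia.
rewrite big1 // => j; rewrite -ltnNge => ij; have := plus_nincr a (ltnW ij); lia.
Qed.

Lemma excess_plus a s : excess (plus a) s = excess a s.
Proof. exact: (sum_plus (fun x => Num.max (x - s) 0)). Qed.

Lemma psum_inj (a b : K) : (forall i, psum a i = psum b i) -> a = b.
Proof.
move=> h; apply/ffunP => i.
have e c : psum c i = \sum_(j < N | (j < i)%N) c j + c i.
  rewrite /psum (bigD1 i) //= addrC; congr (_ + _); apply: eq_bigl => j.
  by rewrite -val_eqE /= ltn_neqAle andbC.
have [i0|i0] := posnP i.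
  have := h i; rewrite !e !big_pred0 ?add0r //; by move=> j; rewrite i0.
have := h (inord i.-1); have := h i; rewrite !e.
have f c : psum c (inord i.-1) = \sum_(j < N | (j < i)%N) c j.
  apply: eq_bigl => j; rewrite inordK; last by have := ltn_ord i; lia.
  by rewrite -ltnS prednK.
by rewrite !f => + e2; rewrite e2 => /addrI.
Qed.

Lemma prec_trans (a b c : K) : prec a b -> prec b c -> prec a c.
Proof.
move=> /andP[/forallP ab nab] /andP[/forallP bc nbc]; apply/andP; split.
  by apply/forallP => i; apply: le_trans (bc i).
apply/eqP => e; case/eqP: nab; apply: psum_inj => i; apply/eqP.
by rewrite eq_le ab e bc.
Qed.

Lemma prec_irr (a : K) : prec a a = false.
Proof. by rewrite /prec eqxx andbF. Qed.

Lemma dom_trans (a b c : K) : dom a b -> dom b c -> dom a c.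
Proof.
move=> /andP[/eqP s1 /orP[p1|/andP[/eqP e1 p1]]] /andP[/eqP s2 /orP[p2|/andP[/eqP e2 p2]]];
  rewrite /dom s1 s2 eqxx /=.
- by rewrite (prec_trans p1 p2).
- by rewrite -e2 p1.
- by rewrite e1 p2.
- by rewrite e1 e2 eqxx (prec_trans p1 p2) orbT.
Qed.

Lemma dom_irr (a : K) : dom a a = false.
Proof. by rewrite /dom !prec_irr andbF andbF. Qed.

Lemma dom_asym (a b : K) : dom a b -> dom b a = false.
Proof. by move=> ab; apply/negP => /(dom_trans ab); rewrite dom_irr. Qed.

(** Bringing two entries closer with the same sum does not increase [excess], a sum of convex
    functions of the entries. *)
Lemma dom_transfer (i j : 'I_N) (b a : K) : i != j ->
  (forall l, l != i -> l != j -> b l = a l) -> b i + b j = a i + a j ->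
  `|b i - b j| < `|a i - a j| -> dom b a.
Proof.
move=> ij off sum lt.
have split2 (f : int -> int) c : \sum_l f (c l) = f (c i) + (f (c j) +
    \sum_(l < N | (l != i) && (l != j)) f (c l)) :> int.
  by rewrite (bigD1 i) //= (bigD1 j) // eq_sym.
have offs (f : int -> int) : \sum_(l < N | (l != i) && (l != j)) f (b l) =
    \sum_(l < N | (l != i) && (l != j)) f (a l).
  by apply: eq_bigr => l /andP[li lj]; rewrite off.
apply/andP; split.
  by apply/eqP; rewrite /sumK !(split2 id) (offs id) !addrA sum.
apply/orP; left; apply/andP; split; last first.
  apply/eqP => e.
  (* The sum of squares drops strictly, so the two rearrangements differ. *)
  have := sum_plus (fun x => x * x) b; rewrite e (sum_plus (fun x => x * x) a).
  rewrite !(split2 (fun x => x * x)) (offs (fun x => x * x)) !addrA => /addIr; nia.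
apply/forallP => l; rewrite [X in _ <= X]psum_plus_excess.
apply: le_trans (psum_le_excess _ (plus a l) l) _.
rewrite lerD2l !excess_plus /excess.
rewrite !(split2 (fun x => Num.max (x - plus a l) 0)) (offs (fun x => Num.max (x - plus a l) 0)) !addrA lerD2r; lia.
Qed.

Lemma dom_swap (i j : 'I_N) (a : K) : (i < j)%N -> a i < a j -> dom a (kact (tperm i j) a).
Proof.
move=> ij aij; rewrite /dom plus_kact eqxx /=.
have ijn : i != j by rewrite -val_eqE /= neq_ltn ij.
have -> : sumK a == sumK (kact (tperm i j) a).
  rewrite /sumK [X in X == _](reindex_inj (@perm_inj _ (tperm i j))) /=.
  by apply/eqP; apply: eq_bigr => l _; rewrite ffunE.
rewrite prec_irr /=; apply/andP; split; last first.
  by apply/eqP => /(congr1 (fun f : K => f i)); rewrite ffunE tpermL; lia.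
apply/forallP => l; rewrite /psum.
have [li|il] := ltnP l i.
  rewrite le_eqVlt; apply/orP; left; apply/eqP; apply: eq_bigr => m ml.
  by rewrite ffunE tpermD // -val_eqE /=; lia.
rewrite (bigD1 i) //= [X in _ <= X](bigD1 i) //= [X in _ <= X + _]ffunE tpermL.
have [jl|lj] := leqP j l.
  rewrite (bigD1 j) /=; last by rewrite jl eq_sym.
  rewrite [X in _ <= _ + X](bigD1 j) /=; last by rewrite jl eq_sym.
  rewrite [X in _ <= _ + (X + _)]ffunE tpermR addrCA lerD2l lerD2l.
  rewrite le_eqVlt; apply/orP; left; apply/eqP; apply: eq_bigr => m /andP[/andP[_ mi] mj].
  by rewrite ffunE tpermD // eq_sym.
apply: lerD; first exact: ltW.
rewrite le_eqVlt; apply/orP; left; apply/eqP; apply: eq_bigr => m /andP[ml mi].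
rewrite ffunE tpermD //; first by rewrite eq_sym.
by rewrite -val_eqE /=; lia.
Qed.

Definition before (a : K) (j i : 'I_N) : bool := (a i < a j) || ((a j == a i) && (j < i)%N).

Lemma before_irr a i : before a i i = false.
Proof. by rewrite /before ltxx ltnn andbF. Qed.

Lemma before_trans a k j i : before a k j -> before a j i -> before a k i.
Proof. by rewrite /before; lia. Qed.

Lemma before_total a i j : i != j -> before a j i = ~~ before a i j.
Proof. by rewrite /before -val_eqE /=; lia. Qed.

Lemma rank_natE a i : rank_nat a i = #|[pred j | before a j i]|.
Proof.
rewrite /rank_nat [X in (_ + X)%N](cardD1 i) inE /= leqnn eqxx addnS /=.
rewrite -cardUI [X in (_ + X)%N]eq_card0 ?addn0; last first.
  by move=> j; rewrite !inE; lia.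
apply: eq_card => j; rewrite !inE /before -val_eqE /=; lia.
Qed.

Lemma rank_nat_lt a i j : before a j i -> (rank_nat a j < rank_nat a i)%N.
Proof.
move=> ji; rewrite !rank_natE; apply: proper_card; apply/properP; split.
  by apply/fintype.subsetP => k; rewrite !inE => kj; apply: before_trans ji.
by exists j; rewrite !inE ?before_irr.
Qed.

Lemma rankpE (a : K) i : rankp a i = rank_nat a i :> nat.
Proof.
rewrite /rankp; case: pickP => [r /forallP/(_ i)/eqP //|h].
have rN j : (rank_nat a j < N)%N.
  rewrite rank_natE -[X in (_ < X)%N](card_ord N); apply: proper_card; apply/properP.
  by split; [exact: subset_predT|exists j; rewrite ?inE ?before_irr].
pose f j := Ordinal (rN j).
have f_inj : injective f.
  move=> x y /(congr1 val) /= e; apply/eqP; apply/negPn/negP => xy.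
  case: (boolP (before a x y)) => [/rank_nat_lt|]; first by rewrite e ltnn.
  by rewrite -before_total // => /rank_nat_lt; rewrite e ltnn.
by have := h (perm f_inj); rewrite (introT forallP) // => j; rewrite permE.
Qed.

Lemma rankp_lt a i j : (rankp a j < rankp a i)%N = before a j i.
Proof.
rewrite !rankpE; apply/idP/idP => [h|]; last exact: rank_nat_lt.
have [e|ij] := eqVneq j i; first by rewrite e ltnn in h.
rewrite before_total 1?eq_sym //; apply/negP => /rank_nat_lt; lia.
Qed.

Lemma card_ord_lt (i : 'I_N) : #|[pred j : 'I_N | (j < i)%N]| = i.
Proof.
have := card_ord_leq i; rewrite (cardD1 i) !inE leqnn add1n => -[h]; rewrite -[RHS]h.
by apply: eq_card => j; rewrite !inE -val_eqE /= ltn_neqAle.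
Qed.

(** The rank is the only permutation monotone for the total order [before a]; ranks after a swap, a
    shift or the affine step are identified in this way. *)
Lemma rankp_uniq a (w : {perm 'I_N}) :
  (forall i j, before a j i -> (w j < w i)%N) -> w = rankp a.
Proof.
move=> h; apply/permP => i; apply: val_inj => /=.
have hw j : (w j < w i)%N = before a j i.
  apply/idP/idP => [ji|/h//]; have [e|ij] := eqVneq j i; first by rewrite e ltnn in ji.
  by rewrite before_total 1?eq_sym //; apply/negP => /h; lia.
rewrite rankpE rank_natE -[LHS]card_ord_lt -!sum1_card (reindex_inj (@perm_inj _ w)) /=.
by apply: eq_bigl => j; rewrite !inE hw.
Qed.

Lemma rankp_swap (a : K) i : (i < n)%N -> a (ord_lo n i) != a (ord_hi n i) ->
  rankp (kact (stp n i) a) = (stp n i * rankp a)%g.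
Proof.
move=> i_n aa; apply/esym/rankp_uniq => k j; rewrite !permM rankp_lt /before !ffunE.
case/orP => [-> //|/andP[e jk]]; rewrite e /=; apply/orP; right.
rewrite ltnNge; apply/negP => h.
have [ej ek] : j = ord_lo n i /\ k = ord_hi n i.
  have sjk : stp n i j != stp n i k by rewrite (inj_eq perm_inj) -val_eqE /= neq_ltn jk.
  apply: (stp_invert i_n) _ (ltnW jk); rewrite ltn_neqAle h andbT.
  by rewrite val_eqE eq_sym.
by move: e; rewrite ej ek stp_lo stp_hi eq_sym (negPf aa).
Qed.

Lemma rankp_const (a : K) m : rankp (a + constK N m) = rankp a.
Proof.
apply/esym/rankp_uniq => i j; rewrite rankp_lt /before !ffunE.
by rewrite ltrD2r (inj_eq (addIr _)).
Qed.

Lemma rankp0 : rankp (0 : K) = 1%g.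
Proof. by apply/esym/rankp_uniq => i j; rewrite !perm1 /before !ffunE ltxx eqxx. Qed.

(** The map [(a_1, ..., a_N) |-> (a_2, ..., a_N, a_1 + 1)]. *)
Definition aff (a : K) : K := kact (cyc n)^-1%g (a + unitK ord0).

Lemma aff_cyc a i : aff a (cyc n i) = a i + (i == ord0)%:Z.
Proof. by rewrite !ffunE permK. Qed.

Lemma cyc_lt (i j : 'I_N) : (cyc n j < cyc n i)%N =
  if i == ord0 then j != ord0 else (j != ord0) && (j < i)%N.
Proof.
have [->|i0] := eqVneq i ord0; have [->|j0] := eqVneq j ord0 => /=.
- by rewrite ltnn.
- by rewrite cyc0 cycE //=; have := ltn_ord j; move: j0; rewrite -val_eqE /=; lia.
- by rewrite cyc0 /=; have := ltn_ord (cyc n i); lia.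
- by rewrite !cycE //; move: i0 j0; rewrite -!val_eqE /=; lia.
Qed.

Lemma rankp_aff a : rankp (aff a) = ((cyc n)^-1 * rankp a)%g.
Proof.
apply/esym/rankp_uniq => i j.
have [i' ->] : exists i', i = cyc n i' by exists ((cyc n)^-1%g i); rewrite permKV.
have [j' ->] : exists j', j = cyc n j' by exists ((cyc n)^-1%g j); rewrite permKV.
move: i' j' => {}i {}j.
rewrite !permM !permK rankp_lt /before !aff_cyc cyc_lt.
have [->|i0] := eqVneq i ord0; have [->|j0] := eqVneq j ord0 => /=; rewrite ?ltn0;
  [lia|move: j0|move: i0|move: i0 j0]; rewrite -?val_eqE /=; lia.
Qed.

End Compositions.

(** * Jack polynomials *)

Section Zeta.
Variables (R : realType) (n : nat) (t : seq nat).
Local Notation N := n.+1.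
Local Notation Y := (rsyt N t).
Local Notation C := R[i].
Local Notation V := (V R N t).
Local Notation K := (K N).
Local Notation LP := (K -> V).
Local Notation dom := (@Defs.dom N).
Local Notation rep := (@rep R N t).
Local Notation is_lp := (@is_lp R N t).
Local Notation mulx := (@lp_mulx R N t).
Local Notation mono := (@lp_mono R N t).
Local Notation lop := (@lp_op R N t).
Local Notation bv := (@basisv R N t).
Hypothesis tP : is_partition_of N t.
Hypothesis n_gt0 : (0 < n)%N.
Variable kappa : R.
Local Notation kc := (kappa%:C).
Local Notation U := (@cherU R n t kappa).
Hypothesis kb : `|kappa| * (hook t)%:R < 1.

Lemma actE w (p : LP) k : act w p k = opv (rep w) (p (kact w k)).
Proof. by []. Qed.
Lemma mulxE e (p : LP) k : mulx e p k = p (k - e).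
Proof. by []. Qed.
Lemma lopE A (p : LP) k : lop A p k = opv A (p k).
Proof. by []. Qed.
Lemma eulerE i (p : LP) k : euler i p k = ((k i + 1)%:~R : C) *: p k.
Proof. by []. Qed.
Lemma monoE a v k : mono a v k = if k == a then v else 0.
Proof. by []. Qed.

#[local] Opaque act tdiff lp_mulx lp_op dunklE cherU euler omega lp_mono.

Lemma content_bounds i (T : Y) :
  - (size t)%:Z < Defs.content i T < (head 0%N t)%:Z.
Proof.
rewrite contentE /ct.
have := @rsyt_in n t (val T) i (valP T); rewrite /in_diagram => /andP[h1 h2].
have h3 := @part_nth_leq n t tP 0 (val T i).1 isT.
have -> : head 0%N t = nth 0%N t 0 by case: (t).
apply/andP; split; lia.
Qed.

Lemma content_diff i j (T T' : Y) :
  (`|Defs.content i T - Defs.content j T'|%N < hook t)%N.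
Proof.
have := content_bounds i T; have := content_bounds j T'; rewrite /hook; lia.
Qed.

(** With [x] the difference of contents, [|x| + 1 <= hook t], so
    [|kappa * x| + |kappa| < 1 <= |l|]. *)
Lemma kappa_content i j (T T' : Y) (l : int) : l != 0 ->
  `|kappa| < `|l%:~R + kappa * (Defs.content i T - Defs.content j T')%:~R|.
Proof.
move=> l0; have d := content_diff i j T T'; set x := _ - _.
have l1 : 1 <= `|l%:~R : R| by rewrite -intr_norm -[1]/(1%:~R) ler_int; lia.
have hx : `|kappa * x%:~R| + `|kappa| < 1.
  apply: le_lt_trans kb; rewrite normrM -intr_norm -[X in _ + X]mulr1 -mulrDr.
  apply: ler_wpM2l => //; rewrite -[1]/(1%:~R) -intrD -[_%:R]/((Posz (hook t))%:~R) ler_int.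
  by rewrite /x; lia.
have := lerB_normD (l%:~R : R) (kappa * x%:~R); lra.
Qed.

Lemma kappa_content_lt1 i j (T T' : Y) :
  `|kappa * (Defs.content i T - Defs.content j T')%:~R| < 1.
Proof.
have d := content_diff i j T T'.
apply: le_lt_trans kb; rewrite normrM -intr_norm.
apply: ler_wpM2l => //; rewrite -[_%:R]/((Posz (hook t))%:~R) ler_int; lia.
Qed.

Lemma cplx_lin (x y : int) : (x%:~R + kappa * y%:~R)%:C = x%:~R + kc * y%:~R.
Proof. by rewrite rmorphD rmorphM /= !rmorph_int. Qed.

(** * Action of the operators on the coefficient at a maximal exponent *)

Section Leading.
Variables (p : LP) (b : K).
Hypothesis hp : is_lp p.
Hypothesis b_max : forall k, dom b k -> p k = 0.

(** Along the line [b + Z (e_i - e_j)] the increments [D] of the quotient [y] vanish beyond [b] and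
    its mirror image, since exponents with a larger gap dominate [b]. If [b i >= b j] then [y b] is
    the single increment [D b]. If [b i < b j] the increments from [b] to its mirror image add up to
    zero. *)
Lemma tdiff_leading i j : j != i ->
  mulx (unitK i) (tdiff i j p) b + (if (i < j)%N then act (tperm i j) p b else 0) =
  if before b i j then opv (rep (tperm i j)) (p b) else 0.
Proof.
move=> ji; have ij : i != j by rewrite eq_sym.
pose d := (unitK i - unitK j : K).
have di : d i = 1 by apply: unitK_diff.
have dj : d j = -1 by rewrite !ffunE eqxx (negPf ji) sub0r.
have doff l : l != i -> l != j -> d l = 0.
  by move=> /negPf li /negPf lj; rewrite !ffunE li lj subrr.
set y := mulx (unitK i) (tdiff i j p).
have ylp : is_lp y by apply/is_lp_mulx/is_lp_tdiff.
pose D k := opv (rep (tperm i j)) (p k) - opv (rep (tperm i j)) (p (kact (tperm i j) k)).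
have yD k : y k - y (k + d) = D k.
  have := congr1 (fun g : LP => g k) (tdiffP tP n_gt0 i j hp).
  rewrite !lpDE !lpNE lopE actE /D => <-; congr (_ - _).
  by rewrite /y !mulxE /d addrA addrAC addrK.
have eK m k : (b + d *+ m) k = b k + d k * m%:Z by rewrite ffunE ffunMnE -mulr_natr natz.
have far m : `|b i - b j| < `|b i - b j + 2 * m%:Z| -> D (b + d *+ m) = 0.
  move=> lt.
  have e := eK m.
  have z1 : dom b (b + d *+ m).
    apply: (@dom_transfer n i j) => //.
    - by move=> l li lj; rewrite e doff // mul0r addr0.
    - by rewrite !e di dj; ring.
    - by rewrite !e di dj; apply: lt_le_trans lt _; rewrite le_eqVlt; apply/orP; left; apply/eqP; congr `|_|; ring.
  have z2 : dom b (kact (tperm i j) (b + d *+ m)).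
    apply: (@dom_transfer n i j) => //.
    - by move=> l li lj; rewrite ffunE tpermD 1?eq_sym // e doff // mul0r addr0.
    - by rewrite ![kact _ _ _]ffunE tpermL tpermR !e di dj; ring.
    - rewrite ![kact _ _ _]ffunE tpermL tpermR !e di dj.
      have -> : b j + -1 * m%:Z - (b i + 1 * m%:Z) = - (b i - b j + 2 * m%:Z) by ring.
      by rewrite normrN.
  by rewrite /D !b_max // opv0 subrr.
have ray k : (forall m, D (k + d *+ m) = 0) -> y k = 0.
  by move=> h; apply: (@lp_ray R n t tP n_gt0 y k d i) => // m; rewrite yD h.
have -> : act (tperm i j) p b = opv (rep (tperm i j)) (p (kact (tperm i j) b)) by rewrite actE.
have [lt|le] := ltP (b i) (b j); last first.
  have y1 : y (b + d) = 0.
    apply: ray => m; rewrite -addrA -mulrS far //; lia.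
  have -> : y b = D b by rewrite -yD y1 subr0.
  rewrite /D /before; move: le; rewrite le_eqVlt => /orP[/eqP eq|gt].
  - have -> : kact (tperm i j) b = b.
      by apply/ffunP => l; rewrite ffunE; case: tpermP => [->|->|].
    by rewrite subrr add0r eq eqxx ltxx.
  - rewrite gt /=; case: (ltnP i j) => [//|ji']; rewrite ?subrK //= addr0 (@b_max (kact (tperm i j) b)) ?opv0 ?subr0 //.
    rewrite tpermC; apply: dom_swap => //; rewrite ltn_neqAle ji' andbT.
    by rewrite val_eqE.
have [m em] : exists m, b j = b i + m%:Z by exists `|b j - b i|%N; lia.
have km l : (l <= m)%N -> kact (tperm i j) (b + d *+ l) = b + d *+ (m - l).
  move=> lm; apply/ffunP => x; rewrite [LHS]ffunE !eK.
  case: tpermP => [->|->|/eqP xi /eqP xj].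
  - by rewrite di dj em; lia.
  - by rewrite di dj em; lia.
  - by rewrite doff.
have Dsum l : y b = \sum_(x < l) D (b + d *+ x) + y (b + d *+ l).
  elim: l => [|l IH]; first by rewrite big_ord0 add0r mulr0n addr0.
  by rewrite big_ord_recr /= IH -addrA -yD mulrSr [b + (_ + d)]addrA subrK.
have y0 : y b = 0.
  rewrite (Dsum m.+1) [X in _ + X]ray ?addr0; last first.
    move=> x; rewrite -addrA -mulrnDr far //; lia.
  (* Exchanging [i] and [j] reverses the segment from [b] to [b + m d] and changes the sign of
     [D]. *)
  have S : \sum_(x < m.+1) D (b + d *+ x) = - \sum_(x < m.+1) D (b + d *+ x).
    rewrite {1}(reindex_inj rev_ord_inj) -sumrN /=; apply: eq_bigr => x _.
    have xm : (x <= m)%N by rewrite -ltnS.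
    by rewrite subSS -(km _ xm) /D kact_tpermK // opprB.
  apply/ffunP => T; rewrite V0E; have := congr1 (fun v : V => v T) S.
  rewrite VNE => /eqP; rewrite -subr_eq0 opprK -mulr2n mulrn_eq0 => /orP[//|/eqP //].
rewrite y0 add0r /before.
have -> : (b j < b i) || (b i == b j) && (i < j)%N = false by lia.
case: ifP => // ij'; rewrite (@b_max (kact (tperm i j) b)) ?opv0 //; exact: dom_swap.
Qed.

Lemma cherU_leading i :
  U i p b = ((b i + 1)%:~R : C) *: p b +
    kc *: \sum_(j < N | before b i j) opv (rep (tperm i j)) (p b).
Proof.
rewrite cherUE dunklEE !lpDE !lpZE !lp_sumE eulerE -addrA -scalerDr; congr (_ + _ *: _).
rewrite [X in _ + X]big_mkcond /= [X in _ + X](bigD1 i) //= ltnn add0r -big_split /=.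
rewrite [RHS]big_mkcond [RHS](bigD1 i) //= before_irr add0r.
by apply: eq_bigr => j ji; rewrite tdiff_leading.
Qed.

(** Conjugation by the rank turns the positions coming after [i] into the indices above [r i]: the
    sum becomes a Jucys-Murphy element, diagonal with the contents as entries. *)
Lemma leading_xi i T :
  opv (rep (rankp b)) (U i p b) T = xi kappa b T i * opv (rep (rankp b)) (p b) T.
Proof.
set r := rankp b; set w := opv (rep r) (p b).
rewrite cherU_leading opv_is_additive !opvZ opv_sum.
have -> : \sum_(j < N | before b i j) opv (rep r) (opv (rep (tperm i j)) (p b)) = jm (r i) w.
  rewrite /jm [RHS](reindex_inj (@perm_inj _ r)) /=; apply: eq_big => [j|j bij].
    by rewrite rankp_lt.
  by rewrite /w -!opv_repM // -tpermJ conjgE !mulgA mulgV mul1g.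
by rewrite VDE !VZE jmE // /xi mulrDl mulrA.
Qed.

End Leading.

Definition is_content (e : int) : Prop := exists j (T : Y), e = Defs.content j T.

(** The contents are an arbitrary family of integers: after an intertwiner between equal entries
    they are permuted, possibly into a family that belongs to no tableau. *)
Definition eigen (a : K) (e : 'I_N -> int) (p : LP) : Prop :=
  forall i, U i p = (((a i + 1)%:~R : C) + kc * (e i)%:~R) *: p.

Lemma rep_inj w (v : V) : opv (rep w) v = 0 -> v = 0.
Proof. by move=> h; rewrite -(opv_repK tP n_gt0 w v) h opv0. Qed.

(* The eigenvalues determine the composition because contents are separated by
   less than 1/|kappa|. *)
Lemma eigen_max a e p b : is_lp p -> eigen a e p ->
  (forall i, is_content (e i)) ->
  (forall k, dom b k -> p k = 0) -> p b != 0 -> b = a.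
Proof.
move=> hp hU he b_max pb.
have [T wT] : exists T, opv (rep (rankp b)) (p b) T != 0.
  apply/existsP; apply: contraNT pb; rewrite negb_exists => /forallP h.
  by apply/eqP/(rep_inj (w := rankp b))/ffunP => T; rewrite V0E; apply/eqP; have := h T; rewrite negbK.
apply/ffunP => i; have := leading_xi hp b_max i T.
rewrite hU lpZE opvZ VZE => /(mulIf wT); rewrite /xi.
have [j [T' ->]] := he i => h.
have h' : ((a i + 1)%:~R + kappa * (Defs.content j T')%:~R)%:C =
  ((b i + 1)%:~R + kappa * (Defs.content (rankp b i) T)%:~R)%:C.
  by rewrite !cplx_lin.
have {h h'} h : (a i + 1)%:~R + kappa * (Defs.content j T')%:~R =
  (b i + 1)%:~R + kappa * (Defs.content (rankp b i) T)%:~R by apply: complexI.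
have : `|(b i - a i)%:~R : R| < 1.
  apply: le_lt_trans (kappa_content_lt1 j (rankp b i) T' T).
  rewrite le_eqVlt; apply/orP; left; apply/eqP; congr `|_|.
  by rewrite !intrB mulrBr; move: h; rewrite !intrD; lra.
rewrite -intr_norm -[1]/(1%:~R) ltr_int => lt1; clear -lt1.
by move: (b i) (a i) lt1 => x y; lia.
Qed.

Lemma max_above (p : LP) k : is_lp p -> p k != 0 ->
  exists b, [/\ p b != 0, (b == k) || dom k b & forall l, dom b l -> p l = 0].
Proof.
move=> [s ps]; have [m] := ubnP (size [seq x <- s | dom k x]).
elim: m => // m IH in k *; rewrite ltnS => sm pk.
have [[l [kl pl]]|h] := pselect (exists l, dom k l /\ p l != 0); last first.
  exists k; split; rewrite ?eqxx // => l kl; apply/eqP; apply: contra_notT h => pl.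
  by exists l.
have [] := IH l _ pl.
  apply: leq_trans sm; rewrite !size_filter -!size_filter.
  have sub : [seq x <- s | dom l x] = [seq x <- [seq x <- s | dom k x] | dom l x].
    rewrite -filter_predI; apply: eq_filter => x /=; case: (boolP (dom l x)) => //= lx.
    by rewrite (dom_trans kl lx).
  rewrite sub size_filter; have <- := count_predC (dom l) [seq x <- s | dom k x].
  have : (0 < count (predC (dom l)) [seq x <- s | dom k x])%N.
    rewrite -has_count; apply/hasP; exists l; last by rewrite /= dom_irr.
    by rewrite mem_filter kl ps.
  by move=> c0; rewrite -addn1 leq_add2l.
move=> b [pb lb bmax]; exists b; split => //; apply/orP; right.
by case/orP: lb => [/eqP -> //|]; apply: dom_trans.
Qed.

Lemma eigen_support a e p k : is_lp p -> eigen a e p ->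
  (forall i, is_content (e i)) -> p k != 0 -> k = a \/ dom k a.
Proof.
move=> hp hU he pk; have [b [pb kb' bmax]] := max_above hp pk.
have eb := eigen_max hp hU he bmax pb; rewrite eb in kb'.
by case/orP: kb' => [/eqP|]; [left|right].
Qed.

(** A nonzero [p] has a maximal exponent, and by [eigen_max] this can only be [a]. *)
Lemma eigen_eq0 a e p : is_lp p -> eigen a e p ->
  (forall i, is_content (e i)) -> p a = 0 -> p = 0.
Proof.
move=> hp hU he pa; apply: boolp.funext => k; apply/eqP; apply/negPn/negP => pk.
have [b [pb kb' bmax]] := max_above hp pk.
by have eb := eigen_max hp hU he bmax pb; rewrite eb pa eqxx in pb.
Qed.

Definition spec_content (a : K) (T : Y) (i : 'I_N) : int := Defs.content (rankp a i) T.

Definition lead (a : K) (v : V) : V := opv (rep (rankp a)^-1) v.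

(** Exponents may be negative, and triangularity is not imposed: it follows from the eigenvalues, by
    [jack_support]. *)
Definition is_jack (a : K) (T : Y) (p : LP) : Prop :=
  [/\ is_lp p, p a = lead a (bv T) & eigen a (spec_content a T) p].

Lemma spec_contentP a T i : is_content (spec_content a T i).
Proof. by exists (rankp a i), T. Qed.

Lemma jack_uniq a T p q : is_jack a T p -> is_jack a T q -> p = q.
Proof.
move=> [hp pa ep] [hq qa eq]; apply/eqP; rewrite -subr_eq0; apply/eqP.
apply: (@eigen_eq0 a (spec_content a T)).
- exact: is_lpB.
- move=> i; rewrite -scaleN1r addrC cherU_linear // ep eq.
  by rewrite scalerA mulrC -scalerA -scalerDr.
- exact: spec_contentP.
- by rewrite lpDE lpNE pa qa subrr.
Qed.

Lemma jack_support a T p k : is_jack a T p -> p k != 0 -> k = a \/ dom k a.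
Proof. by move=> [hp _ ep]; apply: eigen_support ep _ => //; apply: spec_contentP. Qed.

(** On constants the divided differences vanish, and [U_i] is 1 plus [kappa] times a Jucys-Murphy
    element. *)
Lemma jack0 T : is_jack 0 T (mono 0 (bv T)).
Proof.
have hm : is_lp (mono 0 (bv T)) by apply: is_lp_mono.
split => //.
  by rewrite monoE eqxx /lead rankp0 invg1 opv_rep1.
have k0 w : kact w (0 : K) = 0 by apply/ffunP => l; rewrite !ffunE.
move=> i; rewrite cherUE dunklEE.
have -> : \sum_(j < N | j != i) mulx (unitK i) (tdiff i j (mono 0 (bv T))) = 0.
  apply: big1 => j ji; rewrite (@tdiff_uniq R n t tP n_gt0 i j _ 0) //.
  - by rewrite eq_sym.
  - exact: is_lp0.
  - rewrite act_mono // k0; apply: boolp.funext => k; rewrite !lpDE !lpNE lopE !mulxE !monoE.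
    by case: eqP => _; rewrite ?opv0 ?subrr // subr0.
rewrite scaler0 addr0.
apply: boolp.funext => k; rewrite lpDE !lpZE lp_sumE eulerE /spec_content rankp0 perm1.
have [->|k0'] := eqVneq k 0; last first.
  rewrite monoE (negPf k0') !scaler0 add0r big1 ?scaler0 // => j _.
  by rewrite act_mono // k0 monoE (negPf k0').
have -> : \sum_(j < N | (i < j)%N) act (tperm i j) (mono 0 (bv T)) 0 = jm i (bv T).
  by apply: eq_bigr => j _; rewrite act_mono // k0 monoE eqxx.
rewrite monoE eqxx scalerDl; congr (_ + _); apply/ffunP => T'.
rewrite !VZE jmE // -mulrA; congr (_ * _).
by rewrite ffunE; case: eqP => [->|] //; rewrite !mulr0.
Qed.

Lemma jack_aff a T p : is_jack a T p -> is_jack (aff a) T (omega p).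
Proof.
move=> [hp pa ep]; split; first exact: is_lp_omega.
  rewrite omegaE actE mulxE /aff kactVK addrK pa /lead -opv_repM // rankp_aff.
  by rewrite invMg invgK.
move=> i; have [i' ->] : exists i', i = cyc n i' by exists ((cyc n)^-1%g i); rewrite permKV.
move: i' => {}i; rewrite aff_cyc /spec_content rankp_aff permM permK.
have [->|i0] := eqVneq i ord0.
  rewrite cyc0 cherU_omega_max // ep -[X in _ + X]scale1r -scalerDl.
  rewrite !omegaE mulxZ actZ; congr (_ *: _).
  rewrite /spec_content -[(a ord0 + _ + 1)]addrA !intrD /=; ring.
rewrite cherU_omega // ep !omegaE mulxZ actZ addr0 //.
Qed.

Lemma jack_const a T p m : is_jack a T p -> is_jack (a + constK N m) T (mulx (constK N m) p).
Proof.
move=> [hp pa ep]; split; first exact: is_lp_mulx.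
  by rewrite mulxE addrK pa /lead rankp_const.
move=> i; rewrite cherU_const // ep -scalerDl mulxZ /spec_content rankp_const.
by congr (_ *: _); rewrite !ffunE !intrD; ring.
Qed.

(** [kappa] over the difference of the eigenvalues at [i] and [i+1], which makes [s_i - b] an
    intertwiner. *)
Definition step_coef (a : K) (T : Y) (i : nat) : R :=
  kappa / ((a (ord_lo n i) - a (ord_hi n i))%:~R +
    kappa * (spec_content a T (ord_lo n i) - spec_content a T (ord_hi n i))%:~R).

(** The relations of the graded Hecke algebra make [s_i p - b p] exchange the two eigenvalues. The
    scalars are left free because this serves both for distinct and for equal adjacent entries of
    [a]. *)
Lemma step_eigen i p (x y b : C) : (i < n)%N -> is_lp p ->
  U (ord_lo n i) p = x *: p -> U (ord_hi n i) p = y *: p -> kc = b * (x - y) ->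
  let q := act (stp n i) p - b *: p in
  [/\ U (ord_lo n i) q = y *: q, U (ord_hi n i) q = x *: q &
      forall j z, j != ord_lo n i -> j != ord_hi n i -> U j p = z *: p -> U j q = z *: q].
Proof.
move=> i_n hp ux uy e q.
have hs : is_lp (act (stp n i) p) by apply: is_lp_act.
have e1 : U (ord_hi n i) (act (stp n i) p) = x *: act (stp n i) p - kc *: p.
  by have := cherU_lo tP n_gt0 kappa i_n hp; rewrite ux actZ => ->; rewrite addrK.
have e2 : U (ord_lo n i) (act (stp n i) p) = y *: act (stp n i) p + kc *: p.
  by have := cherU_hi tP n_gt0 kappa i_n hp; rewrite uy actZ => ->; rewrite subrK.
have lin j : U j q = U j (act (stp n i) p) - b *: U j p.
  by rewrite /q addrC -scaleNr cherU_linear // scaleNr addrC.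
split.
- by rewrite lin e2 ux e /q; lpring.
- by rewrite lin e1 uy e /q; lpring.
- move=> j z jlo jhi uz; rewrite lin uz -cherU_other // uz actZ /q; lpring.
Qed.

Lemma stp_dom (a : K) i : (i < n)%N -> a (ord_lo n i) < a (ord_hi n i) ->
  dom a (kact (stp n i) a).
Proof. by move=> i_n lt; apply: dom_swap => //; rewrite ord_loE ?ord_hiE. Qed.

Lemma kact_stpK i : involutive (kact (stp n i)).
Proof. exact: kact_tpermK. Qed.

Lemma step_coefE (a : K) T i : (a (ord_lo n i) != a (ord_hi n i)) ->
  kc = (step_coef a T i)%:C * (((a (ord_lo n i) + 1)%:~R + kc * (spec_content a T (ord_lo n i))%:~R)
     - ((a (ord_hi n i) + 1)%:~R + kc * (spec_content a T (ord_hi n i))%:~R)).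
Proof.
move=> aa.
have e : ((a (ord_lo n i) + 1)%:~R + kc * (spec_content a T (ord_lo n i))%:~R)
     - ((a (ord_hi n i) + 1)%:~R + kc * (spec_content a T (ord_hi n i))%:~R) =
   ((a (ord_lo n i) - a (ord_hi n i))%:~R +
    kappa * (spec_content a T (ord_lo n i) - spec_content a T (ord_hi n i))%:~R)%:C.
  move: (a (ord_lo n i)) (a (ord_hi n i)) (spec_content _ _ _) (spec_content _ _ _) => x y u v.
  rewrite cplx_lin !intrD !intrN; move: kc (x%:~R : C) (y%:~R : C) (u%:~R : C) (v%:~R : C) => k x' y' u' v'.
  by rewrite /=; ring.
rewrite e -rmorphM /= /step_coef divfK //.
have l0 : a (ord_lo n i) - a (ord_hi n i) != 0 by rewrite subr_eq0.
have := kappa_content (rankp a (ord_lo n i)) (rankp a (ord_hi n i)) T T l0.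
rewrite -normr_gt0; apply: le_lt_trans; exact: normr_ge0.
Qed.

Lemma jack_step (a : K) T p i : (i < n)%N -> a (ord_lo n i) < a (ord_hi n i) -> is_jack a T p ->
  is_jack (kact (stp n i) a) T (act (stp n i) p - (step_coef a T i)%:C *: p).
Proof.
move=> i_n lt jp; have [hp pa ep] := jp.
have aa : a (ord_lo n i) != a (ord_hi n i) by apply/eqP; lia.
have [e1 e2 e3] := step_eigen i_n hp (ep _) (ep _) (step_coefE T aa).
have rk := rankp_swap i_n aa.
split.
- by apply: is_lpB; [apply: is_lp_act|apply: is_lpZ].
- rewrite lpDE lpNE lpZE actE kact_stpK.
  (* The swapped composition dominates [a], so [p] has no coefficient there and the new leading
     coefficient comes from [s_i p] alone. *)
  have -> : p (kact (stp n i) a) = 0.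
    apply/eqP; apply/negPn/negP => /(jack_support jp) [e|].
      by have := dom_irr a; rewrite -[X in dom _ X]e stp_dom.
    by rewrite dom_asym // stp_dom.
  rewrite scaler0 subr0 pa /lead -opv_repM // rk invMg.
  by congr (opv (rep (_ * _)%g) _); rewrite /stp tpermV.
- have sc j : spec_content (kact (stp n i) a) T j = spec_content a T (stp n i j).
    by rewrite /spec_content rk permM.
  move=> j; rewrite sc ffunE.
  have [->|jlo] := eqVneq j (ord_lo n i); first by rewrite stp_lo; exact: e1.
  have [->|jhi] := eqVneq j (ord_hi n i); first by rewrite stp_hi; exact: e2.
  have -> : stp n i j = j by rewrite /stp tpermD // eq_sym.
  exact: (e3 _ _ jlo jhi (ep j)).
Qed.

Definition nonneg_supp (p : LP) : Prop := forall k, p k != 0 -> forall m, 0 <= k m.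

Lemma opv_neq0 (A : Op R N t) v : opv A v != 0 -> v != 0.
Proof. by apply: contra_neq => ->; rewrite opv0. Qed.

Lemma nonneg_act w p : nonneg_supp p -> nonneg_supp (act w p).
Proof.
move=> hp k; rewrite actE => /opv_neq0/hp h m.
by have := h (w^-1%g m); rewrite ffunE permKV.
Qed.

Lemma nonneg_step i (b : C) p : nonneg_supp p -> nonneg_supp (act (stp n i) p - b *: p).
Proof.
move=> hp k; rewrite lpDE lpNE lpZE => h.
have [e|ne] := eqVneq (p k) 0; last exact: hp ne.
by apply: (nonneg_act (w := stp n i) hp); move: h; rewrite e scaler0 subr0.
Qed.

Lemma nonneg_omega p : nonneg_supp p -> nonneg_supp (omega p).
Proof.
move=> hp; apply: nonneg_act => k; rewrite mulxE => /hp h m.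
have := h m; rewrite !ffunE; case: eqP => _ /=; lia.
Qed.

Lemma sumK_kact (w : {perm 'I_N}) (a : K) : sumK (kact w a) = sumK a.
Proof.
by rewrite /sumK [RHS](reindex_inj (@perm_inj _ w)) /=; apply: eq_bigr => j _; rewrite ffunE.
Qed.

Lemma sumK_unit : sumK (unitK ord0 : K) = 1.
Proof. by rewrite /sumK (bigD1 ord0) //= ffunE eqxx big1 ?addr0 // => i /negPf i0; rewrite ffunE i0. Qed.

Lemma sumKD (a b : K) : sumK (a + b) = sumK a + sumK b.
Proof. by rewrite /sumK -big_split; apply: eq_bigr => i _; rewrite ffunE. Qed.

Lemma affP (a : K) : aff (kact (cyc n) a - unitK ord0) = a.
Proof. by rewrite /aff subrK kactK. Qed.

(** Induction on the degree, then on the weight [W], which drops when an entry moves right past a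
    zero. If the last entry is nonzero, [a] comes by the affine step from a composition of lower
    degree. *)
Lemma jack_ex (a : K) T : (forall i, 0 <= a i) -> exists p, is_jack a T p /\ nonneg_supp p.
Proof.
have [d] := ubnP `|sumK a|%N; elim: d => // d IHd in a *; rewrite ltnS => ad.
pose W (b : K) := (\sum_(i < N) `|b i| * (n - i))%N.
have [w] := ubnP (W a); elim: w => // w IHw in a ad *; rewrite ltnS => aw a0.
have [amax|amax] := eqVneq (a ord_max) 0; last first.
  set b := kact (cyc n) a - unitK ord0.
  have b0 i : 0 <= b i.
    rewrite !ffunE; have [->|i0] := eqVneq i ord0.
      by rewrite cyc0 /=; have := a0 ord_max; move: amax; lia.
    by rewrite subr0.
  have sb : sumK b = sumK a - 1.
    by have := sumKD b (unitK ord0); rewrite subrK sumK_kact sumK_unit => ->; rewrite addrK.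
  have sb0 : 0 <= sumK b by apply: sumr_ge0 => i _.
  have [p [jp np]] := IHd b ltac:(lia) b0.
  exists (omega p); split; last exact: nonneg_omega.
  by rewrite -[a]affP; apply: jack_aff.
have [a00|[i ai]] : a = 0 \/ exists i, a i != 0.
  have [h|h] := pselect (exists i, a i != 0); [by right|left].
  by apply/ffunP => i; rewrite ffunE; apply/eqP; apply: contra_notT h => h; exists i.
  rewrite a00; exists (mono 0 (bv T)); split; first exact: jack0.
  move=> k; rewrite monoE; have [-> _ m|_] := eqVneq k 0; first by rewrite ffunE.
  by rewrite eqxx.
(* The last nonzero entry, followed by a zero: [a] is reached by an intertwiner from the composition
   with these two exchanged. *)
case: (arg_maxnP (P := fun i => a i != 0) (fun i : 'I_N => i) ai) => {ai} i ai imax.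
have i_n : (i < n)%N.
  rewrite ltn_neqAle -ltnS ltn_ord andbT; apply/eqP => e.
  by case/eqP: ai; rewrite -amax; congr (a _); apply: val_inj.
have lo : ord_lo n i = i by apply: val_inj; rewrite /= ord_loE.
have hi0 : a (ord_hi n i) = 0.
  apply/eqP; apply/negPn/negP => /imax; rewrite /= ord_hiE // ltnn //.
set b := kact (stp n i) a.
have bw : (W b < W a)%N.
  have ne : ord_hi n i != ord_lo n i by rewrite eq_sym ord_lo_neq.
  rewrite /W (bigD1 (ord_lo n i)) //= (bigD1 (ord_hi n i)) //=.
  rewrite [X in (_ < X)%N](bigD1 (ord_lo n i)) //= [X in (_ < _ + X)%N](bigD1 (ord_hi n i)) //=.
  rewrite !ffunE stp_lo stp_hi hi0 lo absz0 !mul0n !add0n.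
  have -> : (\sum_(j < N | (j != i) && (j != ord_hi n i)) `|b j| * (n - j) =
     \sum_(j < N | (j != i) && (j != ord_hi n i)) `|a j| * (n - j))%N.
    apply: eq_bigr => j /andP[j1 j2]; rewrite ffunE /stp tpermD //; last by rewrite eq_sym.
    by rewrite -/(ord_lo n i) lo eq_sym.
  rewrite ltn_add2r ord_hiE //.
  have : (0 < `|a i|)%N by rewrite absz_gt0.
  by nia.
have b0 j : 0 <= b j by rewrite ffunE.
have [p [jp np]] := IHw b ltac:(by rewrite sumK_kact) (leq_trans bw aw) b0.
exists (act (stp n i) p - (step_coef b T i)%:C *: p); split; last exact: nonneg_step.
rewrite -[a](kact_stpK i); apply: jack_step => //.
rewrite !ffunE stp_lo stp_hi hi0 lo; have := a0 i; move: ai; lia.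
Qed.

Lemma zeta_spec (a : K) (T : Y) : (forall i, 0 <= a i) -> is_zeta kappa a T (zeta kappa a T).
Proof.
move=> a0; apply: ClassicalEpsilon.epsilon_spec.
have [p [jp np]] := jack_ex T a0; have [hp pa ep] := jp.
exists p; split => //.
  by move=> b ba /(jack_support jp) [e|//]; rewrite e eqxx in ba.
by move=> i; rewrite cdunklE // ep /xi.
Qed.

Lemma shiftm_ge0 a i : 0 <= (a + constK N (shiftm a)) i.
Proof.
rewrite !ffunE /shiftm (bigD1 i) //= PoszD; lia.
Qed.

Lemma zetaL_jack a T : is_jack a T (zetaL kappa a T).
Proof.
have [[hp _] pa _ ep] := zeta_spec T (shiftm_ge0 a).
have jp : is_jack (a + constK N (shiftm a)) T (zeta kappa (a + constK N (shiftm a)) T).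
  by split => // i; have := ep i; rewrite cdunklE.
have := jack_const (- shiftm a) jp.
rewrite -addrA (_ : constK N (shiftm a) + _ = 0) ?addr0 //.
by apply/ffunP => i; rewrite !ffunE addrN.
Qed.

End Zeta.

(** * Norms *)

Section Norms.
Variables (R : realType) (n : nat) (t : seq nat).
Local Notation N := n.+1.
Local Notation Y := (rsyt N t).
Local Notation K := (K N).
Hypothesis tP : is_partition_of N t.
Hypothesis n_gt0 : (0 < n)%N.
Variable kappa : R.
Hypothesis kb : `|kappa| * (hook t)%:R < 1.
Local Notation spec := (@spec_content n t).

Lemma stp_lt i (j k : 'I_N) : (i < n)%N ->
  ~~ [&& j == ord_lo n i & k == ord_hi n i] -> ~~ [&& j == ord_hi n i & k == ord_lo n i] ->
  (stp n i j < stp n i k)%N = (j < k)%N.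
Proof.
clear tP n_gt0 kb; move=> i_n.
have lo l : (l == ord_lo n i) = (l == i :> nat) by rewrite -val_eqE /= ord_loE.
have hi l : (l == ord_hi n i) = (l == i.+1 :> nat) by rewrite -val_eqE /= ord_hiE.
rewrite !lo !hi !stpE // /adj_swap.
by repeat case: eqP; lia.
Qed.

(** An adjacent transposition permutes the increasing pairs except for [(i, i+1)], which it
    reverses. The two special factors are cross-multiplied to avoid a division. *)
Lemma prod_pairs_stp i (h : 'I_N -> 'I_N -> R) : (i < n)%N ->
  (\prod_(j < N) \prod_(k < N | (j < k)%N) h (stp n i j) (stp n i k)) * h (ord_lo n i) (ord_hi n i) =
  (\prod_(j < N) \prod_(k < N | (j < k)%N) h j k) * h (ord_hi n i) (ord_lo n i).
Proof.
clear tP n_gt0 kb; move=> i_n; rewrite !pair_big_dep /=.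
have lohi : (((ord_lo n i, ord_hi n i) : 'I_N * 'I_N).1 < (ord_lo n i, ord_hi n i).2)%N.
  by rewrite /= ord_loE // ord_hiE.
rewrite (bigD1 (ord_lo n i, ord_hi n i)) //= stp_lo stp_hi.
rewrite [in RHS](bigD1 (ord_lo n i, ord_hi n i)) //= mulrAC [in RHS]mulrAC [h _ _ * h _ _]mulrC.
congr (_ * _).
pose f (p : 'I_N * 'I_N) := (stp n i p.1, stp n i p.2).
have fK : involutive f by case=> x y; rewrite /f /= !stpK.
rewrite [RHS](reindex_inj (inv_inj fK)) /=; apply: eq_big => // [[j k]] /=.
rewrite /f !xpair_eqE /=.
have [/andP[/eqP -> /eqP ->]|h1] := boolP [&& j == ord_lo n i & k == ord_hi n i].
  by rewrite stp_lo stp_hi andbF; apply/esym/negP => /andP[]; rewrite ord_hiE // ord_loE //; lia.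
have [/andP[/eqP -> /eqP ->]|h2] := boolP [&& j == ord_hi n i & k == ord_lo n i].
  by rewrite stp_lo stp_hi !eqxx !andbF; apply/negP => /andP[]; rewrite ord_hiE // ord_loE //; lia.
rewrite andbT stp_lt //; case: (j < k)%N => //=; apply/esym.
apply: contra h2 => /andP[/eqP e1 /eqP e2].
by rewrite -(stpK i j) -(stpK i k) e1 e2 stp_lo stp_hi !eqxx.
Qed.

Definition norm_factor (x y : int) : R :=
  if x <= y - 2 then 1 - ((x - y)%:~R ^- 2) else 1.

Lemma norm0E (T : Y) : norm0 R T =
  \prod_(i < N) \prod_(j < N | (i < j)%N) norm_factor (Defs.content i T) (Defs.content j T).
Proof. by rewrite /norm0; apply: eq_bigr => i _; rewrite big_mkcondr. Qed.

Lemma norm_factor_gt0 x y : 0 < norm_factor x y.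
Proof.
clear tP n_gt0 kb; rewrite /norm_factor; case: ifP => // xy; rewrite subr_gt0 invf_lt1; last first.
  by rewrite exprn_even_gt0 //= intr_eq0 subr_eq0; apply/eqP; lia.
have : (2 : R) <= (y - x)%:~R by rewrite -[2]/(2%:~R) ler_int; lia.
by rewrite -[(x - y)%:~R ^+ 2]sqrrN -intrN opprB => h; nra.
Qed.

Lemma norm0_gt0 (T : Y) : 0 < norm0 R T.
Proof. by rewrite norm0E; do 2 (apply: prodr_gt0 => ? _); apply: norm_factor_gt0. Qed.

Definition pcoefR (a b : int) : R :=
  if `|a - b| <= 1 then 0 else if a < b then 1 else 1 - ((a - b)%:~R ^+ 2)^-1.

Lemma pcoefRE a b : pcoef R a b = (pcoefR a b)%:C.
Proof.
rewrite /pcoef /pcoefR; case: ifP => _; first by rewrite rmorph0.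
case: ifP => _; first by rewrite rmorph1.
have -> : ((a - b)%:~R : R[i]) = ((a - b)%:~R : R)%:C by rewrite rmorph_int.
move: ((a - b)%:~R : R) => z.
by rewrite rmorphB rmorph1 fmorphV rmorphXn.
Qed.

(** Symmetry of [s_i] for the inner product of [V_tau]: the norms of [T] and of its swap differ by
    the factor of the pair [(i, i+1)], which is also the ratio of the off-diagonal coefficients. *)
Lemma norm0_swap (T T2 : Y) i : (i < n)%N -> val T2 = fswap (val T) i ->
  norm0 R T * pcoefR (Defs.content (ord_lo n i) T) (Defs.content (ord_hi n i) T) =
  norm0 R T2 * pcoefR (Defs.content (ord_lo n i) T2) (Defs.content (ord_hi n i) T2).
Proof.
clear tP n_gt0 kb; move=> i_n e; rewrite !norm0E.
have c2 j : Defs.content j T2 = Defs.content (stp n i j) T by rewrite !contentE e ct_fswap.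
rewrite !c2 stp_lo stp_hi.
have := prod_pairs_stp (fun j k => norm_factor (Defs.content j T) (Defs.content k T)) i_n.
have -> : \prod_(j < N) \prod_(k < N | (j < k)%N) norm_factor (Defs.content j T2) (Defs.content k T2) =
    \prod_(j < N) \prod_(k < N | (j < k)%N)
      norm_factor (Defs.content (stp n i j) T) (Defs.content (stp n i k) T).
  by apply: eq_bigr => j _; apply: eq_bigr => k _; rewrite !c2.
move: (Defs.content (ord_lo n i) T) (Defs.content (ord_hi n i) T) => x y.
move: (\prod_(j < N) _) (\prod_(j < N) _) => p q h.
have [xy|xy] := boolP (`|x - y| <= 1).
  by rewrite /pcoefR [`|y - x|]distrC xy !mulr0.
move: h; rewrite /pcoefR [`|y - x|]distrC (negPf xy) /norm_factor.
have [lt|lt] := ltP x y.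
  have -> : y < x = false by lia.
  have -> : x <= y - 2 by lia.
  have -> : y <= x - 2 = false by lia.
  by rewrite -[(y - x)%:~R ^+ 2]sqrrN -intrN opprB !mulr1 => ->.
have -> : y < x by lia.
have -> : y <= x - 2 by lia.
have -> : x <= y - 2 = false by lia.
by rewrite -[(y - x)%:~R ^+ 2]sqrrN -intrN opprB !mulr1 => ->.
Qed.

Definition hfac (m : nat) (d : int) : R := 1 - (kappa / (m%:R + kappa * d%:~R)) ^+ 2.

Definition hprod (x d : int) : R :=
  if 0 < x then \prod_(1 <= m < `|x|.+1) hfac m d else 1.

(* The norm as a product over ordered pairs: a pair [a i > a j] contributes one factor for each
   level [1 <= m <= a i - a j], the last one being cancelled by [Eps] when [j < i]. In this form
   the invariance under [aff] is a reindexing. *)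
Definition hpairs (a : K) (T : Y) : R :=
  \prod_(i < N) \prod_(j < N) hprod (a i - a j - (j < i)%N%:Z) (spec a T i - spec a T j).

Lemma hfac_gt0 m i j (T : Y) : (0 < m)%N ->
  0 < hfac m (Defs.content i T - Defs.content j T).
Proof.
move=> m0; rewrite /hfac subr_gt0 -real_normK ?num_real // expr_lt1 ?normr_ge0 // normf_div.
have h' := @kappa_content R n t tP n_gt0 kappa kb i j T T m%:Z ltac:(lia).
rewrite -[m%:R]/(m%:Z%:~R); rewrite ltr_pdivrMr ?mul1r //; exact: le_lt_trans h'.
Qed.

Lemma hprod_gt0 x i j (T : Y) : 0 < hprod x (Defs.content i T - Defs.content j T).
Proof.
rewrite /hprod; case: ifP => // _; rewrite big_nat; apply: prodr_gt0 => m /andP[m0 _].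
exact: hfac_gt0.
Qed.

Lemma plus_id (a : K) : (forall i j : 'I_N, (i <= j)%N -> a j <= a i) -> plus a = a.
Proof.
move=> h; apply/ffunP => i; rewrite ffunE -/(vals a) sorted_sort.
- by rewrite (nth_map i) ?size_enum_ord // nth_ord_enum.
- by move=> x y z /= h1 h2; apply: le_trans h2 h1.
- apply/(sortedP 0) => j; rewrite size_vals => jn.
  have jn' := ltnW jn.
  have nv x (xn : (x < N)%N) : (vals a)`_x = a (Ordinal xn).
    by rewrite /vals (nth_map ord0) ?size_enum_ord //; congr (a _); apply: val_inj; rewrite /= nth_enum_ord.
  by rewrite (nv _ jn) (nv _ jn'); apply: h => /=.
Qed.

Lemma plus_rankp (a : K) i : plus a (rankp a i) = a i.
Proof.
rewrite -(plus_kact (rankp a)^-1%g) plus_id ?ffunE ?permK // => j k jk.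
rewrite !ffunE; move: jk; rewrite leqNgt => jk; rewrite leNgt; apply: contra jk => lt.
rewrite -[k](permKV (rankp a)) -[j](permKV (rankp a)) rankp_lt /before.
by rewrite lt.
Qed.

Lemma hprodS (x d : int) : 0 < x -> hprod x d = hprod (x - 1) d * hfac `|x| d.
Proof.
move=> x0; rewrite /hprod x0 big_nat_recr /=; last by lia.
congr (_ * _); case: ifP => x1.
  by rewrite (_ : `|x - 1|.+1 = `|x|)%N //; lia.
by rewrite (_ : `|x|%N = 1%N) ?big_geq //; lia.
Qed.

Lemma hprod_le0 x d : x <= 0 -> hprod x d = 1.
Proof. by rewrite /hprod ltNge => ->. Qed.

(** Reindexing by the rank replaces [plus a] by [a]. Since [(1 + x)(1 - x) = 1 - x^2], the product
    of the two [Eps] consists of the top-level factors [hfac] of the pairs with [j < i] and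
    [a j < a i]. *)
Lemma normsqE (a : K) (T : Y) : normsq kappa a T = norm0 R T * hpairs a T.
Proof.
have partE : normsq_part kappa (plus a) T = norm0 R T *
    \prod_(i < N) \prod_(j < N) hprod (a i - a j) (spec a T i - spec a T j).
  rewrite /normsq_part; congr (_ * _).
  rewrite (reindex_inj (@perm_inj _ (rankp a))) /=; apply: eq_bigr => i _.
  rewrite (reindex_inj (@perm_inj _ (rankp a))) /= big_mkcond /=; apply: eq_bigr => j _.
  rewrite !plus_rankp rankp_lt /before /hprod subr_gt0 -/(spec a T i) -/(spec a T j).
  have [ji|ij|e] /= := ltgtP (a j) (a i).
  - by apply: eq_bigr => m _; rewrite /hfac.
  - by [].
  - by rewrite e subrr big_geq //; case: ifP.
have epsE : Eps kappa 1 a T * Eps kappa (-1) a T =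
    \prod_(i < N) \prod_(j < N | (j < i)%N && (a j < a i)) hfac `|a i - a j| (spec a T i - spec a T j).
  rewrite /Eps -big_split /=.
  rewrite [RHS](exchange_big_dep predT) //=; apply: eq_bigr => i _.
  rewrite -big_split /=; apply: eq_bigr => j /andP[_ aij].
  rewrite /hfac; have -> : ((absz (a j - a i))%:R : R) = (a j - a i)%:~R.
    by rewrite -[LHS]/((Posz (absz (a j - a i)))%:~R) gez0_abs // subr_ge0 ltW.
  by rewrite -/(spec a T i) -/(spec a T j); ring.
rewrite /normsq partE epsE mulrCA; congr (_ * _).
have hp i j : hprod (a i - a j) (spec a T i - spec a T j) =
    (if (j < i)%N && (a j < a i) then hfac `|a i - a j| (spec a T i - spec a T j) else 1) *
    hprod (a i - a j - (j < i)%N%:Z) (spec a T i - spec a T j).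
  case: (ltnP j i) => /= ji; last by rewrite subr0 mul1r.
  case: ifP => aji; first by rewrite [LHS]hprodS ?subr_gt0 // mulrC.
  by rewrite mul1r !hprod_le0 //; lia.
have -> : \prod_(i < N) \prod_(j < N) hprod (a i - a j) (spec a T i - spec a T j) =
    \prod_(i < N) \prod_(j < N | (j < i)%N && (a j < a i)) hfac `|a i - a j| (spec a T i - spec a T j) *
    hpairs a T.
  rewrite /hpairs -big_split /=; apply: eq_bigr => i _.
  by rewrite [X in _ = X * _]big_mkcond /= -big_split /=; apply: eq_bigr => j _; rewrite hp.
rewrite mulrA.
rewrite mulVf ?mul1r //; apply/lt0r_neq0.
apply: prodr_gt0 => i _; apply: prodr_gt0 => j /andP[_ aji].
by apply: hfac_gt0; rewrite absz_gt0 subr_eq0; apply/eqP; lia.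
Qed.

Lemma normsq_gt0 a (T : Y) : 0 < normsq kappa a T.
Proof.
rewrite normsqE mulr_gt0 ?norm0_gt0 //; do 2 (apply: prodr_gt0 => ? _); exact: hprod_gt0.
Qed.

Lemma normsq_aff a (T : Y) : normsq kappa (aff a) T = normsq kappa a T.
Proof.
rewrite !normsqE; congr (_ * _); rewrite /hpairs.
rewrite (reindex_inj (@perm_inj _ (cyc n))) /=; apply: eq_bigr => i _.
rewrite (reindex_inj (@perm_inj _ (cyc n))) /=; apply: eq_bigr => j _.
rewrite /spec_content rankp_aff !permM !permK; congr (hprod _ _).
rewrite !aff_cyc cyc_lt.
have [->|i0] := eqVneq i ord0; have [->|j0] := eqVneq j ord0 => /=; rewrite ?ltn0;
  [lia|move: j0|move: i0|move: i0 j0]; rewrite -?val_eqE /=; lia.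
Qed.

(** Only the pair at [i], [i+1] changes: its larger entry now comes first, so it regains its
    top-level factor, which is [1 - step_coef ^ 2]. *)
Lemma normsq_step (a : K) (T : Y) i : (i < n)%N -> a (ord_lo n i) < a (ord_hi n i) ->
  normsq kappa (kact (stp n i) a) T = (1 - step_coef kappa a T i ^+ 2) * normsq kappa a T.
Proof.
move=> i_n lt; rewrite !normsqE mulrCA; congr (_ * _).
have aa : a (ord_lo n i) != a (ord_hi n i) by apply/eqP; lia.
have scE j : spec (kact (stp n i) a) T (stp n i j) = spec a T j.
  by rewrite /spec_content rankp_swap // permM stpK.
rewrite /hpairs (reindex_inj (@perm_inj _ (stp n i))) /=.
under eq_bigr do rewrite (reindex_inj (@perm_inj _ (stp n i))) /=.
rewrite !pair_big /= (bigD1 (ord_hi n i, ord_lo n i)) //= [in RHS](bigD1 (ord_hi n i, ord_lo n i)) //=.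
rewrite mulrA; congr (_ * _).
  rewrite !scE !ffunE !stpK !stp_hi !stp_lo ord_loE // ord_hiE //.
  have -> : (i.+1 < i)%N = false by lia.
  rewrite ltnS leqnn subr0 hprodS ?subr_gt0 // mulrC; congr (_ * _).
  rewrite /hfac /step_coef.
  have -> : ((absz (a (ord_hi n i) - a (ord_lo n i)))%:R : R) = (a (ord_hi n i) - a (ord_lo n i))%:~R.
    by rewrite -[LHS]/((Posz (absz (a (ord_hi n i) - a (ord_lo n i))))%:~R) gez0_abs // subr_ge0 ltW.
  move: (a (ord_lo n i)) (a (ord_hi n i)) (spec _ _ _) (spec _ _ _) => x y u v.
  have -> : (x - y)%:~R + kappa * (u - v)%:~R = - ((y - x)%:~R + kappa * (v - u)%:~R).
    by rewrite !intrB; ring.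
  by rewrite invrN mulrN sqrrN.
apply: eq_bigr => -[j k] /=; rewrite xpair_eqE => h; rewrite !scE !ffunE !stpK.
have [/andP[/eqP -> /eqP ->]|h1] := boolP [&& k == ord_hi n i & j == ord_lo n i].
  by rewrite !hprod_le0 //; case: (_ < _)%N; lia.
by rewrite stp_lt // andbC.
Qed.

Lemma normsq_tableau (a : K) (T T2 : Y) i : (i < n)%N -> a (ord_lo n i) = a (ord_hi n i) ->
  (forall j, spec a T2 j = spec a T (stp n i j)) ->
  normsq kappa a T2 * norm0 R T = normsq kappa a T * norm0 R T2.
Proof.
move=> i_n aa sc; rewrite !normsqE.
suff -> : hpairs a T2 = hpairs a T by ring.
rewrite /hpairs [LHS](reindex_inj (@perm_inj _ (stp n i))) /=; apply: eq_bigr => j _.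
rewrite [LHS](reindex_inj (@perm_inj _ (stp n i))) /=; apply: eq_bigr => k _.
have as_ l : a (stp n i l) = a l by rewrite /stp; case: tpermP => [->|->|] //; rewrite -aa.
rewrite !sc !stpK !as_.
have [/andP[/eqP -> /eqP ->]|h1] := boolP [&& k == ord_lo n i & j == ord_hi n i].
  by rewrite aa subrr !hprod_le0 //; case: (_ < _)%N.
have [/andP[/eqP -> /eqP ->]|h2] := boolP [&& k == ord_hi n i & j == ord_lo n i].
  by rewrite aa subrr !hprod_le0 //; case: (_ < _)%N.
by rewrite stp_lt.
Qed.

End Norms.

(** * The invariant form *)

Local Open Scope ring_scope.

Section Form.
Variables (R : realType) (n : nat) (t : seq nat).
Local Notation N := n.+1.
Local Notation Y := (rsyt N t).
Local Notation C := R[i].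
Local Notation V := (V R N t).
Local Notation K := (K N).
Local Notation LP := (K -> V).
Local Notation rep := (@rep R N t).
Local Notation is_lp := (@is_lp R N t).
Local Notation mulx := (@lp_mulx R N t).
Local Notation mono := (@lp_mono R N t).
Local Notation bv := (@basisv R N t).
Hypothesis tP : is_partition_of N t.
Hypothesis n_gt0 : (0 < n)%N.
Variable kappa : R.
Local Notation kc := (kappa%:C).
Hypothesis kb : `|kappa| * (hook t)%:R < 1.
Local Notation Z := (@zetaL R N t kappa).
Local Notation cnt T i := (Defs.content i (T : Y)).

#[local] Opaque act tdiff lp_mulx lp_op dunklE cherU euler omega lp_mono zetaL.

Lemma zetaP a (T : Y) : is_jack kappa a T (Z a T).
Proof. exact: zetaL_jack. Qed.

Lemma is_lp_zeta a (T : Y) : is_lp (Z a T).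
Proof. by case: (zetaP a T). Qed.

Lemma omega_zeta a (T : Y) : omega (Z a T) = Z (aff a) T.
Proof. by apply: (jack_uniq tP n_gt0 kb) (jack_aff _ _ _) (zetaP _ _) => //; exact: zetaP. Qed.

Lemma act_zeta_lt (a : K) (T : Y) i : (i < n)%N -> a (ord_lo n i) < a (ord_hi n i) ->
  act (stp n i) (Z a T) = (step_coef kappa a T i)%:C *: Z a T + Z (kact (stp n i) a) T.
Proof.
move=> i_n lt; rewrite [X in _ + X](jack_uniq tP n_gt0 kb (zetaP _ _) (jack_step tP n_gt0 kb i_n lt (zetaP _ _))).
by rewrite addrC subrK.
Qed.

Lemma rankp_eq_hi (a : K) i : (i < n)%N -> a (ord_lo n i) = a (ord_hi n i) ->
  rankp a (ord_hi n i) = (rankp a (ord_lo n i)).+1 :> nat.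
Proof.
clear tP kb => i_n aa; apply/eqP; rewrite eqn_leq andbC.
have lt : (rankp a (ord_lo n i) < rankp a (ord_hi n i))%N.
  by rewrite rankp_lt /before aa eqxx ord_loE // ord_hiE // ltnSn orbT.
rewrite lt /= leqNgt; apply/negP => gt.
have kN : ((rankp a (ord_lo n i)).+1 < N)%N by exact: ltn_trans gt (ltn_ord _).
set k := (rankp a)^-1%g (Ordinal kN).
have ek : rankp a k = (rankp a (ord_lo n i)).+1 :> nat by rewrite permKV.
have : before a (ord_lo n i) k by rewrite -rankp_lt ek.
have : before a k (ord_hi n i) by rewrite -rankp_lt ek.
by rewrite /before ord_loE // ord_hiE // aa; lia.
Qed.

Lemma vact_bv_invalid m (T : Y) : (m < n)%N -> ~~ is_rsyt t (fswap (val T) m) ->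
  vact m (bv T) = ((cnt T (ord_lo n m) - cnt T (ord_hi n m))%:~R^-1 : C) *: bv T.
Proof.
move=> m_n inv; apply/ffunP => T'; rewrite VZE ffunE /fact vext_val ffunE.
have -> : vext (bv T) (fswap (val T') m) = 0.
  rewrite /vext; case: insubP => // T2 _ e2; rewrite ffunE; case: eqP => // eT.
  by case/negP: inv; rewrite -eT e2 fswapK // (valP T').
rewrite mulr0 addr0 !contentE; case: eqP => [->|_]; last by rewrite mul0r mulr0.
by rewrite mul1r mulr1.
Qed.

Lemma vact_bv_valid m (T T2 : Y) : (m < n)%N -> val T2 = fswap (val T) m ->
  vact m (bv T) = ((cnt T (ord_lo n m) - cnt T (ord_hi n m))%:~R^-1 : C) *: bv T
    + (pcoefR R (cnt T2 (ord_lo n m)) (cnt T2 (ord_hi n m)))%:C *: bv T2.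
Proof.
move=> m_n e2; apply/ffunP => T'; rewrite VDE !VZE ffunE /fact vext_val -pcoefRE.
have -> : vext (bv T) (fswap (val T') m) = bv T2 T'.
  have [->|ne] := eqVneq T' T2.
    by rewrite e2 fswapK // vext_val !ffunE !eqxx.
  rewrite [in RHS]ffunE (negPf ne) /vext; case: insubP => // T3 _ e3; rewrite ffunE; case: eqP => // eT.
  by case/eqP: ne; apply: val_inj; rewrite e2 -eT e3 fswapK.
rewrite !contentE; congr (_ + _).
  by rewrite ffunE; case: eqP => [->|_]; rewrite ?mul0r ?mulr0 // mul1r mulr1.
rewrite [bv T2 T']ffunE; case: eqP => [->|_]; rewrite ?mulr0 //.
Qed.

(** Equal adjacent entries have consecutive ranks [m] and [m+1], so on the coefficient at [a] the
    transposition [s_i] acts as [s_m] on [V_tau]. Removing the diagonal part leaves [v] there, and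
    the contents are exchanged. *)
Lemma act_zeta_eq_gen (a : K) (T : Y) i m (v : V) : (i < n)%N -> a (ord_lo n i) = a (ord_hi n i) ->
  m = rankp a (ord_lo n i) :> nat ->
  vact m (bv T) = ((cnt T (ord_lo n m) - cnt T (ord_hi n m))%:~R^-1 : C) *: bv T + v ->
  let q := act (stp n i) (Z a T) - ((cnt T (ord_lo n m) - cnt T (ord_hi n m))%:~R^-1 : C) *: Z a T in
  [/\ is_lp q, q a = lead a v &
      eigen kappa a (fun j => spec_content a T (stp n i j)) q].
Proof.
move=> i_n aa em hv q.
have hi_m := rankp_eq_hi i_n aa; rewrite -em in hi_m.
have m_n : (m < n)%N by rewrite -ltnS -hi_m.
have rlo : rankp a (ord_lo n i) = ord_lo n m by apply: val_inj; rewrite /= ord_loE.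
have rhi : rankp a (ord_hi n i) = ord_hi n m by apply: val_inj; rewrite /= hi_m ord_hiE.
have [hp pa ep] := zetaP a T.
set b : C := (_%:~R)^-1 in hv q *.
have cne : cnt T (ord_lo n m) - cnt T (ord_hi n m) != 0.
  by rewrite subr_eq0 !contentE (rsyt_ct_neq tP) // (valP T).
have hb : kc = b * (((a (ord_lo n i) + 1)%:~R + kc * (spec_content a T (ord_lo n i))%:~R)
     - ((a (ord_hi n i) + 1)%:~R + kc * (spec_content a T (ord_hi n i))%:~R)).
  rewrite /b /spec_content rlo rhi aa; clear -cne; move: (_ + 1)%:~R cne => A.
  move: (cnt T _) (cnt T _) => x y xy.
  have -> : A + kc * y%:~R - (A + kc * x%:~R) = kc * (y - x)%:~R by rewrite intrB; ring.
  by rewrite mulrC mulfK // intr_eq0.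
have [e1 e2 e3] := step_eigen tP n_gt0 i_n hp (ep _) (ep _) hb.
have as_ : kact (stp n i) a = a.
  apply/ffunP => l; rewrite ffunE /stp; case: tpermP => [->|->|] //; by rewrite -/(ord_lo n i) -/(ord_hi n i) aa.
split.
- by apply: is_lpB; [apply: is_lp_act|apply: is_lpZ].
- rewrite /q lpDE lpNE lpZE actE as_ pa /lead.
  have -> : opv (rep (stp n i)) (opv (rep (rankp a)^-1) (bv T)) = opv (rep (rankp a)^-1) (vact m (bv T)).
    rewrite -opv_rep_stp // -!opv_repM //; congr (opv (rep _) _).
    by rewrite /stp -/(ord_lo n m) -/(ord_hi n m) -rlo -rhi -tpermJ conjgE !mulgA mulgK.
  by rewrite hv opv_is_additive opvZ addrC addKr.
- move=> j; have [->|jlo] := eqVneq j (ord_lo n i); first by rewrite stp_lo aa; exact: e1.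
  have [->|jhi] := eqVneq j (ord_hi n i); first by rewrite stp_hi -aa; exact: e2.
  have -> : stp n i j = j by rewrite /stp tpermD // eq_sym.
  exact: (e3 _ _ jlo jhi (ep j)).
Qed.

(** The span of two Jack polynomials is stable under [s_i], and the last equation is the symmetry of
    its matrix for the form. The case [y = x] with [g = g' = 0] covers eigenvectors. *)
Definition stp_pair i (x y : K * Y) : Prop := exists b b' g g' : R,
  [/\ act (stp n i) (Z x.1 x.2) = b%:C *: Z x.1 x.2 + g%:C *: Z y.1 y.2,
      act (stp n i) (Z y.1 y.2) = b'%:C *: Z y.1 y.2 + g'%:C *: Z x.1 x.2 &
      g * normsq kappa y.1 y.2 = g' * normsq kappa x.1 x.2].

Lemma stp_pair_sym i x y : stp_pair i x y -> stp_pair i y x.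
Proof. by move=> [b [b' [g [g' [h1 h2 h3]]]]]; exists b', b, g', g; split. Qed.

Lemma stp_pair_lt i (a : K) (T : Y) : (i < n)%N -> a (ord_lo n i) < a (ord_hi n i) ->
  stp_pair i (a, T) (kact (stp n i) a, T).
Proof.
move=> i_n lt; set b := step_coef kappa a T i.
exists b, (- b), 1, (1 - b ^+ 2); split => /=.
- by rewrite scale1r act_zeta_lt.
- have -> : Z (kact (stp n i) a) T = act (stp n i) (Z a T) - b%:C *: Z a T.
    by rewrite act_zeta_lt // addrC addKr.
  rewrite actD actN actZ act_stpK // rmorphB rmorphN rmorphXn rmorph1 /=; lpring.
- by rewrite mul1r normsq_step.
Qed.

Lemma spec_content_fswap (a : K) (T T2 : Y) i m j : (i < n)%N -> a (ord_lo n i) = a (ord_hi n i) ->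
  m = rankp a (ord_lo n i) :> nat -> val T2 = fswap (val T) m ->
  spec_content a T2 j = spec_content a T (stp n i j).
Proof.
move=> i_n aa em e2; have hi_m := rankp_eq_hi i_n aa; rewrite -em in hi_m.
have m_n : (m < n)%N by rewrite -ltnS -hi_m.
have rlo : rankp a (ord_lo n i) = ord_lo n m by apply: val_inj; rewrite /= ord_loE.
have rhi : rankp a (ord_hi n i) = ord_hi n m by apply: val_inj; rewrite /= hi_m ord_hiE.
rewrite /spec_content !contentE e2 ct_fswap; congr (ct _ _).
by rewrite /stp -/(ord_lo n m) -/(ord_hi n m) -rlo -rhi -inj_tperm //; apply: perm_inj.
Qed.

Lemma act_zeta_eq (a : K) (T T2 : Y) i m : (i < n)%N -> a (ord_lo n i) = a (ord_hi n i) ->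
  m = rankp a (ord_lo n i) :> nat -> val T2 = fswap (val T) m ->
  act (stp n i) (Z a T) =
    (((cnt T (ord_lo n m) - cnt T (ord_hi n m))%:~R^-1 : R)%:C) *: Z a T +
    (pcoefR R (cnt T2 (ord_lo n m)) (cnt T2 (ord_hi n m)))%:C *: Z a T2.
Proof.
move=> i_n aa em e2.
have hi_m := rankp_eq_hi i_n aa; rewrite -em in hi_m.
have m_n : (m < n)%N by rewrite -ltnS -hi_m.
have [hq qa eq] := act_zeta_eq_gen i_n aa em (vact_bv_valid m_n e2).
have [hp2 pa2 ep2] := zetaP a T2.
set g := _%:C in qa *.
suff : act (stp n i) (Z a T) - ((cnt T (ord_lo n m) - cnt T (ord_hi n m))%:~R^-1 : C) *: Z a T - g *: Z a T2 = 0.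
  rewrite fmorphV rmorph_int => /eqP; rewrite subr_eq0 => /eqP <-; by rewrite addrC subrK.
move: (_ - _ *: Z a T) hq qa eq => q hq qa eq.
apply: (@eigen_eq0 R n t tP n_gt0 kappa kb a (spec_content a T2)).
- by apply: is_lpB => //; apply: is_lpZ.
- move=> j; rewrite -scaleNr addrC cherU_linear // eq ep2.
  rewrite -(spec_content_fswap j i_n aa em e2); lpring.
- exact: spec_contentP.
- by rewrite lpDE lpNE lpZE pa2 qa /lead opvZ subrr.
Qed.

Lemma act_zeta_invalid (a : K) (T : Y) i m : (i < n)%N -> a (ord_lo n i) = a (ord_hi n i) ->
  m = rankp a (ord_lo n i) :> nat -> ~~ is_rsyt t (fswap (val T) m) ->
  act (stp n i) (Z a T) =
    (((cnt T (ord_lo n m) - cnt T (ord_hi n m))%:~R^-1 : R)%:C) *: Z a T.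
Proof.
move=> i_n aa em inv; have hi_m := rankp_eq_hi i_n aa; rewrite -em in hi_m.
have m_n : (m < n)%N by rewrite -ltnS -hi_m.
have hv : vact m (bv T) = ((cnt T (ord_lo n m) - cnt T (ord_hi n m))%:~R^-1 : C) *: bv T + 0.
  by rewrite addr0 vact_bv_invalid.
have [hq qa eq] := act_zeta_eq_gen i_n aa em hv.
apply/eqP; rewrite -subr_eq0 fmorphV rmorph_int; apply/eqP.
apply: (eigen_eq0 tP n_gt0 kb hq eq) => [j|]; first exact: spec_contentP.
by rewrite qa /lead opv0.
Qed.

Lemma stp_pair_ex i x : (i < n)%N -> exists y, stp_pair i x y.
Proof.
move=> i_n; case: x => a T; have [lt|gt|aa] := ltgtP (a (ord_lo n i)) (a (ord_hi n i)).
- by exists (kact (stp n i) a, T); apply: stp_pair_lt.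
- exists (kact (stp n i) a, T); apply: stp_pair_sym.
  have := @stp_pair_lt i (kact (stp n i) a) T i_n; rewrite !ffunE stp_lo stp_hi kact_stpK; exact.
set m : nat := rankp a (ord_lo n i).
have hi_m := rankp_eq_hi i_n aa; rewrite -/m in hi_m.
have m_n : (m < n)%N by rewrite -ltnS -hi_m.
case: (boolP (is_rsyt t (fswap (val T) m))) => [val2|inv].
  pose T2 : Y := Sub (fswap (val T) m) val2.
  have e2 : val T2 = fswap (val T) m by [].
  have e1 : val T = fswap (val T2) m by rewrite e2 fswapK.
  exists (a, T2); do 4 eexists; split => /=; [exact: act_zeta_eq e2|exact: act_zeta_eq e1|].
  have h1 := norm0_swap R m_n e2.
  have h2 : normsq kappa a T2 * norm0 R T = normsq kappa a T * norm0 R T2.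
    apply: (normsq_tableau tP n_gt0 kb i_n aa) => j.
    exact: spec_content_fswap e2.
  apply: (mulfI (lt0r_neq0 (norm0_gt0 R T))).
  apply: (mulfI (lt0r_neq0 (norm0_gt0 R T2))).
  move: h1 h2; move: (pcoefR _ _ _) (pcoefR _ _ _) (normsq _ _ _) (normsq _ _ _) (norm0 _ _) (norm0 _ _) => p1 p2 n1 n2 m1 m2 h1 h2.
  have -> : m1 * (m2 * (p1 * n2)) = m1 * p1 * (n2 * m2) by ring.
  by rewrite -h1 h2; ring.
(* The swap of [T] is no tableau, so [s_i] multiplies the Jack polynomial by a scalar. *)
exists (a, T); set b : R := ((cnt T (ord_lo n m) - cnt T (ord_hi n m))%:~R)^-1; exists b, b, 0, 0; split; rewrite ?mul0r // scale0r addr0 (act_zeta_invalid (m := m) i_n aa erefl inv) //.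
Qed.

(** * Expansion of Laurent polynomials in Jack polynomials *)

Lemma big_supp (I : eqType) (S : nmodType) (s s' : seq I) (F : I -> S) : uniq s -> uniq s' ->
  (forall i, F i != 0 -> i \in s) -> (forall i, F i != 0 -> i \in s') ->
  \sum_(i <- s) F i = \sum_(i <- s') F i.
Proof.
move=> us us' h h'.
have e r : \sum_(i <- r) F i = \sum_(i <- [seq i <- r | F i != 0]) F i.
  rewrite big_filter [RHS]big_mkcond; apply: eq_bigr => i _.
  by case: eqP => // ->.
rewrite e [RHS]e; apply: perm_big; apply: uniq_perm; rewrite ?filter_uniq // => i.
by rewrite !mem_filter; case: (boolP (F i != 0)) => //= Fi; rewrite h ?h'.
Qed.

(* Quantifying over all large enough index lists makes linearity immediate, without tracking
   supports. *)
Definition expands (f c : LP) : Prop := is_lp c /\ exists s0 : seq K, forall s, uniq s ->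
  {subset s0 <= s} -> f = \sum_(k <- s) \sum_T c k T *: Z k T.

Lemma expands_lin z f g c d : expands f c -> expands g d -> expands (z *: f + g) (z *: c + d).
Proof.
move=> [hc [s0 fc]] [hd [s1 gd]]; split; first by apply: is_lpD => //; apply: is_lpZ.
exists (s0 ++ s1) => s us sub.
rewrite {1}(fc s us) ?{1}(gd s us); last 2 first.
  by move=> k ks; apply: sub; rewrite mem_cat ks orbT.
  by move=> k ks; apply: sub; rewrite mem_cat ks.
rewrite scaler_sumr -big_split; apply: eq_bigr => k _ /=.
rewrite scaler_sumr -big_split; apply: eq_bigr => T _ /=.
by rewrite lpDE lpZE VDE VZE scalerDl scalerA.
Qed.

Lemma expands_zeta k T : expands (Z k T) (mono k (bv T)).
Proof.
split; first exact: is_lp_mono.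
exists [:: k] => s us sub.
rewrite (bigD1_seq k) //=; last by apply: sub; rewrite mem_head.
have -> : \sum_(i <- s | i != k) \sum_T0 mono k (bv T) i T0 *: Z i T0 = 0.
  by apply: big1 => j /negPf jk; apply: big1 => T' _; rewrite monoE jk V0E scale0r.
have bz T' : mono k (bv T) k T' = (T' == T)%:R by rewrite monoE eqxx ffunE.
rewrite addr0 (bigD1 T) //= bz eqxx scale1r.
have -> : \sum_(T' | T' != T) mono k (bv T) k T' *: Z k T' = 0; last by rewrite addr0.
by apply: big1 => T' /negPf ne; rewrite bz ne scale0r.
Qed.

(** At a maximal exponent [b] of [c] only the Jack polynomials indexed by [b] contribute, and their
    coefficients at [b] are the images of the basis under an invertible map. *)
Lemma expands0 c : expands 0 c -> c = 0.
Proof.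
move=> [hc [s0 fc]]; apply: boolp.funext => k0; apply/eqP; apply/negPn/negP => ck0.
have [b [cb _ bmax]] := max_above hc ck0.
have z k : k != b -> (\sum_T c k T *: Z k T) b = 0.
  move=> kb'; rewrite lp_sumE; apply: big1 => T _; rewrite lpZE.
  have [-> |ne] := eqVneq (Z k T b) 0; first by rewrite scaler0.
  have [e|h] := jack_support tP n_gt0 kb (zetaP k T) ne; first by rewrite e eqxx in kb'.
  by rewrite bmax // V0E scale0r.
pose s := undup (b :: s0); have us : uniq s := undup_uniq _.
have bs : b \in s by rewrite mem_undup mem_head.
have h : 0 = (\sum_T c b T *: Z b T) b.
  transitivity ((\sum_(k <- s) \sum_T c k T *: Z k T) b).
    by rewrite -fc // => k ks; rewrite mem_undup inE ks orbT.
  rewrite lp_sumE (bigD1_seq b bs us) /=; apply: etrans (addr0 _); congr (_ + _).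
  by apply: big1 => k; apply: z.
case/eqP: cb.
suff : opv (rep (rankp b)^-1) (c b) = 0.
  by move=> e; rewrite -(opv_repVK tP n_gt0 (rankp b) (c b)) e opv0.
rewrite [c b]basisvE opv_sum; rewrite lp_sumE in h; apply: etrans (esym h); apply: eq_bigr => T _.
by rewrite lpZE opvZ; case: (zetaP b T) => _ -> _.
Qed.

Lemma expands_uniq f c d : expands f c -> expands f d -> c = d.
Proof.
move=> hc hd; have := expands_lin (-1) hd hc; rewrite scaleN1r addNr => /expands0/eqP.
by rewrite addrC scaleN1r subr_eq0 => /eqP.
Qed.

Lemma is_lp_lin z f g : is_lp f -> is_lp g -> is_lp (z *: f + g).
Proof. by move=> hf hg; apply: is_lpD => //; apply: is_lpZ. Qed.

Definition spanned (f : LP) : Prop := exists c, expands f c.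

Lemma spanned_lin z f g : spanned f -> spanned g -> spanned (z *: f + g).
Proof. by move=> [c hc] [d hd]; exists (z *: c + d); apply: expands_lin. Qed.

Lemma spanned0 : spanned 0.
Proof.
exists 0; split; first exact: is_lp0.
exists [::] => s _ _; rewrite big1 // => k _; rewrite big1 // => T _.
by rewrite V0E scale0r.
Qed.

Lemma spanned_ind (P : LP -> Prop) : P 0 -> (forall z f g, P f -> P g -> P (z *: f + g)) ->
  (forall a T, P (Z a T)) -> forall f, spanned f -> P f.
Proof.
move=> P0 PD PZ f [c [_ [s0 fc]]].
rewrite (fc (undup s0) (undup_uniq _) ltac:(by move=> k; rewrite mem_undup)).
have PD' g h : P g -> P h -> P (g + h) by move=> pg ph; rewrite -[g]scale1r; apply: PD.
apply: big_rec => // k g _; apply: PD'; apply: big_rec => // T h _ ph; exact: PD.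
Qed.

Lemma spanned_zeta a T : spanned (Z a T).
Proof. by exists (mono a (bv T)); apply: expands_zeta. Qed.

Lemma spanned_actP w f : spanned f -> spanned (act w f).
Proof.
suff : forall f, spanned f -> spanned (act w f) by move=> h; apply: h.
  elim/stp_ind: w {f} => [f|w i i_n IH f hf]; first by rewrite act1.
  rewrite actM //; move: (act w f) (IH f hf).
  apply: (@spanned_ind (fun f => spanned (act (stp n i) f))) => [|z g h hg hh|a T].
  - by rewrite act0; apply: spanned0.
  - by rewrite actD actZ; apply: spanned_lin.
  - have [y [b [_ [g [_ [-> _ _]]]]]] := stp_pair_ex (a, T) i_n.
    apply: spanned_lin; first exact: spanned_zeta.
    by rewrite -[_ *: _]addr0; apply: spanned_lin; [exact: spanned_zeta|exact: spanned0].
Qed.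

Lemma mulx00 e : mulx e 0 = 0.
Proof. by apply: boolp.funext => k; rewrite mulxE. Qed.

Lemma spanned_omega f : spanned f -> spanned (omega f).
Proof.
apply: (@spanned_ind (fun f => spanned (omega f))) => [|z g h hg hh|a T].
- by rewrite omegaE mulx00 act0; apply: spanned0.
- by rewrite omegaE mulxD mulxZ actD actZ -!omegaE; apply: spanned_lin.
- by rewrite omega_zeta; apply: spanned_zeta.
Qed.

Definition omegaV (f : LP) : LP := mulx (- unitK ord0) (act (cyc n)^-1%g f).

Lemma omegaK f : omegaV (omega f) = f.
Proof. by rewrite /omegaV omegaE actK // mulxK. Qed.

Lemma spanned_omegaV f : spanned f -> spanned (omegaV f).
Proof.
apply: (@spanned_ind (fun f => spanned (omegaV f))) => [|z g h hg hh|a T].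
- by rewrite /omegaV act0 mulx00; apply: spanned0.
- by rewrite /omegaV actD actZ mulxD mulxZ; apply: spanned_lin.
- by rewrite -[a]affP -omega_zeta omegaK; apply: spanned_zeta.
Qed.

Lemma mulx_ind (P : K -> Prop) :
  (forall e f, P e -> P f -> P (e + f)) -> (forall e, P e -> P (- e)) ->
  (forall w e, P e -> P (kact w e)) -> P (unitK ord0) -> forall e, P e.
Proof.
clear tP n_gt0 kb; move=> PD PN PK P1 e.
have P0 : P 0 by rewrite -(subrr (unitK ord0)); apply: (PD) => //; apply: PN.
have Pu i : P (unitK i).
  by rewrite -(kact_unit (tperm i ord0)) tpermL; apply: PK.
have Pn f m : P f -> P (f *+ m).
  by move=> Pf; elim: m => [|m IH]; rewrite ?mulr0n // mulrS; apply: PD.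
have -> : e = \sum_i unitK i *~ e i.
  apply/ffunP => j; rewrite sum_ffunE (bigD1 j) //= big1 ?addr0 => [|i ij].
    by case: (e j) => m; rewrite ?ffunE ffunMnE ffunE eqxx; lia.
  by case: (e i) => m; rewrite ?ffunE ffunMnE ffunE (eq_sym j) (negPf ij) ?mul0rn ?oppr0.
elim/big_ind: _ => // i _; case: (e i) => m; first exact: Pn.
by apply: PN; apply: Pn.
Qed.

Lemma act_mulxE w e f : mulx (kact w e) f = act w^-1%g (mulx e (act w f)).
Proof. by rewrite -act_mulx actK. Qed.

(* [x_1 = act cyc^-1 o omega], so [omega] and the symmetric group generate all monomials. *)
Lemma spanned_mulx e f : spanned f -> spanned (mulx e f).
Proof.
have : (forall f, spanned f -> spanned (mulx e f)) /\ (forall f, spanned f -> spanned (mulx (- e) f)).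
  elim/mulx_ind: e {f} => [e e' [h1 h2] [h3 h4]|e [h1 h2]|w e [h1 h2]|].
  - split=> f hf; rewrite ?opprD -mulxA; [exact/h1/h3|exact/h2/h4].
  - by split=> // f hf; rewrite opprK; apply: h1.
  - split=> f hf; rewrite -?kactN act_mulxE; apply/spanned_actP;
      [apply: h1|apply: h2]; exact: spanned_actP.
  - split=> f hf.
      by rewrite -[mulx _ f](actK tP n_gt0 (cyc n)) -omegaE; apply/spanned_actP/spanned_omega.
    by rewrite -[f](actK tP n_gt0 (cyc n)); apply/spanned_omegaV/spanned_actP.
by case=> h _; apply: h.
Qed.

(** The constants are the [Z 0 T], and multiplication by [x^a] preserves the span; the triangular
    expansion need not be inverted. *)
Lemma spanned_mono a v : spanned (mono a v).
Proof.
rewrite -[a]add0r -mulx_mono; apply: spanned_mulx.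
exists (mono 0 v); split; first exact: is_lp_mono.
exists [:: 0] => s us sub.
have z k : k != 0 -> \sum_T mono 0 v k T *: Z k T = 0.
  by move=> /negPf k0; apply: big1 => T _; rewrite monoE k0 V0E scale0r.
rewrite (bigD1_seq 0 (sub _ (mem_head _ _)) us) /=.
rewrite -[LHS]addr0; congr (_ + _); last by apply/esym/big1 => k; apply: z.
apply: boolp.funext => k; rewrite lp_sumE monoE.
have zE T : Z 0 T = mono 0 (bv T).
  by apply: (jack_uniq tP n_gt0 kb) (zetaP 0 T) (jack0 _ _ _ _).
have mE T : mono 0 v 0 T = v T by rewrite monoE eqxx.
under eq_bigr do rewrite lpZE zE mE monoE.
case: eqP => _; first exact: basisvE.
by rewrite big1 // => T _; rewrite scaler0.
Qed.

Lemma lp_spanned f : is_lp f -> spanned f.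
Proof.
elim/lp_ind => [|p q hp hq|a v]; first exact: spanned0; last exact: spanned_mono.
by rewrite -[p]scale1r; apply: spanned_lin.
Qed.

Lemma lp_zeta_ind (P : LP -> Prop) : P 0 -> (forall z f g, is_lp f -> is_lp g -> P f -> P g -> P (z *: f + g)) ->
  (forall a T, P (Z a T)) -> forall f, is_lp f -> P f.
Proof.
move=> P0 PD PZ f /lp_spanned; suff h : spanned f -> is_lp f /\ P f by case/h.
move: f; apply: (@spanned_ind (fun f => is_lp f /\ P f)) => [|z f g [h1 h2] [h3 h4]|a T].
- by split=> //; apply: is_lp0.
- by split; [apply: is_lp_lin|apply: PD].
- by split=> //; apply: is_lp_zeta.
Qed.

Definition coef (f : LP) : LP := ClassicalEpsilon.epsilon (inhabits 0) (expands f).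

Lemma coefP f : is_lp f -> expands f (coef f).
Proof. by move=> /lp_spanned [c hc]; apply: ClassicalEpsilon.epsilon_spec; exists c. Qed.

Lemma coef_lin z f g : is_lp f -> is_lp g -> coef (z *: f + g) = z *: coef f + coef g.
Proof.
move=> hf hg; apply: (@expands_uniq (z *: f + g)); first exact/coefP/is_lp_lin.
by apply: expands_lin; apply: coefP.
Qed.

Lemma coef_zeta a T : coef (Z a T) = mono a (bv T).
Proof. by apply: (@expands_uniq (Z a T)); [exact/coefP/is_lp_zeta|exact: expands_zeta]. Qed.

(** The very list over which [lp_coord] sums. *)
Definition suppseq (f : LP) : seq K :=
  ClassicalEpsilon.epsilon (inhabits [::]) (fun s : seq K => uniq s /\ forall k, f k != 0 -> k \in s).

Lemma suppseqP f : is_lp f -> uniq (suppseq f) /\ forall k, f k != 0 -> k \in suppseq f.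
Proof.
move=> [s hs]; apply: (@ClassicalEpsilon.epsilon_spec _ (inhabits [::]) (fun s : seq K => uniq s /\ forall k, f k != 0 -> k \in s)).
by exists (undup s); split; [exact: undup_uniq|move=> k /hs; rewrite mem_undup].
Qed.

(** Serves only as the witness that some form satisfies [is_lpform]; from then on [lpform] itself is
    used. *)
Definition jform (f g : LP) : C :=
  \sum_(k <- suppseq (coef f)) \sum_T (coef f k T)^* * coef g k T * (normsq kappa k T)%:C.

Lemma jform_zeta a T b T' : jform (Z a T) (Z b T') = if (a == b) && (T == T') then (normsq kappa a T)%:C else 0.
Proof.
rewrite /jform !coef_zeta.
have [us sub] := suppseqP (is_lp_mono a (bv T)).
have bne : bv T != 0.
  by apply/eqP => /ffunP/(_ T); rewrite !ffunE eqxx => /eqP; rewrite oner_eq0.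
have as_ : a \in suppseq (mono a (bv T)) by apply: sub; rewrite monoE eqxx.
rewrite (bigD1_seq a as_ us) /=; rewrite -[RHS]addr0; congr (_ + _); last first.
  by apply: big1 => k /negPf ka; apply: big1 => T0 _; rewrite monoE ka V0E rmorph0 !mul0r.
have mT T0 : mono a (bv T) a T0 = (T0 == T)%:R by rewrite monoE eqxx ffunE.
rewrite (bigD1 T) //=; rewrite -[RHS]addr0; congr (_ + _); last first.
  by apply: big1 => T0 /negPf ne; rewrite mT ne rmorph0 !mul0r.
rewrite mT eqxx rmorph1 mul1r monoE; case: (a == b) => /=; last by rewrite V0E mul0r.
by rewrite ffunE; case: eqP => _; rewrite ?mul1r ?mul0r.
Qed.

Lemma jform_supp f g s : is_lp f -> uniq s -> (forall k, coef f k != 0 -> k \in s) ->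
  jform f g = \sum_(k <- s) \sum_T (coef f k T)^* * coef g k T * (normsq kappa k T)%:C.
Proof.
move=> hf us sub; have [us' sub'] := suppseqP (proj1 (coefP hf)).
have h k : \sum_T (coef f k T)^* * coef g k T * (normsq kappa k T)%:C != 0 -> coef f k != 0.
  apply: contra_neq => ->; apply: big1 => T _.
  by rewrite V0E rmorph0 !mul0r.
by apply: big_supp => // k /h; [apply: sub'|apply: sub].
Qed.

Lemma jform_is_lpform : is_lpform kappa jform.
Proof.
split; last exact: jform_zeta.
  move=> f1 f2 g z h1 h2 _; rewrite -/(z *: f1 + f2).
  have [s hs] := proj1 (coefP h1); have [s' hs'] := proj1 (coefP h2).
  have us : uniq (undup (s ++ s')) := undup_uniq _.
  rewrite (jform_supp _ (is_lp_lin z h1 h2) us); last first.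
    move=> k; rewrite coef_lin // mem_undup mem_cat lpDE lpZE => ne.
    have [e|/hs -> //] := eqVneq (coef f1 k) 0.
    by rewrite hs' ?orbT //; move: ne; rewrite e scaler0 add0r.
  rewrite (jform_supp _ h1 us); last by move=> k /hs; rewrite mem_undup mem_cat => ->.
  rewrite (jform_supp _ h2 us); last by move=> k /hs'; rewrite mem_undup mem_cat orbC => ->.
  rewrite mulr_sumr -big_split; apply: eq_bigr => k _ /=.
  rewrite mulr_sumr -big_split; apply: eq_bigr => T _ /=.
  by rewrite coef_lin // lpDE lpZE VDE VZE rmorphD rmorphM /=; ring.
move=> f g1 g2 z hf h1 h2; rewrite -/(z *: g1 + g2) /jform.
rewrite mulr_sumr -big_split; apply: eq_bigr => k _ /=.
rewrite mulr_sumr -big_split; apply: eq_bigr => T _ /=.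
by rewrite coef_lin // lpDE lpZE VDE VZE; ring.
Qed.

Lemma lpform_spec : is_lpform kappa (lpform (t := t) (N := N) kappa).
Proof. by apply: ClassicalEpsilon.epsilon_spec; exists jform; apply: jform_is_lpform. Qed.

(** * Unitarity of the symmetric group, of [omega] and of the monomials *)

Local Notation B := (@lpform R N t kappa).

Lemma lpformDl z f g h : is_lp f -> is_lp g -> is_lp h -> B (z *: f + g) h = z^* * B f h + B g h.
Proof. by case: lpform_spec => + _ _; apply. Qed.

Lemma lpformDr z f g h : is_lp f -> is_lp g -> is_lp h -> B f (z *: g + h) = z * B f g + B f h.
Proof. by case: lpform_spec => _ + _; apply. Qed.

Lemma lpform_zeta a T b T' :
  B (Z a T) (Z b T') = if (a == b) && (T == T') then (normsq kappa a T)%:C else 0.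
Proof. by case: lpform_spec. Qed.

Lemma lpform0l f : is_lp f -> B 0 f = 0.
Proof.
move=> hf; have := @lpformDl 1 0 0 f (is_lp0 _ _ _) (is_lp0 _ _ _) hf.
by rewrite scaler0 addr0 rmorph1 mul1r => /eqP; rewrite eq_sym -subr_eq0 addrK => /eqP.
Qed.

Lemma lpform0r f : is_lp f -> B f 0 = 0.
Proof.
move=> hf; have := @lpformDr 1 f 0 0 hf (is_lp0 _ _ _) (is_lp0 _ _ _).
by rewrite scaler0 addr0 mul1r => /eqP; rewrite eq_sym -subr_eq0 addrK => /eqP.
Qed.

Lemma lpform_suml I (r : seq I) (c : I -> C) (G : I -> LP) h : (forall i, is_lp (G i)) -> is_lp h ->
  B (\sum_(i <- r) c i *: G i) h = \sum_(i <- r) (c i)^* * B (G i) h.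
Proof.
move=> hG hh; elim: r => [|i r IH]; first by rewrite !big_nil lpform0l.
rewrite !big_cons lpformDl // ?IH //.
by apply: is_lp_sum => j _; apply: is_lpZ.
Qed.

Lemma lpform_sumr I (r : seq I) (c : I -> C) (G : I -> LP) h : (forall i, is_lp (G i)) -> is_lp h ->
  B h (\sum_(i <- r) c i *: G i) = \sum_(i <- r) c i * B h (G i).
Proof.
move=> hG hh; elim: r => [|i r IH]; first by rewrite !big_nil lpform0r.
rewrite !big_cons lpformDr // ?IH //.
by apply: is_lp_sum => j _; apply: is_lpZ.
Qed.

(** By sesquilinearity and the spanning property, an identity between forms need only be checked on
    Jack polynomials. *)
Lemma lpform_ext (F G : LP -> LP) (F' G' : LP -> LP) :
  (forall z f g, F (z *: f + g) = z *: F f + F g) -> (forall z f g, G (z *: f + g) = z *: G f + G g) ->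
  (forall z f g, F' (z *: f + g) = z *: F' f + F' g) -> (forall z f g, G' (z *: f + g) = z *: G' f + G' g) ->
  (forall f, is_lp f -> is_lp (F f)) -> (forall f, is_lp f -> is_lp (G f)) ->
  (forall f, is_lp f -> is_lp (F' f)) -> (forall f, is_lp f -> is_lp (G' f)) ->
  (forall a T b T', B (F (Z a T)) (G (Z b T')) = B (F' (Z a T)) (G' (Z b T'))) ->
  forall f g, is_lp f -> is_lp g -> B (F f) (G g) = B (F' f) (G' g).
Proof.
move=> Fl Gl F'l G'l hF hG hF' hG' h f g hf hg.
have z0 (H : LP -> LP) : (forall z f g, H (z *: f + g) = z *: H f + H g) -> H 0 = 0.
  move=> Hl; have := Hl (-1) 0 0; rewrite scaler0 addr0 => ->.
  by rewrite scaleN1r addNr.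
move: f hf g hg; apply: (@lp_zeta_ind (fun f => forall g, is_lp g -> B (F f) (G g) = B (F' f) (G' g)))
    => [g hg|z f f' hf hf' IH IH' g hg|a T].
- by rewrite !z0 // !lpform0l //; [apply: hG'|apply: hG].
- by rewrite Fl F'l !lpformDl ?IH ?IH' //; by [apply: hG'|apply: hG|apply: hF|apply: hF'].
- apply: (@lp_zeta_ind (fun g => B (F (Z a T)) (G g) = B (F' (Z a T)) (G' g))) => [|z f f' hf hf' IH IH'|b T'].
  + by rewrite (z0 G) // (z0 G') // !lpform0r //; [apply: hF'|apply: hF]; apply: is_lp_zeta.
  + by rewrite Gl G'l !lpformDr ?IH ?IH' //; by [apply: hG'|apply: hG|apply: hF; apply: is_lp_zeta|apply: hF'; apply: is_lp_zeta].
  + exact: h.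
Qed.

Lemma act_lin w z (f g : LP) : act w (z *: f + g) = z *: act w f + act w g.
Proof. by rewrite actD actZ. Qed.

Lemma conj_real (x : R) : (x%:C)^* = x%:C.
Proof. exact: conjc_real. Qed.

(** On Jack polynomials both sides vanish unless [z] is [x] or its partner. For [z = x] they agree
    because the diagonal coefficient is real; for the partner this is the last equation of
    [stp_pair]. *)
Lemma lpform_stp i f g : (i < n)%N -> is_lp f -> is_lp g ->
  B (act (stp n i) f) g = B f (act (stp n i) g).
Proof.
move=> i_n.
pose nn (x : K * Y) : C := (normsq kappa x.1 x.2)%:C.
pose D (x y : K * Y) : C := if x == y then nn x else 0.
have DC x y : D x y = D y x by rewrite /D eq_sym; case: eqP => [->|].
have DE x y : B (Z x.1 x.2) (Z y.1 y.2) = D x y.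
  by rewrite lpform_zeta /D /nn; case: x y => [? ?] [? ?]; rewrite xpair_eqE.
have hZ (x : K * Y) : is_lp (Z x.1 x.2) := is_lp_zeta x.1 x.2.
have Bl x y z b g0 : B (b%:C *: Z x.1 x.2 + g0%:C *: Z y.1 y.2) (Z z.1 z.2) = b%:C * D x z + g0%:C * D y z.
  rewrite lpformDl //; last exact: is_lpZ.
  rewrite -[_ *: _]addr0 lpformDl //; last exact: is_lp0.
  by rewrite lpform0l // addr0 !DE !conj_real.
have Br x y z b g0 : B (Z z.1 z.2) (b%:C *: Z x.1 x.2 + g0%:C *: Z y.1 y.2) = b%:C * D x z + g0%:C * D y z.
  rewrite lpformDr //; last exact: is_lpZ.
  rewrite -[_ *: _]addr0 lpformDr //; last exact: is_lp0.
  by rewrite lpform0r // addr0 !DE (DC z x) (DC z y).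
apply: (@lpform_ext (act (stp n i)) id id (act (stp n i))) => //;
  try by [move=> *; exact: act_lin|move=> *; exact: is_lp_act].
move=> a T b T'; pose x := (a, T); pose z := (b, T').
rewrite -[Z a T]/(Z x.1 x.2) -[Z b T']/(Z z.1 z.2); move: x z => {a T b T'} x z.
have pairE y : stp_pair i x y -> y = z -> x != z -> B (act (stp n i) (Z x.1 x.2)) (Z z.1 z.2) = B (Z x.1 x.2) (act (stp n i) (Z z.1 z.2)).
  move=> [b [b' [g0 [g' [h1 h2 h3]]]]] e xz; rewrite h1 -e h2 Bl Br {1 3}/D e (negPf xz) eq_sym (negPf xz).
  by rewrite !mulr0 !add0r /D !eqxx /nn -!rmorphM /= -e h3.
have [y hy] := stp_pair_ex x i_n; have [w hw] := stp_pair_ex z i_n.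
have [e|xz] := eqVneq x z.
  by rewrite e in hy *; have [b [_ [g0 [_ [-> _ _]]]]] := hy; rewrite Bl Br.
have [yz|yz] := eqVneq y z; first exact: pairE hy yz xz.
have [wx|wx] := eqVneq w x; first by rewrite wx in hw; apply: pairE (stp_pair_sym hw) _ xz.
have [b [_ [g0 [_ [-> _ _]]]]] := hy; have [b' [_ [g' [_ [-> _ _]]]]] := hw.
by rewrite Bl Br /D (negPf xz) (negPf yz) (negPf wx) eq_sym (negPf xz) !mulr0.
Qed.

Lemma lpform_act w f g : is_lp f -> is_lp g -> B (act w f) (act w g) = B f g.
Proof.
elim/stp_ind: w f g => [f g hf hg|w i i_n IH f g hf hg]; first by rewrite !act1.
rewrite !actM // lpform_stp ?act_stpK ?IH //; by apply: is_lp_act; try exact: is_lp_act.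
Qed.

Lemma omega_lin z (f g : LP) : omega (z *: f + g) = z *: omega f + omega g.
Proof. by rewrite !omegaE mulxD mulxZ act_lin. Qed.

Lemma aff_inj : injective (@aff n).
Proof.
move=> a b /(congr1 (kact (cyc n))); rewrite /aff !kactVK => h.
by apply: (addIr (unitK ord0)).
Qed.

Lemma lpform_omega f g : is_lp f -> is_lp g -> B (omega f) (omega g) = B f g.
Proof.
apply: (@lpform_ext (@omega R n t) (@omega R n t) id id) => //;
  try by [move=> *; exact: omega_lin|move=> *; exact: is_lp_omega].
move=> a T b T'; rewrite !omega_zeta !lpform_zeta normsq_aff //.
by rewrite (inj_eq aff_inj).
Qed.

Lemma lpform_mulx e f g : is_lp f -> is_lp g -> B (mulx e f) (mulx e g) = B f g.
Proof.
have lx e' h : is_lp h -> is_lp (mulx e' h) := @is_lp_mulx R n t e' h.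
have la w h : is_lp h -> is_lp (act w h) by move=> ?; apply: is_lp_act.
elim/mulx_ind: e f g => [e e' he he'|e he|w e he|] f g hf hg.
- by rewrite -!mulxA he ?he' //; exact: lx.
- by rewrite -he ?mulxVK //; exact: lx.
- by rewrite !act_mulxE lpform_act ?he ?lpform_act //; [apply: la|apply: la|apply/lx/la|apply/lx/la].
- have e h : mulx (unitK ord0) h = act (cyc n)^-1%g (omega h) by rewrite omegaE actK.
  by rewrite !e lpform_act ?lpform_omega //; apply: is_lp_omega.
Qed.

Lemma lpform_coef a T g : is_lp g -> B (Z a T) g = coef g a T * (normsq kappa a T)%:C.
Proof.
move: g; apply: lp_zeta_ind => [|z f g hf hg IH IH'|b T'].
- have -> : coef 0 = 0.
    by apply: (@expands_uniq 0); [exact/coefP/is_lp0|have [c hc] := spanned0; rewrite {2}(_ : 0 = c) //; apply/esym/expands0].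
  by rewrite V0E mul0r lpform0r //; apply: is_lp_zeta.
- by rewrite coef_lin // lpDE lpZE VDE VZE mulrDl -mulrA -IH -IH' lpformDr //; apply: is_lp_zeta.
- rewrite lpform_zeta coef_zeta monoE; case: (a == b) => /=; last by rewrite V0E mul0r.
  by rewrite ffunE; case: eqP => _; rewrite ?mul1r ?mul0r.
Qed.

Lemma lpform_sumlD I (r : seq I) (G : I -> LP) h : (forall i, is_lp (G i)) -> is_lp h ->
  B (\sum_(i <- r) G i) h = \sum_(i <- r) B (G i) h.
Proof.
move=> hG hh; transitivity (B (\sum_(i <- r) 1 *: G i) h).
  by congr (B _ h); apply: eq_bigr => i _; rewrite scale1r.
by rewrite lpform_suml //; apply: eq_bigr => i _; rewrite rmorph1 mul1r.
Qed.

Lemma lpform_ge0 f : is_lp f -> 0 <= B f f.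
Proof.
move=> hf; have [_ [s0 fc]] := coefP hf.
rewrite {1}(fc (undup s0) (undup_uniq _) ltac:(by move=> k; rewrite mem_undup)).
have hZ a T : is_lp (Z a T) := is_lp_zeta a T.
rewrite lpform_sumlD //; last by move=> k; apply: is_lp_sum => T _; apply: is_lpZ.
apply: sumr_ge0 => k _; rewrite lpform_suml //; apply: sumr_ge0 => T _.
rewrite lpform_coef // mulrA mulrC mulr_ge0 //.
  by rewrite lecR ltW // normsq_gt0.
by rewrite mulrC mul_conjC_ge0.
Qed.

(* The homogeneous degree is self-adjoint, being diagonal on Jack polynomials. *)
Definition degop (f : LP) : LP := fun k => ((sumK k)%:~R : C) *: f k.

Lemma degop_zeta a T : degop (Z a T) = ((sumK a)%:~R : C) *: Z a T.
Proof.
apply: boolp.funext => k; rewrite lpZE /degop.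
have [->|ne] := eqVneq (Z a T k) 0; first by rewrite !scaler0.
have [->|] := jack_support tP n_gt0 kb (zetaP a T) ne; first by [].
by case/andP => /eqP ->.
Qed.

Lemma degop_mono a v : degop (mono a v) = ((sumK a)%:~R : C) *: mono a v.
Proof.
apply: boolp.funext => k; rewrite lpZE /degop monoE.
by have [->|_] := eqVneq k a; rewrite ?scaler0.
Qed.

Lemma is_lp_degop f : is_lp f -> is_lp (degop f).
Proof.
by move=> [s hs]; exists s => k h; apply: hs; move: h; rewrite /degop; apply: contra_neq => ->; rewrite scaler0.
Qed.

Lemma degop_lin z f g : degop (z *: f + g) = z *: degop f + degop g.
Proof.
by apply: boolp.funext => k; rewrite lpDE lpZE /degop lpDE lpZE scalerDr !scalerA mulrC.
Qed.

Lemma lpform_degree a b v v' : sumK a != sumK b -> B (mono a v) (mono b v') = 0.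
Proof.
move=> ab; have hm k u := is_lp_mono k u : is_lp (mono k u).
have scl z f g : is_lp f -> is_lp g -> B (z *: f) g = z^* * B f g.
  by move=> hf hg; rewrite -[_ *: f]addr0 lpformDl ?lpform0l ?addr0 //; apply: is_lp0.
have scr z f g : is_lp f -> is_lp g -> B f (z *: g) = z * B f g.
  by move=> hf hg; rewrite -[_ *: g]addr0 lpformDr ?lpform0r ?addr0 //; apply: is_lp0.
have : B (degop (mono a v)) (mono b v') = B (mono a v) (degop (mono b v')).
  apply: (@lpform_ext degop id id degop) => //;
    try by [move=> *; exact: degop_lin|move=> *; exact: is_lp_degop].
  move=> a' T b' T'; rewrite !degop_zeta scl ?scr ?lpform_zeta; try exact: is_lp_zeta.
  rewrite rmorph_int; have [->|] := eqVneq a' b' => //=; by rewrite !mulr0.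
rewrite !degop_mono scl // scr // rmorph_int => /eqP; rewrite -subr_eq0 -mulrBl mulf_eq0 -intrB intr_eq0.
by rewrite subr_eq0 (negPf ab) /= => /eqP.
Qed.

Lemma posK_negK (g : K) : posK g - negK g = g.
Proof.
clear tP n_gt0 kb; apply/ffunP => i; rewrite ffunE [X in _ + X]ffunE ffunE [X in _ - X]ffunE.
have h (x : int) : Order.max x 0 - Order.max (- x) 0 = x.
  by have [x0|x0] := leP x 0; [rewrite max_l|rewrite max_r]; lia.
exact: h.
Qed.

(** Invariance under multiplication by [x^(negK g)] merges the two exponents into [g]; for
    [sumK g != 0] the form vanishes by degree, in accordance with the value 0 of [Amat]. *)
Lemma AmatE (g : K) (T T' : Y) : Amat kappa g T T' =
  ((Num.sqrt (norm0 R T * norm0 R T'))^-1)%:C * B (mono g (bv T)) (mono 0 (bv T')).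
Proof.
have s0 : sumK (0 : K) = 0 by rewrite /sumK big1 // => i _; rewrite ffunE.
rewrite /Amat; case: eqP => [_|/eqP g0]; last by rewrite lpform_degree ?mulr0 // s0.
rewrite -[X in _ = _ * X](lpform_mulx (negK g)); try exact: is_lp_mono.
by rewrite !mulx_mono add0r -{3}(posK_negK g) subrK.
Qed.

End Form.

(** * Weak limits of discrete measures *)

Local Open Scope classical_set_scope.
Section UltraLimit.
Variable R : realType.

Lemma ultra_cvg (U : set_system nat) (s : nat -> R) (b : R) : UltraFilter U ->
  (forall n, `|s n| <= b) -> exists l : R, s @ U --> l.
Proof.
move=> UU sb.
have cpt := @segment_compact R (- b) b.
have [|l [_ cl]] := cpt (s @ U) _.
  by apply: (@filterE _ U) => n /=; have := sb n; rewrite ler_norml in_itv.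
exists l => A Al.
have [//|nA] := in_ultra_setVsetC (s @^-1` A) UU.
have [x [h1 h2]] := cl (~` A) A nA Al.
by case: (h1).
Qed.

End UltraLimit.

(** * Numbering of the dyadic boxes *)

Section Coding.
Variable I : finType.
Local Notation T := {ffun I -> bool}.
Local Notation B := #|{: T}|.

(* [code v L] encodes in base 2^|I| the dyadic box of level [L] containing a point of [0,1[^I
   whose coordinates are truncated to [v L l / 2^L]; [addr] decodes it. *)
Fixpoint code (v : nat -> I -> nat) (L : nat) : nat :=
  if L is L'.+1 then (code v L' * B + index [ffun l => odd (v L l)] (enum {: T}))%N else 0%N.

Fixpoint addr (L i : nat) : I -> nat :=
  if L is L'.+1 then
    fun l => ((addr L' (i %/ B) l).*2 + nth [ffun=> false] (enum {: T}) (i %% B) l)%N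
  else fun=> 0%N.

Lemma base_gt0 : (0 < B)%N.
Proof. by apply/card_gt0P; exists [ffun=> false]. Qed.

Lemma index_lt (x : T) : (index x (enum {: T}) < B)%N.
Proof. by rewrite cardE index_mem mem_enum. Qed.

Lemma code_div v L : (code v L.+1 %/ B = code v L)%N.
Proof. by rewrite /= divnMDl ?base_gt0 // divn_small ?addn0 // index_lt. Qed.

Lemma code_lt v L : (code v L < B ^ L)%N.
Proof. by elim: L => // L IH; rewrite expnS mulnC -ltn_divLR ?base_gt0 // code_div. Qed.

Lemma addr_code v L l : (forall l, v 0%N l = 0%N) -> (forall L l, v L l = (v L.+1 l)./2) ->
  addr L (code v L) l = v L l.
Proof.
move=> v0 vS; elim: L l => [|L IH] l; first by rewrite v0.
rewrite [LHS]/= -/(code v L.+1) code_div IH /= modnMDl modn_small ?index_lt //.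
by rewrite nth_index ?mem_enum // ffunE vS addnC odd_double_half.
Qed.

Lemma addr_lt L i l : (addr L i l < 2 ^ L)%N.
Proof.
elim: L i => // L IH i; rewrite expnS mul2n /=.
by have := IH (i %/ B)%N; move: (addr _ _ _) => a; case: (_ l) => /= h; lia.
Qed.

End Coding.

Section BoundedIntegral.
Context d (T : measurableType d) (R : realType) (mu : {measure set T -> \bar R}) (D : set T).
Hypothesis mD : measurable D.

Lemma bounded_integrable (f : T -> R) b : (mu D < +oo)%E -> measurable_fun D f ->
  (forall x, D x -> `|f x| <= b) -> mu.-integrable D (EFin \o f).
Proof.
move=> muD mf fb; apply: measurable_bounded_integrable => //.
exists b; split; first exact: num_real.
by move=> y yb x Dx; apply: le_trans (fb x Dx) (ltW yb).
Qed.

Lemma Rintegral_sum J (s : seq J) (F : J -> T -> R) :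
  (forall j, mu.-integrable D (EFin \o F j)) ->
  \int[mu]_(x in D) (\sum_(j <- s) F j x) = \sum_(j <- s) \int[mu]_(x in D) F j x.
Proof.
move=> hF; elim: s => [|j s IH].
  rewrite big_nil -[RHS](mul0r (fine (mu D))) -(Rintegral_cst mu mD).
  by apply: eq_Rintegral => x _; rewrite big_nil.
rewrite big_cons -IH -RintegralD //; last first.
  rewrite (_ : EFin \o _ = fun x => (\sum_(i <- s) (F i x)%:E)%E); first by apply: integrable_sum => // i _; apply: hF.
  by apply: funext => x /=; rewrite sumEFin.
by apply: eq_Rintegral => x _; rewrite big_cons.
Qed.

End BoundedIntegral.

(** * Step functions on an interval cut according to the masses *)

Section Intervals.
Variables (R : realType) (B : nat) (M : R) (mass : nat -> nat -> R).
Hypothesis B_gt0 : (0 < B)%N.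
Hypothesis mass_ge0 : forall L i, 0 <= mass L i.
Hypothesis mass_sum : forall L, \sum_(0 <= i < B ^ L) mass L i = M.
Hypothesis mass_split : forall L i, mass L i = \sum_(0 <= b < B) mass L.+1 (i * B + b)%N.

(* [0,M[ is cut at each level into intervals whose lengths are the masses of the boxes. *)
Definition cumul L i : R := \sum_(0 <= j < i) mass L j.

Lemma cumulS L i : cumul L i.+1 = cumul L i + mass L i.
Proof. by rewrite /cumul big_nat_recr. Qed.

Lemma cumul_mono L i j : (i <= j)%N -> cumul L i <= cumul L j.
Proof.
by move=> ij; rewrite /cumul (big_cat_nat (leq0n i) ij) lerDl; apply: sumr_ge0.
Qed.

Lemma cumul_refine L i : cumul L.+1 (i * B)%N = cumul L i.
Proof.
elim: i => [|i IH]; first by rewrite /cumul mul0n !big_nil.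
rewrite cumulS -IH /cumul mulSn addnC (big_cat_nat (leq0n (i * B)) (leq_addr B (i * B))) /=.
congr (_ + _); rewrite mass_split -{1}[(i * B)%N]add0n big_addn addKn.
by apply: eq_bigr => b _; rewrite addnC.
Qed.

Definition step L (f : nat -> R) (x : R) : R :=
  \sum_(0 <= i < B ^ L) f i * \1_(`[cumul L i, cumul L i.+1[) x.

Lemma step_cell L f x i : (i < B ^ L)%N -> cumul L i <= x < cumul L i.+1 -> step L f x = f i.
Proof.
move=> iL /andP[x1 x2]; rewrite /step (bigD1_seq i) ?mem_index_iota ?iota_uniq //=.
rewrite indicE mem_set /= ?in_itv /= ?x1 // mulr1 big1 ?addr0 // => j ji.
rewrite indicE memNset ?mulr0 //= in_itv /= => /andP[y1 y2].
case: (ltngtP i j) ji => // ij _.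
- by have := cumul_mono L ij; rewrite leNgt (le_lt_trans y1 x2).
- by have := cumul_mono L ij; rewrite leNgt (le_lt_trans x1 y2).
Qed.

Lemma cell_ex L x : 0 <= x < M -> exists i, (i < B ^ L)%N /\ cumul L i <= x < cumul L i.+1.
Proof.
move=> /andP[x0 xM].
have ex : exists i, x < cumul L i by exists (B ^ L)%N; rewrite /cumul mass_sum.
case: (ex_minnP ex) => [[|i]]; first by rewrite /cumul big_nil ltNge x0.
move=> xi imin; exists i; split; last first.
  by rewrite xi andbT leNgt; apply/negP => /imin; rewrite ltnn.
by apply: imin; rewrite /cumul mass_sum.
Qed.

Lemma step_out L f x : ~~ (0 <= x < M) -> step L f x = 0.
Proof.
move=> h; rewrite /step big_nat big1 // => i /andP[_ iL].
rewrite indicE memNset ?mulr0 //= in_itv /= => /andP[y1 y2]; case/negP: h; apply/andP; split.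
  by apply: le_trans y1; rewrite /cumul; apply: sumr_ge0.
by apply: (lt_le_trans y2); rewrite -(mass_sum L); apply: cumul_mono.
Qed.

Lemma cell_refine L x i : (i < B ^ L.+1)%N -> cumul L.+1 i <= x < cumul L.+1 i.+1 ->
  (i %/ B < B ^ L)%N /\ cumul L (i %/ B) <= x < cumul L (i %/ B).+1.
Proof.
move=> iL /andP[x1 x2]; split; first by rewrite ltn_divLR // mulnC -expnS.
apply/andP; split; rewrite -cumul_refine.
  by apply: le_trans x1; apply: cumul_mono; apply: leq_trunc_div.
by apply: (lt_le_trans x2); apply: cumul_mono; apply: ltn_ceil.
Qed.

Local Notation leb := (@lebesgue_measure R).
Local Notation dom0 := (`[0, M[ : set R).

Lemma leb_dom_fin : (leb dom0 < +oo)%E.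
Proof. by rewrite lebesgue_measure_itv /=; case: ifP => //; rewrite ltry. Qed.

Lemma leb_co (a b : R) : a <= b -> fine (leb `[a, b[) = b - a.
Proof.
move=> ab; rewrite lebesgue_measure_itv /= lte_fin; case: ltP => // ba.
by apply/esym/eqP; rewrite subr_eq0 eq_le ab ba.
Qed.

Lemma leb_dom : fine (leb dom0) = M.
Proof. by rewrite leb_co ?subr0 // -(mass_sum 0); apply: sumr_ge0. Qed.

Lemma measurable_step L f : measurable_fun [set: R] (step L f : R -> R).
Proof.
apply: measurable_sum => i; apply: measurable_funM; first exact: measurable_cst.
apply: measurable_indic; exact: measurable_itv.
Qed.

Lemma step_bound L f x : `|step L f x| <= \sum_(0 <= i < B ^ L) `|f i|.
Proof.
apply: le_trans (ler_norm_sum _ _ _) _; apply: ler_sum => i _.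
rewrite normrM ler_piMr // indicE; case: (_ \in _); rewrite ?normr1 ?normr0 //.
Qed.

Lemma leb_integrable (f : R -> R) b : measurable_fun [set: R] f -> (forall x, `|f x| <= b) ->
  leb.-integrable dom0 (EFin \o f).
Proof.
move=> mf fb; have mD : measurable dom0 by exact: measurable_itv.
apply: (@bounded_integrable _ (measurableTypeR R) R leb _ mD f b leb_dom_fin) => //.
exact: measurable_funS mf.
Qed.

Lemma integral_step L f :
  \int[leb]_(x in dom0) step L f x = \sum_(0 <= i < B ^ L) f i * mass L i.
Proof.
have mI i : measurable (`[cumul L i, cumul L i.+1[ : set R) by exact: measurable_itv.
have mD : measurable dom0 by exact: measurable_itv.
rewrite (@Rintegral_sum _ (measurableTypeR R) R leb _ mD _ _ (fun i x => f i * \1_(`[cumul L i, cumul L i.+1[) x)) => [|i]; last first.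
  apply: (@leb_integrable _ `|f i|).
    by apply: measurable_funM; [exact: measurable_cst|exact: measurable_indic].
  move=> x; rewrite normrM ler_piMr // indicE; case: (_ \in _); rewrite ?normr1 ?normr0 //.
rewrite big_nat [RHS]big_nat; apply: eq_bigr => i /andP[_ iL].
rewrite RintegralZl //; last first.
  apply: (@leb_integrable _ 1); first exact: measurable_indic.
  by move=> x; rewrite indicE; case: (_ \in _); rewrite ?normr1 ?normr0.
congr (_ * _); rewrite /Rintegral integral_indic // setIidl.
  by apply: etrans (leb_co (cumul_mono L (leqnSn i))) _; rewrite cumulS addrC addKr.
move=> x /=; rewrite !in_itv /= => /andP[y1 y2]; apply/andP; split.
  by apply: le_trans y1; rewrite /cumul; apply: sumr_ge0.
by apply: (lt_le_trans y2); rewrite -(mass_sum L); apply: cumul_mono.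
Qed.

Section Limit.
Variables (I : finType) (ad : nat -> nat -> I -> nat).
Hypothesis ad_lt : forall L i l, (ad L i l < 2 ^ L)%N.
Hypothesis ad_step : forall L i l, exists b : bool, ad L.+1 i l = ((ad L (i %/ B) l).*2 + b)%N.

Definition coord L i l : R := (ad L i l)%:R / 2 ^+ L.

Definition approx L l (x : R) : R := step L (fun i => coord L i l) x.

(** The cell of [x] at level [L.+1] lies in its cell at level [L], and passing to the smaller box
    appends one binary digit to each coordinate. *)
Lemma approx_step L l x : approx L l x <= approx L.+1 l x <= approx L l x + (2^-1) ^+ L.+1.
Proof.
rewrite /approx; have [h|h] := boolP (0 <= x < M); last first.
  by rewrite !step_out // lexx add0r exprn_ge0.
have [i [iL ci]] := cell_ex L.+1 h; have [iL' ci'] := cell_refine iL ci.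
rewrite (step_cell _ iL ci) (step_cell _ iL' ci') /coord.
have [b ->] := ad_step L i l.
have p0 : 0 < (2 : R) ^+ L by rewrite exprn_gt0.
have e : (2^-1) ^+ L.+1 = 2^-1 / 2 ^+ L :> R by rewrite exprS exprVn.
have -> : ((ad L (i %/ B) l).*2 + b)%:R / 2 ^+ L.+1 = (ad L (i %/ B) l)%:R / 2 ^+ L + b%:R * (2^-1) ^+ L.+1 :> R.
  rewrite e exprS natrD -mul2n natrM; field; exact: lt0r_neq0.
rewrite lerDl lerD2l; case: b; rewrite ?mul1r ?mul0r ?lexx ?andbT ?exprn_ge0 //.
Qed.

Definition limcoord (x : R) (l : I) : R := lim (approx L l x @[L --> \oo]).

Lemma limcoord_cvg x l : approx L l x @[L --> \oo] --> limcoord x l.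
Proof.
have nd : {homo (fun L => approx L l x) : L L' / (L <= L')%N >-> L <= L'}.
  by apply: homo_leq => //; [exact: le_trans|move=> L; case/andP: (approx_step L l x)].
apply: nondecreasing_is_cvgn nd _; exists 1 => _ [L _ <-]; rewrite /approx.
have [h|h] := boolP (0 <= x < M); last by rewrite step_out.
have [i [iL ci]] := cell_ex L h; rewrite (step_cell _ iL ci) /coord.
rewrite ler_pdivrMr ?exprn_gt0 // mul1r -natrX ler_nat; exact/ltnW/ad_lt.
Qed.

Lemma limcoord_close L x l : `|limcoord x l - approx L l x| <= (2^-1) ^+ L.
Proof.
have nd : {homo (fun L => approx L l x) : L L' / (L <= L')%N >-> L <= L'}.
  by apply: homo_leq => //; [exact: le_trans|move=> L'; case/andP: (approx_step L' l x)].
(* The subtracted term keeps the exact sum of the geometric increments, so that the induction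
   closes. *)
have ub k : approx (L + k) l x <= approx L l x + (2^-1) ^+ L - (2^-1) ^+ (L + k).
  elim: k => [|k IH]; first by rewrite addn0 addrK.
  have /andP[_ h] := approx_step (L + k) l x.
  rewrite addnS; apply: le_trans h _; apply: le_trans (lerD IH (lexx _)) _.
  rewrite exprS; set y := _ ^+ (L + k); lra.
have cv := @limcoord_cvg x l.
rewrite ger0_norm; last by rewrite subr_ge0; apply: nondecreasing_cvgn_le => //; apply/cvg_ex; exists (limcoord x l).
rewrite lerBlDl; apply: (@limr_le nat \oo _ _ _ (fun L' => approx L' l x)); first by apply/cvg_ex; exists (limcoord x l).
near=> L'; have LL' : (L <= L')%N by near: L'; exists L.
rewrite -(subnKC LL'); apply: le_trans (ub _) _; rewrite lerBlDr lerDl exprn_ge0 //.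
Unshelve. all: by end_near. Qed.

Lemma measurable_limcoord l : measurable_fun [set: R] (limcoord ^~ l : R -> R).
Proof.
apply: (@measurable_fun_cvg _ _ _ _ (fun L => approx L l)) => [L|x _]; first exact: measurable_step.
exact: limcoord_cvg.
Qed.

End Limit.
End Intervals.

(** * The limit point of the discrete measures *)

Section Limit.
Variables (R : realType) (I : finType) (m : nat -> nat).
Hypothesis m_gt0 : forall n, (0 < m n)%N.
Local Notation J n := {ffun I -> 'I_(m n)}.
Variables (w : forall n, J n -> R) (M : R).
Hypothesis w_ge0 : forall n j, 0 <= @w n j.
Hypothesis w_sum : forall n, \sum_j @w n j = M.
Local Notation B := #|{: {ffun I -> bool}}|.

(** The first [L] binary digits of the coordinate [j l / m n] of a grid point. *)
Definition grid n (j : J n) L (l : I) : nat := ((2 ^ L * j l) %/ m n)%N.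

Lemma grid0 n (j : J n) l : grid j 0 l = 0%N.
Proof. by rewrite /grid mul1n divn_small. Qed.

Lemma gridS n (j : J n) L l : grid j L l = ((grid j L.+1 l)./2)%N.
Proof. by rewrite /grid -divn2 -divnMA expnS -mulnA [(m n * 2)%N]mulnC divnMl. Qed.

Lemma grid_close n (j : J n) L l :
  `|(grid j L l)%:R / 2 ^+ L - (j l)%:R / (m n)%:R| <= (2^-1 : R) ^+ L.
Proof.
have p0 : 0 < (2 : R) ^+ L by rewrite exprn_gt0.
have m0 : 0 < (m n)%:R :> R by rewrite ltr0n.
have h1 : (grid j L l)%:R * (m n)%:R <= 2 ^+ L * (j l)%:R :> R.
  by rewrite -natrX -!natrM ler_nat leq_trunc_div.
have h2 : 2 ^+ L * (j l)%:R <= ((grid j L l)%:R + 1) * (m n)%:R :> R.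
  by rewrite -natrX -natrM -[1]/(1%:R) -natrD -natrM ler_nat addn1 ltnW // ltn_ceil.
rewrite exprVn distrC; move: h1 h2 p0 m0.
move: (grid j L l)%:R (j l)%:R (m n)%:R (2 ^+ L) => g a q p h1 h2 p0 q0.
have -> : a / q - g / p = (p * a - g * q) / q / p by field; rewrite !lt0r_neq0.
rewrite ger0_norm; last by rewrite !divr_ge0 ?(ltW q0) ?(ltW p0) // subr_ge0.
by rewrite ler_pdivrMr // mulVf ?lt0r_neq0 // ler_pdivrMr // mul1r; move: h2; rewrite mulrDl mul1r; lra.
Qed.

Definition cellmass n L i : R := \sum_(j : J n | code (grid j) L == i) w j.

Lemma cellmass_ge0 n L i : 0 <= cellmass n L i.
Proof. exact: sumr_ge0. Qed.

Lemma sum_cellmass n L (f : nat -> R) :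
  \sum_(0 <= i < B ^ L) f i * cellmass n L i = \sum_(j : J n) f (code (grid j) L) * w j.
Proof.
rewrite big_mkord; pose c (j : J n) := Ordinal (code_lt (grid j) L).
rewrite [RHS](partition_big c predT) //=; apply: eq_bigr => i _.
rewrite mulr_sumr; apply: eq_big => [j|j /eqP ->] //.
Qed.

Lemma cellmass_le n L i : cellmass n L i <= M.
Proof. by rewrite -(w_sum n) [leRHS](bigID (fun j => code (grid j) L == i)) /= lerDl sumr_ge0. Qed.

Lemma cellmass_split n L i : cellmass n L i = \sum_(0 <= b < B) cellmass n L.+1 (i * B + b)%N.
Proof.
rewrite big_mkord; pose c (j : J n) : 'I_B := Ordinal (index_lt [ffun l => odd (grid j L.+1 l)]).
rewrite /cellmass [LHS](partition_big c predT) //=; apply: eq_bigr => b _.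
apply: eq_bigl => j; rewrite -val_eqE /=.
have ix := index_lt [ffun l => odd (grid j L.+1 l)].
apply/andP/eqP => [[/eqP -> /eqP ->] //|e].
have := congr1 (divn^~ B) e; rewrite !divnMDl ?base_gt0 // !divn_small ?addn0 //.
by move=> e1; split; apply/eqP => //; move: e; rewrite e1 => /addnI.
Qed.

(* A weak limit point of the discrete measures [sum_j w j delta_(j/m)]: the masses of the dyadic
   boxes converge along an ultrafilter, and the limit measure is the image of Lebesgue measure
   on [0,M[ under the map sending a point to the limit of the boxes whose intervals contain it. *)
Theorem weak_limit : exists D : R -> I -> R,
  (forall l, measurable_fun [set: R] (D ^~ l : R -> R)) /\
  forall (F : (I -> R) -> R) b alpha,
    (forall e, 0 < e -> exists2 d, 0 < d & forall x y, (forall l, `|x l - y l| <= d) -> `|F x - F y| <= e) ->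
    (forall x, `|F x| <= b) -> measurable_fun [set: R] (F \o D) ->
    (\sum_(j : J n) F (fun l => (j l)%:R / (m n)%:R) * w j) @[n --> \oo] --> alpha ->
    \int[@lebesgue_measure R]_(x in `[0, M[) F (D x) = alpha.
Proof.
(* Along an ultrafilter all box masses, being bounded, converge at once without extraction of
   subsequences; as it refines [\oo], the assumed limits persist. *)
have [U [UU Uoo]] := ultraFilterLemma (eventually_filter : ProperFilter (\oo : set_system nat)).
have cv L i : exists l : R, cellmass n L i @[n --> U] --> l.
  apply: (@ultra_cvg R U (fun n => cellmass n L i) M UU) => n.
  by rewrite ger0_norm ?cellmass_ge0 // cellmass_le.
pose mass L i : R := projT1 (cid (cv L i)).
have massP L i : cellmass n L i @[n --> U] --> mass L i := projT2 (cid (cv L i)).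
have Ucst (a : R) : (fun _ : nat => a) @ U --> a by exact: cvg_cst.
have Usum J0 (s : seq J0) (g : J0 -> nat -> R) (h : J0 -> R) :
    (forall j, g j n @[n --> U] --> h j) -> (\sum_(j <- s) g j n) @[n --> U] --> \sum_(j <- s) h j.
  move=> gh; elim: s => [|j s IH].
    by under eq_fun do rewrite big_nil; rewrite big_nil; exact: Ucst.
  by under eq_fun do rewrite big_cons; rewrite big_cons; apply: cvgD.
have Uuniq (s : nat -> R) (a b : R) : s @ U --> a -> s @ U --> b -> a = b.
  by move=> h1 h2; apply: (cvg_unique _ h1 h2); exact: Rhausdorff.
have Ule (s s' : nat -> R) (a b : R) : s @ U --> a -> s' @ U --> b -> (forall n, s n <= s' n) -> a <= b.
  move=> h1 h2 le; apply: (ler_cvg_to h1 h2); exact: filterE.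
have mass_ge0 L i : 0 <= mass L i.
  by apply: Ule (Ucst 0) (massP L i) _ => n; apply: cellmass_ge0.
have Ustep L (f : nat -> R) : (\sum_(j : J n) f (code (grid j) L) * w j) @[n --> U] -->
    \sum_(0 <= i < B ^ L) f i * mass L i.
  under eq_fun do rewrite -sum_cellmass.
  by apply: Usum => i; apply: cvgM; [exact: Ucst|exact: massP].
have mass_sum L : \sum_(0 <= i < B ^ L) mass L i = M.
  have := Ustep L (fun=> 1); under eq_fun do (under eq_bigr do rewrite mul1r; rewrite w_sum).
  by under eq_bigr do rewrite mul1r; move=> h; apply: Uuniq h (Ucst M).
have mass_split L i : mass L i = \sum_(0 <= b < B) mass L.+1 (i * B + b)%N.
  apply: Uuniq (massP L i) _; under eq_fun do rewrite cellmass_split.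
  by apply: Usum => b; apply: massP.
have ad_step L i (l : I) : exists b : bool, addr L.+1 i l = ((addr L (i %/ B) l).*2 + b)%N.
  by eexists.
pose D := limcoord B mass (@addr I).
exists D; split => [l|F b alpha UC Fb mF cvF].
  exact: (measurable_limcoord (base_gt0 I) mass_ge0 mass_sum mass_split (@addr_lt I) ad_step).
have M0 : 0 <= M by rewrite -(mass_sum 0%N); apply: sumr_ge0.
have close e : 0 < e -> `|\int[@lebesgue_measure R]_(x in `[0, M[) F (D x) - alpha| <= e * M + e * M.
  move=> e0; have [d d0 hd] := UC e e0.
  (* A level whose boxes are finer than the modulus [d] for [e]. The sum [S] over its boxes is
     within [e * M] both of the limit of the discrete sums and of the integral. *)
  have [L hL] : exists L, (2^-1 : R) ^+ L <= d.
    have /cvgrPdist_le /(_ d d0) [L _ hL] := @cvg_expr R (2^-1) ltac:(by rewrite ger0_norm; lra).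
    by exists L; have := hL L (leqnn L); rewrite /= sub0r normrN ger0_norm // exprn_ge0.
  pose f i := F (fun l => coord R (@addr I) L i l).
  pose S := \sum_(0 <= i < B ^ L) f i * mass L i.
  have h1 : `|S - alpha| <= e * M.
    have cF : (\sum_(j : J n) F (fun l => (j l)%:R / (m n)%:R) * w j) @[n --> U] --> alpha.
      exact: (cvg_trans (cvg_app _ Uoo) cvF).
    have cd : `|\sum_(j : J n) f (code (grid j) L) * w j -
        \sum_(j : J n) F (fun l => (j l)%:R / (m n)%:R) * w j| @[n --> U] --> `|S - alpha|.
      exact: cvg_norm (cvgB (Ustep L f) cF).
    apply: Ule cd (Ucst (e * M)) _ => n.
    rewrite -[X in _ <= _ * X](w_sum n) mulr_sumr -sumrB; apply: le_trans (ler_norm_sum _ _ _) _.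
    apply: ler_sum => j _; rewrite -mulrBl normrM (ger0_norm (w_ge0 j)); apply: ler_wpM2r => //.
    apply: hd => l; rewrite /coord addr_code; [|exact: grid0|exact: gridS].
    exact: le_trans (grid_close _ _ _) hL.
  have h2 : `|\int[@lebesgue_measure R]_(x in `[0, M[) F (D x) - S| <= e * M.
    have iF : lebesgue_measure.-integrable `[0, M[ (EFin \o (F \o D)).
      exact: (leb_integrable M mF (fun x => Fb (D x))).
    have iS := leb_integrable M (measurable_step B mass L f) (step_bound B mass L f).
    have mG : measurable_fun [set: R] ((fun x => F (D x) - step B mass L f x) : R -> R).
      by apply: measurable_funB => //; apply: measurable_step.
    have iG : lebesgue_measure.-integrable `[0, M[ (EFin \o ((fun x => F (D x) - step B mass L f x) : R -> R)).
      apply: (leb_integrable M (b := b + \sum_(0 <= i < B ^ L) `|f i|)) => // x.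
      exact: le_trans (ler_normB _ _) (lerD (Fb _) (step_bound _ _ _ _ _)).
    have iN : lebesgue_measure.-integrable `[0, M[ (EFin \o ((fun x => `|F (D x) - step B mass L f x|) : R -> R)).
      apply: (leb_integrable M (b := b + \sum_(0 <= i < B ^ L) `|f i|)) => [|x].
        exact: measurableT_comp.
      rewrite normr_id; exact: le_trans (ler_normB _ _) (lerD (Fb _) (step_bound _ _ _ _ _)).
    have iE : lebesgue_measure.-integrable `[0, M[ (EFin \o ((fun=> e) : R -> R)).
      by apply: (leb_integrable M (b := `|e|)).
    have mD : measurable (`[0, M[ : set (measurableTypeR R)) by exact: measurable_itv.
    rewrite /S -(integral_step mass_ge0 mass_sum) -(@RintegralB _ (measurableTypeR R)) //.
    have eM : e * M = \int[@lebesgue_measure R]_(x in `[0, M[) e.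
      by rewrite (@Rintegral_cst _ (measurableTypeR R)) // (leb_dom mass_ge0 mass_sum).
    rewrite eM; apply: le_trans (@le_normr_Rintegral _ (measurableTypeR R) _ _ _ _ mD _) _.
      exact: iG.
    apply: (@le_Rintegral _ (measurableTypeR R)) => //.
    move=> x /=; rewrite in_itv /= => xM.
    have [i [iL ci]] := cell_ex mass_sum L xM.
    rewrite (step_cell mass_ge0 _ iL ci); apply: hd => l.
    apply: le_trans hL; have := limcoord_close (base_gt0 I) mass_ge0 mass_sum mass_split (@addr_lt I) ad_step L x l.
    by rewrite /approx (step_cell mass_ge0 _ iL ci).
  by rewrite -(subrK S (\int[_]_(x in _) _)) -addrA; apply: le_trans (ler_normD _ _) (lerD h2 h1).
apply/eqP; rewrite -subr_eq0 -normr_le0; apply/ler_addgt0Pr => e e0; rewrite add0r.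
(* The added 1 covers the case of total mass [M = 0]. *)
have e1 : 0 < e / (M + M + 1) by rewrite divr_gt0 //; lra.
apply: le_trans (close _ e1) _; rewrite -mulrDr mulrAC ler_pdivrMr; last lra.
by rewrite ler_pM2l //; lra.
Qed.
End Limit.

(** * Fourier analysis on finite grids *)

Section Circle.
Variable R : realType.
Local Notation C := R[i].

Definition circ (x : R) : C := cos (pi *+ 2 * x) +i* sin (pi *+ 2 * x).

Lemma circD x y : circ (x + y) = circ x * circ y.
Proof. by rewrite /circ mulrDr cosD sinD; apply/eqP; rewrite eq_complex /= addrC [X in _ && (X == _)]addrC !eqxx. Qed.

Lemma circ0 : circ 0 = 1.
Proof. by rewrite /circ mulr0 cos0 sin0. Qed.

Lemma circ1 : circ 1 = 1.
Proof. by rewrite /circ mulr1 cos2pi sin2pi. Qed.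

Lemma circN_mul x : circ (- x) * circ x = 1.
Proof. by rewrite -circD addNr circ0. Qed.

Lemma circ_neq0 x : circ x != 0.
Proof. by apply/eqP => h; have := circN_mul x; rewrite h mulr0 => /eqP; rewrite eq_sym oner_eq0. Qed.

Lemma circN x : circ (- x) = (circ x)^-1.
Proof. by apply: (mulIf (circ_neq0 x)); rewrite circN_mul mulVf ?circ_neq0. Qed.

Lemma conj_circ x : ((circ x)^*)%R = circ (- x).
Proof. by rewrite /circ mulrN cosN sinN. Qed.

Lemma norm_circ x : `|circ x| = 1.
Proof.
by rewrite normc_def /circ /= cos2Dsin2 sqrtr1.
Qed.

Lemma circ_sum I (r : seq I) (f : I -> R) : circ (\sum_(i <- r) f i) = \prod_(i <- r) circ (f i).
Proof. by elim/big_rec2: _ => [|i y1 y2 _ <-]; rewrite ?circ0 ?circD. Qed.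

Lemma circX x n : circ (x *+ n) = circ x ^+ n.
Proof. by elim: n => [|n IH]; rewrite ?mulr0n ?circ0 // mulrS circD IH exprS. Qed.

Lemma circXz x (k : int) : circ x ^ k = circ (k%:~R * x).
Proof.
case: k => n; first by rewrite -exprnP -circX -mulr_natl.
by rewrite NegzE -exprnN -circX -circN -mulr_natl mulrNz mulNr.
Qed.

Lemma circ_int (k : int) : circ k%:~R = 1.
Proof. by rewrite -[k%:~R]mulr1 -circXz circ1 exp1rz. Qed.

(** The real part is [1 - 2 sin(pi x)^2], and [sin(pi x) > 0]. *)
Lemma circ_neq1 x : 0 < x < 1 -> circ x != 1.
Proof.
move=> /andP[x0 x1]; apply/eqP => h.
have : complex.Re (circ x) = 1 by rewrite h.
have -> : complex.Re (circ x) = cos (pi * x) * cos (pi * x) - sin (pi * x) * sin (pi * x).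
  by rewrite -cosD /circ /=; congr cos; ring.
move=> hc.
have s0 : 0 < sin (pi * x).
  by apply: sin_gt0_pi; rewrite mulr_gt0 ?pi_gt0 //= -[ltRHS]mulr1 ltr_pM2l ?pi_gt0.
have := cos2Dsin2 (pi * x); move: hc s0; move: (sin _) (cos _) => s c; nra.
Qed.

Lemma circ_frac (m : nat) (s : int) : (0 < m)%N -> ~~ (m %| s)%Z -> circ (s%:~R / m%:R) != 1.
Proof.
move=> m0 ms; rewrite {1}(divz_eq s m) intrD intrM mulrDl mulfK ?pnatr_eq0 -?lt0n //.
rewrite circD circ_int mul1r; apply: circ_neq1.
have r0 : (0 <= s %% m)%Z by rewrite modz_ge0 // -lt0n.
have rm : (s %% m < m)%Z by rewrite ltz_pmod.
have rn : (s %% m)%Z != 0 by apply: contra ms => /eqP; rewrite /dvdz => h; apply/dvdz_mod0P.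
have mR : 0 < m%:R :> R by rewrite ltr0n.
rewrite ltr_pdivlMr // mul0r ltr_pdivrMr // mul1r ltr0z lt_neqAle eq_sym rn r0 /=.
by rewrite -[m%:R]/(m%:Z%:~R) ltr_int.
Qed.

Lemma circ_geom (m : nat) (s : int) : (0 < m)%N ->
  \sum_(j < m) circ (s%:~R * (j%:R / m%:R)) = if (m %| s)%Z then m%:R else 0.
Proof.
move=> m0; have mR : m%:R != 0 :> R by rewrite pnatr_eq0 -lt0n.
have e (j : 'I_m) : circ (s%:~R * (j%:R / m%:R)) = circ (s%:~R / m%:R) ^+ j.
  by rewrite -circX -mulr_natr; congr circ; field.
under eq_bigr do rewrite e.
have zm : circ (s%:~R / m%:R) ^+ m = 1
    by rewrite -circX -(circ_int s); congr circ; field.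
case: ifP => [/dvdzP[q ->]|/negbT ms].
  have -> : circ ((q * m)%:~R / m%:R) = 1 by rewrite intrM mulfK // circ_int.
  by under eq_bigr do rewrite expr1n; rewrite sumr_const card_ord.
apply: (mulfI (_ : circ (s%:~R / m%:R) - 1 != 0)); first by rewrite subr_eq0 circ_frac.
by rewrite -subrX1 zm subrr mulr0.
Qed.

(* Uniform continuity follows from continuity at 0 by the addition formulas. *)
Lemma circ_unif (e : R) : 0 < e -> exists2 d, 0 < d & forall x y, `|x - y| <= d ->
  `|complex.Re (circ x) - complex.Re (circ y)| <= e /\
  `|complex.Im (circ x) - complex.Im (circ y)| <= e.
Proof.
move=> e0; have e20 : 0 < e / 2 by lra.
have twopi : 0 < pi *+ 2 :> R by rewrite mulrn_wgt0 // pi_gt0.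
have [d1 d10 h1] : exists2 d, 0 < d & forall h : R, `|h| < d -> `|cos h - 1| <= e / 2.
  have /cvgrPdist_le /(_ _ e20) [d d0 hd] := @continuous_cos R 0.
  exists d => // h hh; have := hd h; rewrite /= sub0r normrN cos0 distrC; exact.
have [d2 d20 h2] : exists2 d, 0 < d & forall h : R, `|h| < d -> `|sin h| <= e / 2.
  have /cvgrPdist_le /(_ _ e20) [d d0 hd] := @continuous_sin R 0.
  exists d => // h hh; have := hd h; rewrite /= !sub0r normrN sin0 sub0r normrN; exact.
(* Division by [2 pi] converts a distance into an angle; the final half makes the inequality
   strict. *)
exists (Num.min d1 d2 / (pi *+ 2) / 2); first by rewrite !divr_gt0 // lt_min d10 d20.
move=> x y xy; pose h := pi *+ 2 * (x - y).
have [hd1 hd2] : `|h| < d1 /\ `|h| < d2.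
  suff : `|h| < Num.min d1 d2 by rewrite lt_min => /andP.
  rewrite /h normrM gtr0_norm //; have m0 : 0 < Num.min d1 d2 by rewrite lt_min d10 d20.
  have : pi *+ 2 * `|x - y| <= pi *+ 2 * (Num.min d1 d2 / (pi *+ 2) / 2) by rewrite ler_pM2l.
  have -> : pi *+ 2 * (Num.min d1 d2 / (pi *+ 2) / 2) = Num.min d1 d2 / 2.
    by rewrite mulrA mulrCA mulfV ?mulr1 // lt0r_neq0.
  lra.
have c1 := h1 h hd1; have s1 := h2 h hd2.
have e1 : pi *+ 2 * x = pi *+ 2 * y + h by rewrite /h; ring.
rewrite /circ /= e1 cosD sinD; move: (pi *+ 2 * y) => u.
have [cu su] : `|cos u| <= 1 /\ `|sin u| <= 1.
  by rewrite !ler_norml cos_geN1 cos_le1 sin_geN1 sin_le1.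
have b (p q : R) : `|p| <= 1 -> `|q| <= 1 -> `|p * (cos h - 1)| + `|q * sin h| <= e.
  move=> p1 q1; rewrite !normrM.
  have := ler_wpM2r (normr_ge0 (cos h - 1)) p1; have := ler_wpM2r (normr_ge0 (sin h)) q1; lra.
split.
  have -> : cos u * cos h - sin u * sin h - cos u = cos u * (cos h - 1) - sin u * sin h by ring.
  exact: le_trans (ler_normB _ _) (b _ _ cu su).
have -> : sin u * cos h + cos u * sin h - sin u = sin u * (cos h - 1) + cos u * sin h by ring.
exact: le_trans (ler_normD _ _) (b _ _ su cu).
Qed.

End Circle.

(** * The Herglotz-Bochner theorem on [Z^N] *)

Section Herglotz.
Variables (R : realType) (N : nat) (a : K N -> R[i]).
Local Notation C := R[i].
Local Notation K := (K N).
Hypothesis a_pos : forall (s : seq K) (c : K -> C),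
  0 <= \sum_(k <- s) \sum_(k' <- s) (c k)^*%R * c k' * a (k - k').

Definition phase (g : K) (x : 'I_N -> R) : R := \sum_(l < N) (g l)%:~R * x l.

Lemma phaseD g h x : phase (g + h) x = phase g x + phase h x.
Proof. by rewrite /phase -big_split; apply: eq_bigr => l _; rewrite ffunE intrD mulrDl. Qed.

Lemma phaseN g x : phase (- g) x = - phase g x.
Proof. by rewrite /phase -sumrN; apply: eq_bigr => l _; rewrite ffunE intrN mulNr. Qed.

Section Level.
Variable P : nat.
Hypothesis P_gt0 : (0 < P)%N.
Local Notation m := (2 * P)%N.
Local Notation Q := {ffun 'I_N -> 'I_P}.
Local Notation J := {ffun 'I_N -> 'I_m}.

Definition freq (k : Q) : K := [ffun l => (k l : nat)%:Z].
Definition pt (j : J) (l : 'I_N) : R := (j l)%:R / m%:R.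

(* Values on the grid of a nonnegative Fejer mean of [sum_g a(g) x^g]. The modulus [2 * P] is
   large enough to avoid aliasing, by orthogonality of characters of (Z/2P)^N. *)
Definition weightC (j : J) : C :=
  (\sum_(k : Q) \sum_(k' : Q) circ (phase (freq k - freq k') (pt j)) * a (freq k - freq k'))
  / (m%:R ^+ N * P%:R ^+ N).

Lemma weightC_ge0 j : 0 <= weightC j.
Proof.
rewrite divr_ge0 ?mulr_ge0 ?exprn_ge0 ?ler0n //.
have := a_pos [seq freq k | k : Q] (fun k => circ (- phase k (pt j))).
rewrite big_image /=; under eq_bigr do rewrite big_image /=.
congr (0 <= _); apply: eq_bigr => k _; apply: eq_bigr => k' _.
by rewrite [((circ _)^*)%R]conj_circ opprK -circD phaseD phaseN.
Qed.

Lemma dvdz_small (s : int) : (`|s| < m)%N -> (m %| s)%Z = (s == 0).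
Proof.
move=> sm; apply/idP/eqP => [|->]; last exact: dvdz0.
rewrite dvdzE /= => /dvdn_leq h; apply/eqP; rewrite -absz_eq0 -leqn0 leqNgt; apply/negP => /h.
by rewrite leqNgt sm.
Qed.

(** These are the triangular coefficients of the Fejer kernel in one variable. *)
Lemma count_diff (g : int) : (`|g| <= P)%N ->
  (\sum_(k < P) \sum_(k' < P) ((k : nat)%:Z - (k' : nat)%:Z == g)%R = P - `|g|)%N.
Proof.
move=> gP.
have H d (h : 'I_P -> 'I_P -> bool) : (d <= P)%N -> (forall k k' : 'I_P, h k k' = (k == k' + d :> nat)%N) ->
    (\sum_(k' < P) \sum_(k < P) h k k' = P - d)%N.
  move=> dP hh.
  transitivity (\sum_(k' < P) (k' + d < P)%N : nat).
    apply: eq_bigr => k' _; under eq_bigr do rewrite hh.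
    case: ltnP => lt; last by rewrite big1 // => k _; apply/eqP; rewrite eqb0; have := ltn_ord k; lia.
    rewrite (bigD1 (Ordinal lt)) //= eqxx big1 // => k kk.
    by apply/eqP; rewrite eqb0; move: kk; rewrite -val_eqE.
  rewrite -(big_mkord xpredT (fun k' => (k' + d < P)%N : nat)).
  rewrite (big_cat_nat (leq0n (P - d)) (leq_subr d P)) /= [X in (_ + X)%N]big_nat_cond.
  rewrite [X in (_ + X)%N]big1 ?addn0; last first.
    by move=> i /andP[/andP[h1 h2] _]; apply/eqP; rewrite eqb0; clear -h1 h2 dP; lia.
  rewrite big_nat (eq_bigr (fun=> 1%N)) => [|i /andP[_ ip]]; last by apply/eqP; rewrite eqb1; clear -ip; lia.
  by rewrite -big_nat sum_nat_const_nat subn0 muln1.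
have [g0|g0] := leP 0 g.
  rewrite exchange_big /=; apply: (H `|g|%N (fun k k' => (k : nat)%:Z - (k' : nat)%:Z == g)%R gP) => k k'; lia.
apply: (H `|g|%N (fun k k' => (k' : nat)%:Z - (k : nat)%:Z == g)%R gP) => k k'; lia.
Qed.

Lemma weight_moment (g : K) : (forall l, (`|g l| <= P)%N) ->
  \sum_(j : J) weightC j * circ (- phase g (pt j)) =
  a g * \prod_(l < N) ((P - `|g l|)%:R / P%:R).
Proof.
move=> gP; have P0 : P%:R != 0 :> C by rewrite pnatr_eq0 -lt0n.
have m0 : (0 < m)%N by rewrite muln_gt0.
have mC : m%:R != 0 :> C by rewrite pnatr_eq0 -lt0n.
have charsum (s : K) : (forall l, (`|s l| < m)%N) ->
    \sum_(j : J) circ (phase s (pt j)) = m%:R ^+ N * (s == 0)%:R.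
  move=> sm; transitivity (\prod_(l < N) \sum_(i < m) circ ((s l)%:~R * (i%:R / m%:R)) : C).
    by rewrite bigA_distr_bigA /=; apply: eq_bigr => j _; rewrite /phase circ_sum.
  under eq_bigr => l _ do rewrite circ_geom // dvdz_small //.
  have [->|sn] := eqVneq s 0.
    by under eq_bigr do rewrite ffunE eqxx; rewrite prodr_const card_ord mulr1.
  have [l sl] : exists l, s l != 0.
    apply/existsP; apply: contraNT sn; rewrite negb_exists => /forallP h.
    by apply/eqP/ffunP => l; rewrite ffunE; apply/eqP; have := h l; rewrite negbK.
  by rewrite (bigD1 l) //= (negPf sl) mul0r mulr0.
have sumj (k k' : Q) : \sum_(j : J) circ (phase (freq k - freq k') (pt j)) * a (freq k - freq k')
      * circ (- phase g (pt j)) = m%:R ^+ N * (a g * (freq k - freq k' == g)%:R).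
  transitivity (a (freq k - freq k') * \sum_(j : J) circ (phase (freq k - freq k' - g) (pt j))).
    rewrite mulr_sumr; apply: eq_bigr => j _.
    by rewrite [in RHS]phaseD phaseN circD; ring.
  (* Since [|k - k'| < P] and [|g| <= P] in each coordinate, the frequency is below [2 P] in
     absolute value. *)
  rewrite charsum; last first.
    move=> l; have -> : (freq k - freq k' - g) l = (k l : nat)%:Z - (k' l : nat)%:Z - g l.
      by rewrite !ffunE.
    have := gP l; have := ltn_ord (k l); have := ltn_ord (k' l).
    by move: (g l) (nat_of_ord (k l)) (nat_of_ord (k' l)) => x y z; lia.
  rewrite subr_eq0; case: eqP => [->|_]; rewrite ?mulr1 ?mulr0 //; ring.
transitivity ((\sum_(k : Q) \sum_(k' : Q) m%:R ^+ N * (a g * (freq k - freq k' == g)%:R)) / (m%:R ^+ N * P%:R ^+ N)).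
  rewrite mulr_suml; under eq_bigr do rewrite /weightC mulrAC mulr_suml mulr_suml.
  rewrite exchange_big /=; apply: eq_bigr => k _.
  under eq_bigr do rewrite mulr_suml mulr_suml.
  rewrite exchange_big /= mulr_suml; apply: eq_bigr => k' _.
  by rewrite -sumj mulr_suml.
have cnt : \sum_(k : Q) \sum_(k' : Q) ((freq k - freq k' == g)%:R : C) = \prod_(l < N) (P - `|g l|)%:R.
  transitivity (\sum_(k : Q) \sum_(k' : Q) \prod_(l < N) (((k l : nat)%:Z - (k' l : nat)%:Z == g l)%:R : C)).
    apply: eq_bigr => k _; apply: eq_bigr => k' _; case: eqP => [<-|ne].
      by rewrite big1 // => l _; rewrite !ffunE eqxx.
    have [l hl] : exists l, (k l : nat)%:Z - (k' l : nat)%:Z != g l.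
      apply/existsP; apply: contra_notT ne; rewrite negb_exists => /forallP h.
      by apply/ffunP => l; rewrite !ffunE; apply/eqP; have := h l; rewrite negbK.
    by rewrite (bigD1 l) //= (negPf hl) mul0r.
  transitivity (\sum_(k : Q) \prod_(l < N) \sum_(i < P) (((k l : nat)%:Z - (i : nat)%:Z == g l)%:R : C)).
    by apply: eq_bigr => k _; rewrite bigA_distr_bigA.
  rewrite -(bigA_distr_bigA (fun l (k : 'I_P) => \sum_(i < P) (((k : nat)%:Z - (i : nat)%:Z == g l)%:R : C))).
  apply: eq_bigr => l _; rewrite -(count_diff (gP l)) natr_sum.
  by apply: eq_bigr => k _; rewrite natr_sum.
under eq_bigr do (under eq_bigr do rewrite mulrA; rewrite -mulr_sumr).
rewrite -mulr_sumr cnt -mulrA; rewrite prodf_div prodr_const card_ord.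
field; rewrite !expf_neq0 //.
Qed.

End Level.

Lemma re_ge0 (z : C) : 0 <= z -> z = (complex.Re z)%:C.
Proof. by case: z => x y; rewrite lecE /= => /andP[/eqP -> _]. Qed.

Lemma fejer_cvg (g : K) : (\prod_(l < N) ((n.+1 - `|g l|)%:R / n.+1%:R : R)) @[n --> \oo] --> (1 : R).
Proof.
have cvg1 (d : nat) : ((n.+1 - d)%:R / n.+1%:R : R) @[n --> \oo] --> (1 : R).
  apply: (@cvg_trans _ ((1 - d%:R * harmonic n : R) @[n --> \oo])).
    apply: near_eq_cvg; near=> n.
    have dn : (d <= n.+1)%N by apply: leqW; near: n; exists d.
    rewrite natrB // -[harmonic n]/(n.+1%:R^-1); have : n.+1%:R != 0 :> R by rewrite pnatr_eq0.
    by move: n.+1%:R => x x0; rewrite mulrBl mulfV.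
  have h : (1 - d%:R * harmonic n : R) @[n --> \oo] --> (1 - d%:R * 0 : R).
    by apply: cvgB; [exact: cvg_cst|apply: cvgM; [exact: cvg_cst|exact: cvg_harmonic]].
  by move: h; rewrite mulr0 subr0.
elim: (index_enum _) => [|l s IH].
  by under eq_fun do rewrite big_nil; exact: cvg_cst.
have h := cvgM (cvg1 `|g l|%N) IH; rewrite mulr1 in h.
by under eq_fun do rewrite big_cons; exact: h.
Unshelve. all: by end_near. Qed.

Lemma phase_lip g x y d : (forall l, `|x l - y l| <= d) ->
  `|phase g x - phase g y| <= (\sum_l `|(g l)%:~R : R|) * d.
Proof.
move=> xy; rewrite /phase -sumrB mulr_suml; apply: le_trans (ler_norm_sum _ _ _) _.
by apply: ler_sum => l _; rewrite -mulrBr normrM ler_wpM2l.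
Qed.

Lemma measurable_circ (f : R -> R) : measurable_fun [set: R] f ->
  measurable_fun [set: R] ((fun x => complex.Re (circ (f x))) : R -> R) /\
  measurable_fun [set: R] ((fun x => complex.Im (circ (f x))) : R -> R).
Proof.
move=> mf; have mm : measurable_fun [set: R] ((fun x => pi *+ 2 * f x) : R -> R).
  by apply: measurable_funM => //; exact: measurable_cst.
split; rewrite /circ /=.
  by apply: (measurableT_comp (f := cos)) mm; apply: continuous_measurable_fun; exact: continuous_cos.
by apply: (measurableT_comp (f := sin)) mm; apply: continuous_measurable_fun; exact: continuous_sin.
Qed.

Lemma measurable_phase g (D : R -> 'I_N -> R) : (forall l, measurable_fun [set: R] (D ^~ l : R -> R)) ->
  measurable_fun [set: R] ((fun x => phase g (D x)) : R -> R).
Proof.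
move=> mD; apply: measurable_sum => l; apply: measurable_funM; [exact: measurable_cst|exact: mD].
Qed.

Theorem herglotz : exists D : R -> 'I_N -> R,
  (forall l, measurable_fun [set: R] (D ^~ l : R -> R)) /\
  forall g : K,
    \int[@lebesgue_measure R]_(x in `[0, complex.Re (a 0)[) complex.Re (circ (- phase g (D x))) = complex.Re (a g) /\
    \int[@lebesgue_measure R]_(x in `[0, complex.Re (a 0)[) complex.Im (circ (- phase g (D x))) = complex.Im (a g).
Proof.
pose m n := (2 * n.+1)%N.
pose w n (j : {ffun 'I_N -> 'I_(m n)}) : R := complex.Re (weightC j).
have wE n (j : {ffun 'I_N -> 'I_(m n)}) : weightC j = (w n j)%:C by apply/re_ge0/weightC_ge0.
have w_ge0 n j : 0 <= w n j by have := @weightC_ge0 n.+1 j; rewrite wE lecR.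
have mom n (g : K) : (forall l, (`|g l| <= n.+1)%N) ->
    \sum_(j : {ffun 'I_N -> 'I_(m n)}) (w n j)%:C * circ (- phase g (fun l => (j l)%:R / (m n)%:R)) =
    (\prod_(l < N) ((n.+1 - `|g l|)%:R / n.+1%:R))%:C * a g.
  move=> gn; have := weight_moment (P := n.+1) isT gn.
  under eq_bigr do rewrite wE.
  move=> ->; rewrite mulrC; congr (_ * _); rewrite rmorph_prod; apply: eq_bigr => l _.
  by rewrite /= fmorph_div !rmorph_nat.
have ReZ (x : R) (z : C) : complex.Re (x%:C * z) = x * complex.Re z.
  by case: z => u v /=; rewrite mul0r subr0.
have ImZ (x : R) (z : C) : complex.Im (x%:C * z) = x * complex.Im z.
  by case: z => u v /=; rewrite mul0r addr0.
(* At [g = 0] the Fejer factor is 1, so every level has the same total mass. *)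
have w_sum n : \sum_j w n j = complex.Re (a 0).
  have := congr1 (@complex.Re R) (mom n 0 (fun l => ltac:(by rewrite ffunE))).
  rewrite ReZ; have -> : \prod_(l < N) ((n.+1 - `|(0 : K) l|)%:R / n.+1%:R) = 1 :> R.
    by apply: big1 => l _; rewrite ffunE subn0 divff ?pnatr_eq0.
  have e (F : _ -> C) : complex.Re (\sum_j F j) = \sum_j complex.Re (F j) := raddf_sum (@complex.Re R) _ _ _.
  rewrite mul1r => <-; rewrite e; apply: eq_bigr => j _; rewrite ReZ.
  have -> : phase 0 (fun l => (j l)%:R / (m n)%:R) = 0.
    by rewrite /phase big1 // => l _; rewrite ffunE mul0r.
  by rewrite oppr0 circ0 mulr1.
have m_gt0 n : (0 < m n)%N by [].
have [D [mD hD]] := weak_limit m_gt0 w_ge0 w_sum.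
exists D; split => // g.
have mN : measurable_fun [set: R] ((fun x => - phase g (D x)) : R -> R).
  by apply: measurable_funN; apply: measurable_phase.
have [mRe mIm] := measurable_circ mN.
have unif e : 0 < e -> exists2 d, 0 < d & forall x y, (forall l : 'I_N, `|x l - y l| <= d) ->
    `|complex.Re (circ (- phase g x)) - complex.Re (circ (- phase g y))| <= e /\
    `|complex.Im (circ (- phase g x)) - complex.Im (circ (- phase g y))| <= e.
  move=> e0; have [d d0 hd] := circ_unif e0.
  set S := \sum_l `|(g l)%:~R : R|; have S0 : 0 <= S by apply: sumr_ge0.
  exists (d / (S + 1)); first by rewrite divr_gt0 //; lra.
  move=> x y xy; apply: hd; rewrite -opprD normrN.
  apply: le_trans (phase_lip g xy) _; rewrite -/S mulrA ler_pdivrMr; last lra.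
  by rewrite mulrC ler_pM2l //; lra.
(* Stated for the real and the imaginary part together. The moment formula holds once [n] exceeds
   all [|g l|], and its Fejer factor tends to 1. *)
have lim (p : {additive C -> R}) : (forall x z, p (x%:C * z) = x * p z) ->
   (\sum_(j : {ffun 'I_N -> 'I_(m n)}) p (circ (- phase g (fun l => (j l)%:R / (m n)%:R))) * w n j) @[n --> \oo] --> p (a g).
  move=> pZ; have h : ((\prod_(l < N) ((n.+1 - `|g l|)%:R / n.+1%:R : R)) * p (a g)) @[n --> \oo] --> p (a g).
    have := cvgM (fejer_cvg g) (cvg_cst (p (a g))); rewrite mul1r; exact.
  apply: cvg_trans h; apply: near_eq_cvg; near=> n.
  rewrite -pZ -mom; last first.
    move=> l; apply: leqW; apply: (@leq_trans (\sum_l `|g l|)%N); first by rewrite (bigD1 l) //= leq_addr.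
    by near: n; exists (\sum_l `|g l|)%N.
  by rewrite raddf_sum; apply: eq_bigr => j _; rewrite pZ mulrC.
split; [apply: (hD (fun x => complex.Re (circ (- phase g x))) 1)|apply: (hD (fun x => complex.Im (circ (- phase g x))) 1)] => //.
- by move=> e /unif [d d0 h]; exists d => // x y /h [].
- by move=> x; rewrite ler_norml cos_geN1 cos_le1.
- exact: (lim (@complex.Re R)).
- by move=> e /unif [d d0 h]; exists d => // x y /h [].
- by move=> x; rewrite ler_norml sin_geN1 sin_le1.
- exact: (lim (@complex.Im R)).
Unshelve. all: by end_near. Qed.

End Herglotz.

(** * Measures on the torus *)

Section FinitePushforward.
Context d d' (T1 : measurableType d) (T2 : measurableType d') (R : realType).
Variables (m : {measure set T1 -> \bar R}) (f : T1 -> T2).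
Hypothesis mf : measurable_fun [set: T1] f.
Hypothesis m_fin : (m [set: T1] < +oo)%E.

Lemma finite_pushforward : exists nu : {finite_measure set T2 -> \bar R},
  forall (A : set T2) (g : T2 -> R), measurable A -> measurable_fun [set: T2] g ->
    m.-integrable (f @^-1` A) (EFin \o (g \o f)) ->
    \int[nu]_(y in A) g y = \int[m]_(x in f @^-1` A) g (f x).
Proof.
have [nu0 nu0E] : exists nu0 : {measure set T2 -> \bar R}, nu0 = pushforward m f :> (set T2 -> \bar R).
  unshelve eexists (pushforward m f : {measure set T2 -> \bar R}); [exact: mf|by []].
have fin : fin_num_fun nu0.
  apply: lty_fin_num_fun; rewrite nu0E /pushforward preimage_setT; exact: m_fin.
have sfin : sigma_finite setT nu0 by apply: fin_num_fun_sigma_finite fin; rewrite measure0 ltry.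
pose H1 := isFinite.Build _ _ _ _ fin.
pose H2 := isSFinite.Build _ _ _ _ (sfinite_measure_sigma_finite sfin).
pose H3 := isSigmaFinite.Build _ _ _ _ sfin.
pose nu := HB.pack_for (FiniteMeasure.type T2 R) (Measure.sort nu0) H1 H2 H3.
exists nu => A g mA mg ig.
rewrite /Rintegral -[Measure.sort nu]/(nu0 : set T2 -> \bar R) nu0E.
by rewrite (integral_pushforward mf) //; exact/measurable_EFinP.
Qed.
End FinitePushforward.

Lemma integral_mrestr d (T : measurableType d) (R : realType) (mu : {measure set T -> \bar R})
  (D : set T) (mD : measurable D) (f : T -> \bar R) :
  (mrestr mu mD).-integrable [set: T] f ->
  (\int[mrestr mu mD]_x f x = \int[mu]_(x in D) f x)%E.
Proof.
move=> fi; rewrite [LHS](@negligible_integral _ _ _ _ _ (~` D)) //.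
- rewrite setDE setCK setTI; apply: eq_measure_integral => A mA AD.
  by rewrite /= /mrestr setIidl.
- exact: measurableC.
- by rewrite /= /mrestr setICl measure0.
Qed.

Section Push.
Variables (R : realType) (N : nat) (M : R) (D : R -> 'I_N -> R).
Hypothesis mD : forall l, measurable_fun [set: R] (D ^~ l : R -> R).
Local Notation CN := (CN R N).
Local Notation torus := (@torus R N).

Definition circle_map (x : measurableTypeR R) : CN := fun l => circ (D x l).

Lemma measurable_circle_map : measurable_fun [set: measurableTypeR R] circle_map.
Proof.
apply: (@measurability _ _ (measurableTypeR R) (g_sigma_algebraType (@cgen R N)) setT circle_map (@cgen R N)) => //.
move=> _ [A [j [U [oU hA]]] <-].
have [mRe mIm] := measurable_circ (mD j).
have mU : measurable U by apply: open_measurable.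
case: hA => ->; [exact: mRe|exact: mIm].
Qed.

Lemma circle_map_torus x : torus (circle_map x).
Proof. by move=> j; rewrite norm_circ. Qed.

End Push.

(** * Integration of trigonometric polynomials over the torus *)

Section TorusIntegral.
Variables (R : realType) (N : nat).
Local Notation C := R[i].
Local Notation CN := (CN R N).
Local Notation torus := (@torus R N).
Local Notation K := (K N).

Definition cmeasurable (f : CN -> C) : Prop :=
  measurable_fun [set: CN] (fun x => complex.Re (f x)) /\
  measurable_fun [set: CN] (fun x => complex.Im (f x)).

Lemma cmeasurable_coord l : cmeasurable (fun x => x l).
Proof.
have h (p : C -> R) : (forall U : set R, open U -> cgen ((fun x : 'I_N -> C => p (x l)) @^-1` U)) ->
    measurable_fun [set: CN] (fun x : CN => p (x l)).
  move=> hp; apply: (measurability _ (RGenOInfty.measurableE R)) => // _ [_ [y ->] <-].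
  rewrite setTI; apply: sub_sigma_algebra; apply: hp; exact: interval_open.
by split; apply: h => U oU; exists l, U; split=> //; [left|right].
Qed.

Lemma cmeasurableM f g : cmeasurable f -> cmeasurable g -> cmeasurable (fun x => f x * g x).
Proof.
move=> [f1 f2] [g1 g2]; split.
  rewrite (_ : (fun x => complex.Re (f x * g x)) = fun x => complex.Re (f x) * complex.Re (g x) - complex.Im (f x) * complex.Im (g x)).
    by apply: measurable_funB; apply: measurable_funM.
  by apply: funext => x; case: (f x) (g x) => [? ?] [? ?].
rewrite (_ : (fun x => complex.Im (f x * g x)) = fun x => complex.Re (f x) * complex.Im (g x) + complex.Im (f x) * complex.Re (g x)).
  by apply: measurable_funD; apply: measurable_funM.
by apply: funext => x; case: (f x) (g x) => [? ?] [? ?].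
Qed.

Lemma cmeasurable_cst c : cmeasurable (fun=> c).
Proof. by split; apply: measurable_cst. Qed.

Lemma cmeasurable_conj f : cmeasurable f -> cmeasurable (fun x => ((f x)^*)%R).
Proof.
move=> [f1 f2]; split.
  by rewrite (_ : (fun x => _) = fun x => complex.Re (f x)) //; apply: funext => x; case: (f x).
rewrite (_ : (fun x => _) = fun x => - complex.Im (f x)); first exact: measurable_funN.
by apply: funext => x; case: (f x).
Qed.

Lemma conj_torus (z : C) : `|z| = 1 -> ((z^*)%R) = z^-1.
Proof.
move=> z1; have z0 : z != 0 by rewrite -normr_eq0 z1 oner_eq0.
by apply: (mulfI z0); rewrite -normCK z1 expr1n mulfV.
Qed.

Lemma measurable_torus : measurable (torus : set CN).
Proof.
have -> : torus = \bigcap_(l in [set: 'I_N])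
    ((fun x : CN => complex.Re (x l) ^+ 2 + complex.Im (x l) ^+ 2) @^-1` [set (1 : R)]).
  apply/seteqP; split=> x h l => [_|].
    have := h l; rewrite normc_def => /(congr1 (@complex.Re R)) /= e.
    by rewrite -[LHS]sqr_sqrtr ?e ?expr1n // addr_ge0 // sqr_ge0.
  by have /= := h l I; rewrite normc_def => ->; rewrite sqrtr1.
apply: fin_bigcap_measurable => // l _.
have [mRe mIm] := cmeasurable_coord l.
have mf : measurable_fun [set: CN] (fun x : CN => complex.Re (x l) ^+ 2 + complex.Im (x l) ^+ 2).
  by apply: measurable_funD; apply: measurable_funX.
by rewrite -[X in measurable X]setTI; apply: mf.
Qed.

(** Measurability is asked of some [g] that agrees with [f] on the torus: negative powers are then
    treated as powers of the conjugate, which is the inverse there. *)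
Definition torus_fun (f : CN -> C) : Prop := exists g b, cmeasurable g /\
  forall x, torus x -> f x = g x /\ `|f x| <= b%:C.

Lemma torus_fun_cst c : torus_fun (fun=> c).
Proof.
exists (fun=> c), (complex.Re `|c|); split; first exact: cmeasurable_cst.
by move=> x _; split=> //; rewrite normc_def.
Qed.

Lemma torus_funM f g : torus_fun f -> torus_fun g -> torus_fun (fun x => f x * g x).
Proof.
move=> [f' [b [mf fb]]] [g' [c [mg gc]]]; exists (fun x => f' x * g' x), (b * c).
split; first exact: cmeasurableM.
move=> x tx; have [-> h1] := fb x tx; have [-> h2] := gc x tx; split=> //.
by rewrite normrM rmorphM; apply: ler_pM.
Qed.

Lemma cmeasurableD f g : cmeasurable f -> cmeasurable g -> cmeasurable (fun x => f x + g x).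
Proof.
move=> [f1 f2] [g1 g2]; split.
  rewrite (_ : (fun x => complex.Re (f x + g x)) = fun x => complex.Re (f x) + complex.Re (g x)).
    exact: measurable_funD.
  by apply: funext => x; case: (f x) (g x) => [? ?] [? ?].
rewrite (_ : (fun x => complex.Im (f x + g x)) = fun x => complex.Im (f x) + complex.Im (g x)).
  exact: measurable_funD.
by apply: funext => x; case: (f x) (g x) => [? ?] [? ?].
Qed.

Lemma torus_funD f g : torus_fun f -> torus_fun g -> torus_fun (fun x => f x + g x).
Proof.
move=> [f' [b [mf fb]]] [g' [c [mg gc]]]; exists (fun x => f' x + g' x), (b + c).
split; first exact: cmeasurableD.
move=> x tx; have [<- h1] := fb x tx; have [<- h2] := gc x tx; split=> //.
by rewrite rmorphD; apply: le_trans (ler_normD _ _) (lerD h1 h2).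
Qed.

Lemma torus_fun_sum J (s : seq J) (f : J -> CN -> C) : (forall j, torus_fun (f j)) ->
  torus_fun (fun x => \sum_(j <- s) f j x).
Proof.
move=> hf; elim: s => [|j s IH].
  by under eq_fun do rewrite big_nil; exact: torus_fun_cst.
by under eq_fun do rewrite big_cons; exact: torus_funD.
Qed.

Lemma torus_fun_prod J (s : seq J) (f : J -> CN -> C) : (forall j, torus_fun (f j)) ->
  torus_fun (fun x => \prod_(j <- s) f j x).
Proof.
move=> hf; elim: s => [|j s IH].
  by under eq_fun do rewrite big_nil; exact: torus_fun_cst.
by under eq_fun do rewrite big_cons; exact: torus_funM.
Qed.

Lemma torus_fun_coord l : torus_fun (fun x => x l).
Proof.
exists (fun x => x l), 1; split; first exact: cmeasurable_coord.
by move=> x /(_ l) ->.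
Qed.

Lemma torus_fun_conj f : torus_fun f -> torus_fun (fun x => ((f x)^*)%R).
Proof.
move=> [g [b [mg hb]]]; exists (fun x => ((g x)^*)%R), b; split; first exact: cmeasurable_conj.
by move=> x /hb [<- h]; rewrite norm_conjC.
Qed.

Lemma torus_fun_eq f g : (forall x, torus x -> f x = g x) -> torus_fun f -> torus_fun g.
Proof. by move=> e [h [b [mh hb]]]; exists h, b; split=> // x tx; rewrite -e //; apply: hb. Qed.

Lemma torus_fun_xpow k : torus_fun (fun x => xpow x k).
Proof.
apply: torus_fun_prod => l.
have pw f n : torus_fun f -> torus_fun (fun x => f x ^+ n).
  move=> hf; elim: n => [|n IH]; first exact: torus_fun_cst.
  by under eq_fun do rewrite exprS; exact: torus_funM.
case: (k l) => n; first by apply: pw; apply: torus_fun_coord.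
apply: (@torus_fun_eq (fun x => (((x l)^*)%R) ^+ n.+1)); last exact/pw/torus_fun_conj/torus_fun_coord.
by move=> x /(_ l) xl; rewrite conj_torus // NegzE -exprnN exprVn.
Qed.

Lemma xpow_torus x k k' : torus x -> ((xpow x k)^*)%R * xpow x k' = xpow x (k' - k).
Proof.
move=> tx; rewrite /xpow rmorph_prod -big_split; apply: eq_bigr => l _ /=.
have xl := tx l; have xu : x l \is a GRing.unit by rewrite unitfE -normr_eq0 xl oner_eq0.
have -> : ((x l ^ k l)^*)%R = (x l ^ k l)^-1.
  apply: conj_torus; case: (k l) => m; first by rewrite -exprnP normrX xl expr1n.
  by rewrite NegzE -exprnN normfV normrX xl expr1n invr1.
by rewrite !ffunE expfzDr -?unitfE // invr_expz mulrC.
Qed.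

Section Rint.
Variable nu : {finite_measure set CN -> \bar R}.

Lemma torus_fun_integrable f : torus_fun f ->
  nu.-integrable torus (EFin \o (fun x => complex.Re (f x))) /\
  nu.-integrable torus (EFin \o (fun x => complex.Im (f x))).
Proof.
move=> [g [b [[g1 g2] fb]]].
have tfin : (nu torus < +oo)%E.
  by rewrite ltey_eq fin_num_measure //; apply: measurable_torus.
have bnd x : torus x -> `|complex.Re (f x)| <= b /\ `|complex.Im (f x)| <= b.
  move=> /fb [_ h]; rewrite -2!lecR; split; apply: le_trans h; first exact: normc_ge_Re.
  by rewrite normc_def lecR -sqrtr_sqr; apply: ler_wsqrtr; rewrite lerDr sqr_ge0.
split; apply: (bounded_integrable measurable_torus (b := b)) => //.
- apply: (eq_measurable_fun (fun x => complex.Re (g x))); last exact: measurable_funS g1.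
  by move=> x /set_mem /fb [-> _].
- by move=> x /bnd [].
- apply: (eq_measurable_fun (fun x => complex.Im (g x))); last exact: measurable_funS g2.
  by move=> x /set_mem /fb [-> _].
- by move=> x /bnd [].
Qed.

Lemma rint_eq f g : (forall x, torus x -> f x = g x) -> rint nu f = rint nu g.
Proof.
move=> e; rewrite /rint; congr (_ +i* _); apply: eq_Rintegral => x /set_mem tx; by rewrite e.
Qed.

Lemma rint_lin c f g : torus_fun f -> torus_fun g -> rint nu (fun x => c * f x + g x) = c * rint nu f + rint nu g.
Proof.
move=> tf tg; have [f1 f2] := torus_fun_integrable tf; have [g1 g2] := torus_fun_integrable tg.
have mt := measurable_torus.
have iZ (h : CN -> R) (r : R) : nu.-integrable torus (EFin \o h) -> nu.-integrable torus (EFin \o (fun x => r * h x)).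
  move=> ih; rewrite (_ : EFin \o _ = fun x => (r%:E * (h x)%:E)%E); first exact: integrableZl.
  by apply: funext => x /=; rewrite EFinM.
have iD (h h' : CN -> R) : nu.-integrable torus (EFin \o h) -> nu.-integrable torus (EFin \o h') ->
    nu.-integrable torus (EFin \o (fun x => h x + h' x)).
  move=> ih ih'; rewrite (_ : EFin \o _ = fun x => ((h x)%:E + (h' x)%:E)%E); first exact: integrableD.
  by apply: funext => x /=; rewrite EFinD.
have lin3 (h1 h2 h3 : CN -> R) (r1 r2 : R) : nu.-integrable torus (EFin \o h1) ->
    nu.-integrable torus (EFin \o h2) -> nu.-integrable torus (EFin \o h3) ->
    \int[nu]_(x in torus) (r1 * h1 x + r2 * h2 x + h3 x) =
    r1 * \int[nu]_(x in torus) h1 x + r2 * \int[nu]_(x in torus) h2 x + \int[nu]_(x in torus) h3 x.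
  by move=> i1 i2 i3; rewrite !RintegralD ?RintegralZl //; first [exact: iZ|apply: iD; exact: iZ].
rewrite /rint.
have eR (z1 z2 z3 : C) : complex.Re (z1 * z2 + z3) = complex.Re z1 * complex.Re z2 + (- complex.Im z1) * complex.Im z2 + complex.Re z3.
  by case: z1 z2 z3 => [? ?] [? ?] [? ?] /=; rewrite mulNr.
have eI (z1 z2 z3 : C) : complex.Im (z1 * z2 + z3) = complex.Re z1 * complex.Im z2 + complex.Im z1 * complex.Re z2 + complex.Im z3.
  by case: z1 z2 z3 => [? ?] [? ?] [? ?].
rewrite (@eq_Rintegral _ _ _ nu torus _ (fun x => complex.Re (c * f x + g x)) (fun x _ => eR c (f x) (g x))).
rewrite (@eq_Rintegral _ _ _ nu torus _ (fun x => complex.Im (c * f x + g x)) (fun x _ => eI c (f x) (g x))).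
rewrite !lin3 //; case: c => cr ci /=; apply/eqP; rewrite eq_complex /=; apply/andP; split; apply/eqP; ring.
Qed.

Lemma rint_sum J (s : seq J) (c : J -> C) (f : J -> CN -> C) : (forall j, torus_fun (f j)) ->
  rint nu (fun x => \sum_(j <- s) c j * f j x) = \sum_(j <- s) c j * rint nu (f j).
Proof.
move=> tf; have tcf j : torus_fun (fun x => c j * f j x) by apply: torus_funM => //; apply: torus_fun_cst.
elim: s => [|j s IH].
  have := rint_lin 1 (torus_fun_cst 0) (torus_fun_cst 0).
  rewrite (@rint_eq _ (fun=> 0)) => [|x _]; last by rewrite mulr0 addr0.
  rewrite mul1r => /eqP; rewrite eq_sym -subr_eq0 addrK big_nil => /eqP h.
  by rewrite -[RHS]h; apply: rint_eq => x _; rewrite big_nil.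
rewrite big_cons -IH -rint_lin //; last exact: torus_fun_sum.
by apply: rint_eq => x _; rewrite big_cons.
Qed.

End Rint.

Theorem herglotz_measure (a : K -> C) :
  (forall (s : seq K) (c : K -> C), 0 <= \sum_(k <- s) \sum_(k' <- s) ((c k)^*)%R * c k' * a (k - k')) ->
  exists nu : {finite_measure set CN -> \bar R}, forall g, rint nu (fun x => xpow x (- g)) = a g.
Proof.
move=> a_pos; have [D [mD hD]] := herglotz a_pos.
set M := complex.Re (a 0) in hD.
have mI : measurable (`[0, M[ : set (measurableTypeR R)) by exact: measurable_itv.
(* Lebesgue measure is first restricted to [[0, M[], because its image must be finite on the whole
   space. *)
have mfin : (mrestr (@lebesgue_measure R) mI [set: measurableTypeR R] < +oo)%E.
  by rewrite /mrestr setTI; exact: leb_dom_fin.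
have [nu hnu] := finite_pushforward (measurable_circle_map mD) mfin.
exists nu => g; have [k [b [[mk1 mk2] hk]]] := torus_fun_xpow (- g).
rewrite (rint_eq _ (fun x tx => proj1 (hk x tx))).
have pre : circle_map D @^-1` torus = [set: measurableTypeR R].
  by apply/seteqP; split=> // x _; apply: circle_map_torus.
have kE x : k (circle_map D x) = circ (- phase g (D x)).
  rewrite -(proj1 (hk _ (circle_map_torus D x))) /xpow /circle_map -phaseN /phase circ_sum.
  by apply: eq_bigr => l _; rewrite circXz.
have key (p : C -> R) : measurable_fun [set: CN] (fun y => p (k y)) -> (forall z, `|p (circ z)| <= 1) ->
    Rintegral nu torus (fun y => p (k y)) =
    \int[@lebesgue_measure R]_(x in `[0, M[) p (circ (- phase g (D x))).
  move=> mp pb.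
  have iF : (mrestr (@lebesgue_measure R) mI).-integrable [set: measurableTypeR R]
      (EFin \o ((fun y => p (k y)) \o circle_map D)).
    apply: (@bounded_integrable _ (measurableTypeR R) R (mrestr (@lebesgue_measure R) mI) _ measurableT _ 1 mfin) => [|x _ /=].
      exact: measurableT_comp mp (measurable_circle_map mD).
    by rewrite kE.
  rewrite hnu ?pre //; first last.
    exact: measurable_torus.
  rewrite /Rintegral (integral_mrestr iF); congr fine; apply: eq_integral => x _ /=.
  by rewrite kE.
have [hR hI] := hD g.
rewrite /rint (key (@complex.Re R)) // => [|z]; last by rewrite ler_norml cos_geN1 cos_le1.
rewrite (key (@complex.Im R)) // => [|z]; last by rewrite ler_norml sin_geN1 sin_le1.
by rewrite hR hI; case: (a g).
Qed.
End TorusIntegral.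

(** * The matrix of measures *)

Section Measures.
Variables (R : realType) (n : nat) (t : seq nat).
Local Notation N := n.+1.
Local Notation Y := (rsyt N t).
Local Notation C := R[i].
Local Notation V := (V R N t).
Local Notation K := (K N).
Local Notation LP := (K -> V).
Local Notation CN := (CN R N).
Local Notation is_lp := (@is_lp R N t).
Local Notation mono := (@lp_mono R N t).
Local Notation bv := (@basisv R N t).
Hypothesis tP : is_partition_of N t.
Hypothesis n_gt0 : (0 < n)%N.
Variable kappa : R.
Hypothesis kb : `|kappa| * (hook t)%:R < 1.
Local Notation B := (@lpform R N t kappa).

#[local] Opaque lp_mulx lp_mono lpform xpow.

Let hm k (v : V) : is_lp (mono k v) := @is_lp_mono R n t k v.

Lemma mono_lin k z (u v : V) : mono k (z *: u + v) = z *: mono k u + mono k v.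
Proof.
by apply: boolp.funext => l; rewrite lpDE lpZE !monoE; case: eqP; rewrite ?scaler0 ?addr0.
Qed.

Lemma lpform_monoB k k' u v : B (mono (k - k') u) (mono 0 v) = B (mono k u) (mono k' v).
Proof. by rewrite -(lpform_mulx tP n_gt0 kb k') // !mulx_mono subrK add0r. Qed.

(** By invariance under monomials the double sum is the square of the norm of [f], the sum of the
    [c k x^k v]. *)
Lemma moment_pos v (s : seq K) (c : K -> C) :
  0 <= \sum_(k <- s) \sum_(k' <- s) (c k)^*%R * c k' * B (mono (k - k') v) (mono 0 v).
Proof.
pose f := \sum_(k <- s) c k *: mono k v.
have hf : is_lp f by apply: is_lp_sum => k _; apply: is_lpZ.
have := lpform_ge0 tP n_gt0 kb hf; congr (0 <= _).
rewrite {1}/f lpform_suml //; apply: eq_bigr => k _.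
rewrite /f lpform_sumr // mulr_sumr; apply: eq_bigr => k' _.
by rewrite lpform_monoB mulrA.
Qed.

Definition moment (u v : V) (g : K) : C := B (mono g u) (mono 0 v).

Definition nu (v : V) : {finite_measure set CN -> \bar R} :=
  projT1 (cid (@herglotz_measure R N (moment v v) (moment_pos v))).

Lemma nuP v g : rint (nu v) (fun x => xpow x (- g)) = moment v v g.
Proof. exact: (projT2 (cid (@herglotz_measure R N (moment v v) (moment_pos v)))). Qed.

Lemma mono00 k : mono k 0 = 0 :> LP.
Proof. by apply: boolp.funext => l; rewrite monoE; case: eqP. Qed.

Lemma momentDl u u' v g : moment (u + u') v g = moment u v g + moment u' v g.
Proof. by rewrite /moment -[u]scale1r mono_lin lpformDl // rmorph1 mul1r scale1r. Qed.

Lemma momentDr u v v' g : moment u (v + v') g = moment u v g + moment u v' g.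
Proof. by rewrite /moment -[v]scale1r mono_lin lpformDr // mul1r scale1r. Qed.

Lemma momentZl z u v g : moment (z *: u) v g = z^*%R * moment u v g.
Proof. by rewrite /moment -[_ *: u]addr0 mono_lin lpformDl // mono00 lpform0l // addr0. Qed.

Lemma momentZr z u v g : moment u (z *: v) g = z * moment u v g.
Proof. by rewrite /moment -[_ *: v]addr0 mono_lin lpformDr // mono00 lpform0r // addr0. Qed.

Definition unitv (T : Y) : V := ((Num.sqrt (norm0 R T))^-1)%:C *: bv T.

#[local] Opaque moment.

Lemma AmatE_unit g T T' : Amat kappa g T T' = moment (unitv T) (unitv T') g.
Proof.
rewrite AmatE // /unitv momentZl momentZr conj_real mulrA -rmorphM /= -invfM sqrtrM //; exact/ltW/norm0_gt0.
Qed.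

Lemma moment_quad (h l : C) u v g : moment (h *: (u + l *: v)) (h *: (u + l *: v)) g =
  h^*%R * h * (moment u u g + l * moment u v g + l^*%R * moment v u g + l^*%R * l * moment v v g).
Proof.
rewrite momentZl momentZr momentDl (momentDr u) (momentDr (_ *: _)) !momentZl !momentZr; ring.
Qed.

(* [4 s(e,e') = q(e+e') - q(e-e') + i (q(e-ie') - q(e+ie'))] for [s] conjugate-linear on the left. *)
Definition polar_coef (j : 'I_4) : C := nth 0 [:: 1; -1; - 'i%R; 'i%R] j.

(** Halving the vector divides its measure by the 4 of the polarization identity. *)
Definition polar (T T' : Y) (j : 'I_4) : V :=
  (2^-1 : C) *: (unitv T + polar_coef j *: unitv T').

(* On the diagonal the polarization is avoided, to get a positive measure. *)
Definition measures (T T' : Y) : cmeasure R N := fun j =>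
  if T == T' then (if j == 0%R then nu (unitv T) else mzero) else nu (polar T T' j).

Lemma cint_sum (mu : cmeasure R N) J (s : seq J) (c : J -> C) (f : J -> CN -> C) :
  (forall j, torus_fun (f j)) ->
  cint mu (fun x => \sum_(j <- s) c j * f j x) = \sum_(j <- s) c j * cint mu (f j).
Proof.
move=> hf; rewrite /cint !rint_sum // -!sumrB mulr_sumr -big_split; apply: eq_bigr => j _ /=; ring.
Qed.

Lemma cint_eq (mu : cmeasure R N) f g : (forall x, torus x -> f x = g x) -> cint mu f = cint mu g.
Proof. by move=> e; rewrite /cint !(fun nu => rint_eq nu e). Qed.

Lemma rint_mzero (f : CN -> C) : rint mzero f = 0.
Proof. by rewrite /rint /Rintegral !integral_measure_zero. Qed.

Lemma conjN (z : C) : ((- z)^*)%R = - (z^*)%R.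
Proof. by case: z. Qed.

Lemma conjM (z w : C) : ((z * w)^*)%R = (z^*)%R * (w^*)%R.
Proof. exact: rmorphM. Qed.

Lemma conj_sum J (s : seq J) (F : J -> C) :
  ((\sum_(j <- s) F j)^*)%R = \sum_(j <- s) ((F j)^*)%R.
Proof. exact: rmorph_sum. Qed.

Lemma cint_measures T T' g : cint (measures T T') (fun x => xpow x (- g)) = Amat kappa g T T'.
Proof.
rewrite AmatE_unit /cint /measures; case: eqP => [<-|_].
  by rewrite eqxx /= nuP !rint_mzero !subr0 mulr0 addr0.
pose q (j : 'I_4) := moment (polar T T' j) (polar T T' j) g.
transitivity (q 0 - q 1 + 'i * (q 2%:R - q 3%:R)).
  by congr (_ - _ + _ * (_ - _)); apply: nuP.
have h2 : ((2^-1 : C)^*)%R = 2^-1 by rewrite fmorphV rmorph_nat.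
have qE j l l' : polar_coef j = l -> l^*%R = l' -> q j = 2^-1 * 2^-1 *
    (moment (unitv T) (unitv T) g + l * moment (unitv T) (unitv T') g
    + l' * moment (unitv T') (unitv T) g + l' * l * moment (unitv T') (unitv T') g).
  by move=> e <-; rewrite /q /polar e moment_quad h2.
have ci : ('i%R : C)^*%R = - 'i%R := conjCi _.
have cni : (- 'i%R : C)^*%R = 'i%R by rewrite conjN ci opprK.
rewrite (qE 0 1 1 erefl (rmorph1 _)) (qE 1 (-1) (-1) erefl) ; last by rewrite conjN rmorph1.
rewrite (qE 2%:R (- 'i%R) 'i%R erefl cni) (qE 3%:R 'i%R (- 'i%R) erefl ci).
have i2 : ('i%R : C) * 'i%R = -1 by rewrite -expr2 sqrCi.
move: (moment (unitv T') (unitv T') g) (moment (unitv T') (unitv T) g)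
  (moment (unitv T) (unitv T') g) (moment (unitv T) (unitv T) g) => a b c d.
move: i2; move: ('i%R : C) => I i2.
have -> : I * (2^-1 / 2 * (d + - I * c + I * b + I * - I * a) - 2^-1 / 2 * (d + I * c + - I * b + - I * I * a)) =
  2^-1 / 2 * (I * I) * (2 * (b - c)) by ring.
rewrite i2; by field.
Qed.

Lemma lp_expandE (f : LP) (s : seq K) : uniq s -> (forall k, f k != 0 -> k \in s) ->
  f = \sum_(k <- s) \sum_T f k T *: mono k (bv T).
Proof.
move=> us hs; rewrite {1}(lp_expand us hs); apply: eq_bigr => k _.
by apply: boolp.funext => l; rewrite lp_sumE monoE; under eq_bigr do rewrite lpZE monoE;
  case: eqP => _; [exact: basisvE|rewrite big1 // => T _; rewrite scaler0].
Qed.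

(** Both sides are expanded in monomials. On the torus the conjugate of [x^k] times [x^k'] is
    [x^(k' - k)], so each term is a moment of [measures T T'], and the square roots in [lp_coord]
    cancel the normalization of [Amat]. *)
Lemma cint_lpform f g : is_lp f -> is_lp g -> B f g =
  \sum_(T : Y) \sum_(T' : Y)
    cint (measures T T') (fun x => (lp_coord f T x)^*%R * lp_coord g T' x).
Proof.
move=> hf hg; have [uf sf] := suppseqP hf; have [ug sg] := suppseqP hg.
set s := suppseq f in uf sf; set s' := suppseq g in ug sg.
have tx k : torus_fun (fun x => xpow x k) := torus_fun_xpow R k.
have coordE T T' : cint (measures T T') (fun x => (lp_coord f T x)^*%R * lp_coord g T' x) =
    \sum_(k <- s) \sum_(k' <- s') (f k T)^*%R * g k' T' * B (mono k (bv T)) (mono k' (bv T')).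
  transitivity (cint (measures T T') (fun x => \sum_(k <- s) 1 * \sum_(k' <- s')
      ((Num.sqrt (norm0 R T))%:C * (Num.sqrt (norm0 R T'))%:C * ((f k T)^*%R * g k' T')) * xpow x (- (k - k')))).
    apply: cint_eq => x xt; rewrite /lp_coord -/(suppseq f) -/(suppseq g) -/s -/s'.
    rewrite conjM conj_real conj_sum mulr_sumr mulr_suml; apply: eq_bigr => k _.
    rewrite mul1r mulr_sumr mulr_sumr; apply: eq_bigr => k' _.
    by rewrite conjM opprB -(xpow_torus k k' xt); ring.
  rewrite cint_sum => [|k]; last by apply: torus_fun_sum => k'; apply: torus_funM => //; apply: torus_fun_cst.
  apply: eq_bigr => k _; rewrite mul1r cint_sum //; apply: eq_bigr => k' _.
  rewrite cint_measures AmatE // lpform_monoB.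
  have n0 (T0 : Y) : (Num.sqrt (norm0 R T0))%:C != 0 :> C.
    by rewrite (inj_eq (@complexI R)) gt_eqF // sqrtr_gt0 norm0_gt0.
  rewrite sqrtrM ?(ltW (norm0_gt0 _ _)) // fmorphV rmorphM /=.
  by move: (n0 T) (n0 T'); move: (B _ _) => b h1 h2; field; rewrite h1 h2.
under eq_bigr do (under eq_bigr do rewrite coordE).
rewrite [in LHS](lp_expandE uf sf) [in LHS](lp_expandE ug sg).
have h1 k : is_lp (\sum_T f k T *: mono k (bv T)) by apply: is_lp_sum => T _; apply: is_lpZ.
have h2 k : is_lp (\sum_T g k T *: mono k (bv T)) by apply: is_lp_sum => T _; apply: is_lpZ.
rewrite lpform_sumlD //; last by apply: is_lp_sum.
transitivity (\sum_(k <- s) \sum_T \sum_(k' <- s') \sum_T'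
    (f k T)^*%R * g k' T' * B (mono k (bv T)) (mono k' (bv T'))).
  apply: eq_bigr => k _; rewrite lpform_suml //; last by apply: is_lp_sum.
  apply: eq_bigr => T _.
  have -> : \sum_(k' <- s') \sum_T' g k' T' *: mono k' (bv T') =
     \sum_(k' <- s') (1 : C) *: \sum_T' g k' T' *: mono k' (bv T').
    by apply: eq_bigr => k' _; rewrite scale1r.
  rewrite lpform_sumr // mulr_sumr; apply: eq_bigr => k' _; rewrite mul1r.
  rewrite lpform_sumr // mulr_sumr; apply: eq_bigr => T' _; by rewrite mulrA.
rewrite exchange_big /=; apply: eq_bigr => T _.
under eq_bigr do rewrite exchange_big /=.
by rewrite exchange_big.
Qed.

Lemma measures_pos T : cm_positive (measures T T).
Proof.
move=> A _ _; rewrite /measures eqxx; split=> //=; exact: measure_ge0.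
Qed.

End Measures.

Local Close Scope classical_set_scope.
Local Close Scope complex_scope.

Theorem theorem4p4 (R : realType) (N : nat) (t : seq nat) (kappa : R) :
  (2 <= N)%N -> is_partition_of N t -> t != [:: N] -> t != nseq N 1%N ->
  - ((hook t)%:R)^-1 < kappa < ((hook t)%:R)^-1 ->
  exists mu : rsyt N t -> rsyt N t -> cmeasure R N,
    [/\ (forall (a : K N) (T T' : rsyt N t),
           cint (mu T T') (fun x => xpow x (- a)) = Amat kappa a T T'),
        (forall T : rsyt N t, cm_positive (mu T T)) &
        (forall f g : LP R N t, is_lp f -> is_lp g ->
           lpform kappa f g =
           \sum_(T : rsyt N t) \sum_(T' : rsyt N t)
              cint (mu T T') (fun x => (lp_coord f T x)^* * lp_coord g T' x))].
Proof.
case: N => // n n_gt0 tP _ _ /andP[k1 k2].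
have hk : (0 < hook t)%N.
  move: tP; rewrite /is_partition_of /hook; case: t {k1 k2} => [|p s] //=.
  by move=> /and3P[_ /andP[p0 _] _]; lia.
have kb : `|kappa| * (hook t)%:R < 1.
  by rewrite -ltr_pdivlMr ?ltr0n // mul1r ltr_norml k1 k2.
exists (measures tP n_gt0 kb); split.
- by move=> a T T'; apply: cint_measures.
- by move=> T; apply: measures_pos.
- by move=> f g hf hg; apply: cint_lpform.
Qed.
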